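(* Assume that $d=2$. Let $\{\ell_n\}$ be any sequence of real numbers such that $\lim_n\ell_n=\infty$ and $\lim_n\log\ell_n/\log n=0$. Let $S_n$ be the location of a typical particle of generation $n$, and let $B(S_n;\ell_n)$ be the ball of radius $\ell_n$ centered at $S_n$. Then, conditional on $G_n$, (A) the number of unoccupied sites (sites of $\mathbb{Z}^2$ containing no particle of generation $n$) in $B(S_n;\ell_n)$ is $o_P(\ell_n^2)$, and (B) the number of particles of generation $n$ in $B(S_n;\ell_n)$ is of order $O_P(\log n\cdot\ell_n^2)$.
   Context: Branching random walk: a nearest neighbor branching random walk on $\mathbb{Z}^d$ with offspring distribution $\mathcal{Q}=\{Q_l\}_{l\ge 0}$ evolves as follows: at each time $n=0,1,2,\dots$ every particle independently produces a random number of offspring with law $\mathcal{Q}$ (which replace it), and each offspring independently moves to a site chosen uniformly at random from the $2d+1$ sites at distance $\le 1$ from the location of its parent. Standing assumptions: $\mathcal{Q}$ has mean $1$ (criticality) and finite, positive variance $\sigma^2$; the process is started by a single particle at the origin at time $0$. Notation: $\mathcal{Z}_n$ is the set of particles in generation $n$; $G_n$ is the event that the process survives to generation $n$ (i.e. $\mathcal{Z}_n\ne\emptyset$). On $G_n$, a typical particle is a particle chosen from $\mathcal{Z}_n$ uniformly at random, the choice being made independently of the evolution of the branching random walk up to time $n$. For random variables $X_n$, positive reals $f(n)$ and events $H_n$ of positive probability: $X_n=O_P(f(n))$ given $H_n$ means that the conditional distributions of $X_n/f(n)$ given $H_n$ are tight; $X_n=o_P(f(n))$ given $H_n$ means that the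 conditional distributions of $X_n/f(n)$ given $H_n$ converge weakly to the point mass at $0$. *)

(* Defs.v *)
From HB Require Import structures.
From mathcomp Require Import all_boot all_order all_algebra finmap.
From mathcomp Require Import all_classical all_reals all_analysis.

Set Implicit Arguments.
Unset Strict Implicit.
Unset Printing Implicit Defensive.

Import Order.TTheory GRing.Theory Num.Theory.
Import numFieldNormedType.Exports.

Local Open Scope classical_set_scope.
Local Open Scope ring_scope.

Section conditional_asymptotics.
Context d (T : measurableType d) (R : realType) (P : probability T R).

(* Meaningful when [H] has positive probability. It is kept as a bare set
   function because [X] need only be measurable on [H]. *)
Definition cond_distribution (H : set T) (X : T -> R) : set R -> \bar R :=
  fun A => (P (H `&` X @^-1` A) * ((fine (P H))^-1)%:E)%E.

Definition tight (I : Type) (D : set I) (mu : I -> set R -> \bar R) : Prop :=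
  forall e : R, 0 < e -> exists K : set R,
    compact K /\ forall i, D i -> (mu i (~` K) <= e%:E)%E.

Definition weak_cvg (mu : nat -> set R -> \bar R) (nu : set R -> \bar R) : Prop :=
  forall g : R -> R, continuous g -> bounded_fun g ->
    (\int[mu n]_x (g x)%:E @[n --> \oo] --> \int[nu]_x (g x)%:E)%E.

(* The normalisation [f n] is only required to be positive eventually; the
   indices with [f n <= 0] (e.g. [f n = ln n * _] at [n <= 1]) are left out of
   the tight family. *)
Definition is_O_P (H : nat -> set T) (X : nat -> T -> R) (f : nat -> R) : Prop :=
  tight [set n | 0 < f n]
    (fun n => cond_distribution (H n) (fun w => X n w / f n)).

Definition is_o_P (H : nat -> set T) (X : nat -> T -> R) (f : nat -> R) : Prop :=
  weak_cvg (fun n => cond_distribution (H n) (fun w => X n w / f n))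
    (dirac (0 : R)).

End conditional_asymptotics.

Section independence.
Context d (T : measurableType d) (R : realType) (P : probability T R).

Definition mutually_independent (I : choiceType) (F : I -> set (set T)) : Prop :=
  forall (J : {fset I}) (A : I -> set T), (forall i, i \in J -> F i (A i)) ->
    P (\bigcap_(i in [set` J]) A i) = (\prod_(i <- J) P (A i))%E.

(* Both assume [E] countable, with its discrete sigma-algebra. *)
Definition discrete_rv (E : Type) (X : T -> E) : Prop :=
  forall x, measurable (X @^-1` [set x]).

Definition events_of (E : Type) (X : T -> E) : set (set T) :=
  [set X @^-1` A | A in [set: set E]].

End independence.

Section offspring_distribution.
Context (R : realType) (Q : nat -> R).
Local Open Scope ereal_scope.

Definition is_distribution : Prop :=
  (forall l, (0 <= Q l)%R) /\ \sum_(0 <= l <oo) (Q l)%:E = 1.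

Definition dist_mean : \bar R := \sum_(0 <= l <oo) (l%:R * Q l)%:E.

(* Meaningful when the mean is finite. *)
Definition dist_variance : \bar R :=
  \sum_(0 <= l <oo) ((l%:R - fine dist_mean) ^+ 2 * Q l)%:E.

End offspring_distribution.

Notation site k := 'rV[int]_k.

Section lattice.
Context (R : realType) (k : nat).

Definition site_dist (x y : site k) : R :=
  Num.sqrt (\sum_(i < k) ((x ord0 i - y ord0 i)%:~R ^+ 2)).

Definition site_ball (x : site k) (r : R) : set (site k) :=
  [set y | site_dist x y <= r].

Lemma finite_site_ball (x : site k) (r : R) : finite_set (site_ball x r).
Proof.
pose N := (Num.truncn `|r|).+1.
have hN : `|r| < N%:R by exact: truncnS_gt.
pose f (u : 'rV['I_(N + N).+1]_k) : site k :=
  \row_i (x ord0 i + (u ord0 i : nat)%:Z - N%:Z).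
apply: (@sub_finite_set _ _ (f @` [set: 'rV['I_(N + N).+1]_k])); last first.
  by apply: finite_image; exact: finite_finset.
move=> y /= hy.
have hi i : (`|y ord0 i - x ord0 i| <= N%:Z)%R.
  have : `|(x ord0 i - y ord0 i)%:~R| <= `|r| :> R.
    apply: le_trans (le_trans hy (ler_norm r)).
    rewrite -sqrtr_sqr /site_dist ler_wsqrtr // (bigD1 i)//= lerDl.
    by apply: sumr_ge0 => j _; exact: sqr_ge0.
  move=> /le_lt_trans/(_ hN)/ltW.
  by rewrite -intr_norm -[N%:R]/(N%:Z%:~R) ler_int distrC.
exists (\row_i inord (absz (y ord0 i - x ord0 i + N%:Z)%R)) => //.
apply/rowP => i; rewrite !mxE.
have := hi i; rewrite ler_norml => /andP[h1 h2].
have h0 : 0 <= y ord0 i - x ord0 i + N%:Z by rewrite -(lerD2r (- N%:Z)) addrK sub0r.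
rewrite inordK; last first.
  rewrite ltnS -lez_nat gez0_abs// PoszD lerD2r//.
by rewrite gez0_abs// addrA addrK addrC subrK.
Qed.

End lattice.

(* Ulam-Harris labels, read from the particle up to the root: the initial
   particle is [[::]], and the [i]-th child (from 0) of [v] is [i :: v]. *)
Notation label := (seq nat).

(* Offspring numbers and displacements are attached to all labels, whether or
   not the particle is ever born. *)
Record branching_random_walk d (T : measurableType d) (R : realType)
    (P : probability T R) (k : nat) (Q : nat -> R) := BranchingRandomWalk {
  offspring : label -> T -> nat ;
  displacement : label -> nat -> T -> site k ;
  offspring_rv : forall v, discrete_rv (offspring v) ;
  displacement_rv : forall v i, discrete_rv (displacement v i) ;
  offspring_law : forall v l, P (offspring v @^-1` [set l]) = (Q l)%:E ;
  displacement_law : forall v i x,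
    P (displacement v i @^-1` [set x])
      = (\1_(site_ball (0 : site k) (1 : R)) x / (2 * k + 1)%:R)%:E ;
  brw_independent : mutually_independent P
    (fun j : (label + label * nat)%type =>
       match j with
       | inl v => events_of (offspring v)
       | inr (v, i) => events_of (displacement v i)
       end)
}.

Section branching_random_walk.
Context d (T : measurableType d) (R : realType) (P : probability T R).
Context (k : nat) (Q : nat -> R) (B : branching_random_walk P k Q).

Fixpoint generation (n : nat) (w : T) : seq label :=
  if n is m.+1 then
    [seq i :: v | v <- generation m w, i <- iota 0 (offspring B v w)]
  else [:: [::]].

Fixpoint location (u : label) (w : T) : site k :=
  if u is i :: v then location v w + displacement B v i w else 0.

Definition survives (n : nat) : set T := [set w | generation n w <> [::]].

(* The sigma-algebra generated by the branching random walk up to time [n]: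
   which particles exist in generations [0..n], and where they are. *)
Definition evolution (n : nat) : set (set T) :=
  <<s [set E | exists u x, (size u <= n)%N /\
         E = [set w | u \in generation (size u) w /\ location u w = x]] >>.

(* On [survives n], [tau] is a uniformly chosen element of [generation n],
   chosen independently of [evolution n]: conditionally on [evolution n] it is
   uniform on [generation n]. Its values off [survives n] are irrelevant. *)
Definition typical_particle (n : nat) (tau : T -> label) : Prop :=
  (forall v, measurable (survives n `&` tau @^-1` [set v])) /\
  (forall v E, evolution n E ->
    P (E `&` survives n `&` tau @^-1` [set v]) =
    (\int[P]_(w in E `&` survives n)
       ((v \in generation n w)%:R / (size (generation n w))%:R)%:E)%E).

Definition num_particles (n : nat) (A : set (site k)) (w : T) : nat :=
  count (fun u => location u w \in A) (generation n w).

Definition unoccupied (n : nat) (w : T) : set (site k) :=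
  [set x | forall u, u \in generation n w -> location u w <> x].

(* [fset_set] is only meaningful on finite sets; see [finite_site_ball]. *)
Definition num_unoccupied (n : nat) (A : set (site k)) (w : T) : nat :=
  #|` fset_set (A `&` unoccupied n w)|%fset.

End branching_random_walk.

(* Main.v *)
Require Import Defs.
From HB Require Import structures.
From mathcomp Require Import all_boot all_order all_algebra finmap.
From mathcomp Require Import zify ring lra.
From mathcomp Require Import all_classical all_reals all_analysis measurable_realfun.

(* Conditionally on survival the generation has at least eta n particles with
   probability close to 1, so a bad property of the typical particle is
   controlled by the expected number of bad particles. For "x + position is
   vacant" and "the ball around the particle is crowded", that number is
   computed by a spine decomposition: with a : Z^2 -> [0, 1] marking the other
   particles, the expectation of sum_v 1[v at y] prod_(u <> v) a(u - y) solves
   a recursion in n whose solution, summed over y, is the mass of a lazy simple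
   random walk killed at the rate 1 - f'(A a_m), where f is the offspring
   generating function, A the average over the five steps, a_0 = a and
   a_(m+1) = f(A a_m). For a = 1 - 1_{x}, the killing rate near the origin is
   of order 1 / (m log m) by the planar heat kernel bounds, so the mass decays
   like a power of log l_n / log n and tends to 0, whence (A). For
   a = 1 - s 1_ball with s of order 1 / (lambda l_n^2 log n), the mass lost is
   at most of order s l_n^2 sum_(m <= n) 1 / m = O(1 / lambda), whence (B). *)

Set Implicit Arguments.
Unset Strict Implicit.
Unset Printing Implicit Defensive.

Import Order.TTheory GRing.Theory Num.Theory.
Import numFieldNormedType.Exports.

Local Open Scope classical_set_scope.
Local Open Scope ring_scope.

(** Survival to generation n has probability of order 1 / n, so the unconditional probability of a
    bad event has to be compared with 1 / n. Choosing one of at least eta n particles divides the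
    expected number M of bad ones by eta n, which yields a conditional probability of order M: it is
    enough to make M small. The lower bound on the population comes from extinction: a generation of
    fewer than eta n particles would die out within about eta n more generations with probability at
    least 1/2, while surviving n but not n + k generations has probability at most of order k / n^2.
    For (A) the obstacle is a lower bound on the killing rate. A side branch meets a given site with
    probability at least of order its expected number of visits divided by a logarithm. Before time
    l_n^2 the site may be out of diffusive reach, so only later times are used; they contribute a
    multiple of log (log n / log l_n), which diverges because log l_n / log n tends to 0. The part
    of the walk beyond the diffusive scale is charged in proportion to the killing rate, so that
    these errors do not add up over time. *)

(** * One-dimensional simple random walk: pointwise bounds of order N^(-1/2) *)

Section simple_walk.
Context (R : realFieldType).

Fixpoint srw (N : nat) (u : int) : R :=
  if N is M.+1 then (srw M (u - 1) + srw M (u + 1)) / 2 else (u == 0)%:R.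

Lemma srw_ge0 N u : 0 <= srw N u.
Proof.
by elim: N u => [|N IH] u /=; rewrite ?ler0n// divr_ge0// addr_ge0.
Qed.

Lemma srwN N u : srw N (- u) = srw N u.
Proof.
elim: N u => [|N IH] u /=; first by rewrite oppr_eq0.
by rewrite -opprD IH (_ : - u + 1 = - (u - 1)) ?IH 1?addrC//; lia.
Qed.

(* The ratio of consecutive binomial coefficients, multiplied out so that it also holds, as 0 = 0, for u of the wrong parity. *)
Lemma srw_ratio N u :
  (N%:R + u%:~R + 2) * srw N (u + 2) = (N%:R - u%:~R) * srw N u.
Proof.
elim: N u => [|N IH] u /=.
  have [->|u0] := eqVneq u 0; first by rewrite /= !mulr0; lra.
  have [u2|] := eqVneq (u + 2) 0; last by rewrite !mulr0.
  by have -> : u = - 2 by [lia]; rewrite /= mulr0 mulr1; lra.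
have := IH (u + 1); have := IH (u - 1).
rewrite (_ : u - 1 + 2 = u + 1); last by lia.
rewrite (_ : u + 1 + 2 = u + 2 + 1); last by lia.
rewrite (_ : u + 2 - 1 = u + 1); last by lia.
rewrite -[N.+1%:R]natr1 (_ : (u - 1)%:~R = u%:~R - 1 :> R) ?rmorphB//
  (_ : (u + 1)%:~R = u%:~R + 1 :> R) ?rmorphD//.
set a := srw N (u - 1); set b := srw N (u + 1); set c := srw N (u + 2 + 1).
move: (u%:~R) => t h1 h2.
have -> : (N%:R + 1 + t + 2) * ((b + c) / 2) =
  ((N%:R + t + 3) * b + (N%:R + (t + 1) + 2) * c) / 2 by field.
rewrite h2.
have -> : (N%:R + 1 - t) * ((a + b) / 2) =
  ((N%:R + 1 - t) * b + (N%:R - (t - 1)) * a) / 2 by field.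
by rewrite -h1; field.
Qed.

(** The absorption identity k C(N + 1, k) = (N + 1) C(N, k - 1), with 2 k = N + 1 + u. *)
Lemma srwS_ratio N u :
  (N%:R + 1 + u%:~R) * srw N.+1 u = (N%:R + 1) * srw N (u - 1).
Proof.
have /= := srw_ratio N (u - 1).
rewrite (_ : u - 1 + 2 = u + 1); last by lia.
rewrite (_ : (u - 1)%:~R = u%:~R - 1 :> R) ?rmorphB//.
move: (srw N (u - 1)) (srw N (u + 1)) (u%:~R) => a b t h.
have -> : (N%:R + 1 + t) * ((a + b) / 2) =
   ((N%:R + 1 + t) * a + (N%:R + (t - 1) + 2) * b) / 2 by field.
by rewrite h; field.
Qed.

Lemma srwS0 N : srw N.+1 0 = srw N 1.
Proof. by rewrite /= sub0r add0r srwN; field. Qed.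

Lemma srwS1 N : (N%:R + 2) * srw N.+1 1 = (N%:R + 1) * srw N 0.
Proof. by rewrite -[0]/(1 - 1 : int) -srwS_ratio; congr (_ * _); lra. Qed.

(** The two bounds feed each other: the value at 0 after N + 1 steps is the value at 1 after N, and
    [srwS1] expresses the value at 1 through the previous value at 0. The second bound has N rather
    than N + 1 on the right so that N (N + 2) <= (N + 1)^2 closes the induction. *)
Lemma srw_center_ub N :
  (N%:R + 1) * srw N 0 ^+ 2 <= 1 /\ (N%:R + 1) ^+ 2 * srw N 1 ^+ 2 <= N%:R.
Proof.
elim: N => [|N [IH0 IH1]]; first by rewrite /=; split; lra.
have N0 : 0 <= N%:R :> R by rewrite ler0n.
rewrite srwS0 -natr1; split; last first.
  rewrite -exprMn (_ : N%:R + 1 + 1 = N%:R + 2); last by lra.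
  rewrite srwS1 exprMn expr2 -mulrA; nra.
have h : 0 < (N%:R + 1 : R) ^+ 2 by apply: exprn_gt0; lra.
rewrite -(ler_pM2l h) mulr1 mulrCA.
apply: (@le_trans _ _ ((N%:R + 1 + 1) * N%:R)); last by nra.
by rewrite ler_wpM2l//; lra.
Qed.

Lemma srw_decr N (u : int) : 0 <= u -> srw N (u + 2) <= srw N u.
Proof.
move=> u0; have := srw_ratio N u; have := srw_ge0 N u.
have : 0 <= u%:~R :> R by rewrite ler0z.
have : 0 <= N%:R :> R by rewrite ler0n.
move: (srw N u) (srw N (u + 2)) (u%:~R) (N%:R) => a b t n n0 t0 a0 h.
have : 0 <= (n + t + 2) * (a - b) by rewrite mulrBr h; nra.
by rewrite pmulr_rge0 ?subr_ge0//; lra.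
Qed.

(** Within a parity class the values decrease away from the origin, so it suffices to treat 0 and
    1. *)
Lemma srw_ub N u : (N%:R + 1) * srw N u ^+ 2 <= 1.
Proof.
wlog u0 : u / 0 <= u.
  move=> H; have [/H//|] := lerP 0 u; rewrite -oppr_gt0 => /ltW/H.
  by rewrite srwN.
suff H k (i : bool) : srw N ((i + k.*2)%N%:Z) <= srw N (i : nat)%:Z.
  have {}H : srw N u <= srw N (odd `|u|%N : nat)%:Z.
    by have := H `|u|./2 (odd `|u|); rewrite odd_double_half gez0_abs.
  have N0 : 0 <= N%:R :> R by rewrite ler0n.
  apply: (@le_trans _ _ ((N%:R + 1) * srw N (odd `|u|%N : nat)%:Z ^+ 2)).
    by rewrite ler_wpM2l ?lerXn2r ?nnegrE ?srw_ge0//; lra.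
  have [h0 h1] := srw_center_ub N.
  case: (odd _) => //=.
  have : 0 <= srw N 1 ^+ 2 by apply: sqr_ge0.
  move: (srw N 1 ^+ 2) h1 => a; nra.
elim: k => [|k IH]; first by rewrite addn0.
apply: le_trans IH.
by rewrite (_ : ((i + k.+1.*2)%N)%:Z = (i + k.*2)%N%:Z + 2); [exact: srw_decr|lia].
Qed.

(** Two more steps multiply the return probability by (2 n + 3) / (2 n + 4), and (2 n + 3)^2 >= 4 (n
    + 1) (n + 2). *)
Lemma srw_center_lb n : 1 <= 4 * n.+1%:R * srw n.*2.+2 0 ^+ 2.
Proof.
elim: n => [|n IH]; first by rewrite /=; lra.
have n0 : 0 <= n%:R :> R by rewrite ler0n.
rewrite (_ : n.+1.*2.+2 = n.*2.+4)// (srwS0 n.*2.+3).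
have := srwS1 n.*2.+2; move: IH.
rewrite (_ : n.*2.+2%:R = n%:R * 2 + 2 :> R); last by rewrite -muln2 -addn2 natrD natrM.
rewrite (_ : n.+1%:R = n%:R + 1 :> R); last by rewrite natr1.
rewrite (_ : n.+2%:R = n%:R + 1 + 1 :> R); last by rewrite !natr1.
move: (srw _ 0) (srw _ 1) => a b h1 h2.
have h : 0 < ((n%:R + 2) * (n%:R + 2) : R) by rewrite mulr_gt0//; lra.
rewrite -(ler_pM2l h) mulr1.
have -> : (n%:R + 2) * (n%:R + 2) * (4 * (n%:R + 1 + 1) * b ^+ 2)
   = (n%:R + 2) * ((n%:R * 2 + 2 + 2) * b) ^+ 2 by ring.
rewrite h2.
have -> : (n%:R + 2) * ((n%:R * 2 + 2 + 1) * a) ^+ 2 =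
  (n%:R + 2) * (n%:R * 2 + 3) ^+ 2 * a ^+ 2 by ring.
move: (a ^+ 2) h1 => q h1.
have : 0 <= q by nra.
move: (n%:R) n0 h1 => t t0 h1 q0.
have : t + 2 <= (t + 2) * (4 * (t + 1) * q) by nra.
nra.
Qed.

Lemma srw_central_lb N : (0 < N)%N ->
  1 <= 4 * N%:R * srw N (odd N : nat)%:Z ^+ 2.
Proof.
have e := odd_double_half N; case: (odd N) e => e N0; last first.
  case: N N0 e => [//|N] _ e.
  have := srw_center_lb N./2; rewrite (_ : N./2.*2.+2 = N.+1); last by lia.
  move=> h; apply: le_trans h _.
  by rewrite ler_wpM2r ?sqr_ge0// ler_wpM2l// ler_nat; lia.
have := srw_center_lb N./2; rewrite srwS0 (_ : N./2.*2.+1 = N)// => h.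
apply: le_trans h _.
by rewrite ler_wpM2r ?sqr_ge0// ler_wpM2l// ler_nat; lia.
Qed.

(** Every ratio (N - v) / (N + v + 2) met between the centre and u is at least 1 - (2 U + 2) / N,
    and there are at most U of them; N >= 2 U + 2 keeps this base nonnegative. *)
Lemma srw_offcenter_lb (N U : nat) (u : int) :
  (2 * U + 2 <= N)%N -> (`|u| <= U)%N -> ~~ odd (N + `|u|) ->
  (1 - (2 * U%:R + 2) / N%:R) ^+ U * srw N (odd N : nat)%:Z <= srw N u.
Proof.
move=> hU.
wlog u0 : u / 0 <= u.
  move=> H; have [/H//|] := lerP 0 u; rewrite -oppr_gt0 => /ltW/H.
  by rewrite srwN abszN.
set y := (1 - _).
have N0 : (0 < N%:R :> R) by rewrite ltr0n; lia.
have y0 : 0 <= y.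
  rewrite subr_ge0 ler_pdivrMr// mul1r -(natrM _ 2) -[2]/(2%:R) -natrD ler_nat.
  by lia.
have y1 : y <= 1 by rewrite gerBl divr_ge0 ?(ltW N0)// addr_ge0// mulr_ge0.
suff H k (i : bool) : (i + k.*2 <= U)%N ->
    y ^+ k * srw N (i : nat)%:Z <= srw N (i + k.*2)%N%:Z.
  move=> uU par.
  have -> : odd N = odd `|u| by move: par; rewrite oddD; case: odd; case: odd.
  have := H `|u|./2 (odd `|u|); rewrite odd_double_half gez0_abs// => /(_ uU).
  apply: le_trans; rewrite ler_wpM2r ?srw_ge0//.
  by apply: ler_wiXn2l => //; lia.
elim: k => [|k IH] h; first by rewrite expr0 mul1r addn0.
have {}IH := IH ltac:(lia).
rewrite exprS -mulrA; apply: (@le_trans _ _ (y * srw N (i + k.*2)%N%:Z)).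
  by rewrite ler_wpM2l.
set v := (i + k.*2)%N.
rewrite (_ : (i + k.+1.*2)%N%:Z = v%:Z + 2); last by lia.
have := srw_ratio N v%:Z.
have vU : v%:R <= U%:R :> R by rewrite ler_nat; lia.
have v0 : 0 <= v%:R :> R by rewrite ler0n.
rewrite -[v%:Z%:~R]/(v%:R : R).
have := srw_ge0 N v%:Z; move: (srw _ _) (srw _ _) => a b a0 e.
have p : 0 < N%:R + v%:R + 2 :> R by lra.
rewrite -(ler_pM2l p) e mulrA ler_wpM2r//.
rewrite /y mulrBr mulr1.
have : N%:R * ((2 * U%:R + 2) / N%:R) = 2 * U%:R + 2 :> R.
  by rewrite mulrCA divff ?mulr1// gt_eqF.
have : 0 <= ((2 * U%:R + 2) / N%:R) :> R.
  by rewrite divr_ge0// ?(ltW N0)//; lra.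
move: (_ / _) => q q0 eq; nra.
Qed.

End simple_walk.

(** * Heat kernel of the lazy walk on the planar lattice *)

Section lazy_walk.
Context (R : realType).
Notation site := 'rV[int]_2.
Implicit Types (h : site -> R) (z t : site).

Definition pt (a b : int) : site := \row_i (if i == ord0 then a else b).
Definition steps : seq site := [:: 0; pt 1 0; pt (-1) 0; pt 0 1; pt 0 (-1)].

Lemma site2P z t : (z == t) = (z 0 0 == t 0 0) && (z 0 1 == t 0 1).
Proof.
apply/eqP/andP => [->//|[/eqP h0 /eqP h1]].
apply/rowP => i; have [->//|i0] := eqVneq i 0.
by have -> : i = 1 by apply/val_inj; case: i i0 => [[|[|]]].
Qed.

Definition avg h z : R := 5^-1 * \sum_(d <- steps) h (z + d).

Lemma avgE h z : avg h z = 5^-1 * (h z + h (z + pt 1 0) + h (z + pt (-1) 0)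
  + h (z + pt 0 1) + h (z + pt 0 (-1))).
Proof. by rewrite /avg /steps !big_cons big_nil addr0 addr0 !addrA. Qed.

Lemma le_avg h1 h2 : (forall z, h1 z <= h2 z) -> forall z, avg h1 z <= avg h2 z.
Proof. by move=> H z; rewrite ler_wpM2l ?invr_ge0// ler_sum. Qed.

Lemma avg_cst (c : R) z : avg (fun=> c) z = c.
Proof. by rewrite avgE; lra. Qed.

Lemma avg_ge0 h : (forall z, 0 <= h z) -> forall z, 0 <= avg h z.
Proof. by move=> H z; rewrite -(avg_cst 0 z); exact: le_avg. Qed.

Lemma avg_le1 h : (forall z, h z <= 1) -> forall z, avg h z <= 1.
Proof. by move=> H z; rewrite -(avg_cst 1 z); exact: le_avg. Qed.

Lemma avgD h1 h2 z : avg (fun z => h1 z + h2 z) z = avg h1 z + avg h2 z.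
Proof. by rewrite !avgE; lra. Qed.

Lemma avgZ c h z : avg (fun z => c * h z) z = c * avg h z.
Proof. by rewrite !avgE; lra. Qed.

Lemma avg_shift h t z : avg (fun z => h (z + t)) z = avg h (z + t).
Proof. by rewrite !avgE !(addrAC _ t). Qed.

Lemma eq_avg h1 h2 : h1 =1 h2 -> avg h1 =1 avg h2.
Proof. by move=> e z; rewrite !avgE !e. Qed.

Lemma ptN a b : - pt a b = pt (- a) (- b).
Proof. by apply/rowP => i; rewrite !mxE; case: eqP. Qed.

Lemma ptE0 a b : pt a b 0 0 = a. Proof. by rewrite mxE. Qed.
Lemma ptE1 a b : pt a b 0 1 = b. Proof. by rewrite mxE. Qed.

Definition avgn m h : site -> R := iter m avg h.

Lemma avgnS m h : avgn m.+1 h = avg (avgn m h). Proof. by []. Qed.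
Lemma avgnSr m h : avgn m.+1 h = avgn m (avg h). Proof. exact: iterSr. Qed.
Lemma avgnD m k h : avgn (m + k) h = avgn m (avgn k h). Proof. exact: iterD. Qed.

Lemma le_avgn m h1 h2 : (forall z, h1 z <= h2 z) -> forall z, avgn m h1 z <= avgn m h2 z.
Proof. by move=> H; elim: m => [//|m IH]; apply: le_avg. Qed.

Lemma eq_avgn m h1 h2 : h1 =1 h2 -> avgn m h1 =1 avgn m h2.
Proof. by move=> H; elim: m => [//|m IH]; apply: eq_avg. Qed.

Lemma avgn_cst m (c : R) z : avgn m (fun=> c) z = c.
Proof. by elim: m z => [//|m IH] z; rewrite avgnS (eq_avg IH) avg_cst. Qed.

Lemma avgn_ge0 m h : (forall z, 0 <= h z) -> forall z, 0 <= avgn m h z.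
Proof. by move=> H z; rewrite -(avgn_cst m 0 z); exact: le_avgn. Qed.

Lemma avgn_le1 m h : (forall z, h z <= 1) -> forall z, avgn m h z <= 1.
Proof. by move=> H z; rewrite -(avgn_cst m 1 z); exact: le_avgn. Qed.

Lemma avgnZ m c h z : avgn m (fun z => c * h z) z = c * avgn m h z.
Proof. by elim: m z => [//|m IH] z; rewrite avgnS (eq_avg IH) avgZ. Qed.

Lemma avgn_shift m h t z : avgn m (fun z => h (z + t)) z = avgn m h (z + t).
Proof. by elim: m z => [//|m IH] z; rewrite avgnS (eq_avg IH) avg_shift. Qed.

Lemma avgnD_fun m h1 h2 z : avgn m (fun z => h1 z + h2 z) z = avgn m h1 z + avgn m h2 z.
Proof. by elim: m z => [//|m IH] z; rewrite avgnS (eq_avg IH) avgD. Qed.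

Definition delta t z : R := (z == t)%:R.
Definition heat m : site -> R := avgn m (delta 0).

Lemma delta_ge0 t z : 0 <= delta t z. Proof. exact: ler0n. Qed.
Lemma avgn_delta m t z : avgn m (delta t) z = heat m (z - t).
Proof.
rewrite /heat -(avgn_shift m (delta 0)).
by apply: eq_avgn => y; rewrite /delta subr_eq0.
Qed.

(** A step has squared length 1 with probability 4/5 and mean 0, so the squared norm minus 4 m / 5
    is a martingale. *)
Lemma avgn_normsq m z :
  avgn m (fun z => (z 0 0 ^+ 2 + z 0 1 ^+ 2)%:~R) z =
  (z 0 0 ^+ 2 + z 0 1 ^+ 2)%:~R + 4 / 5 * m%:R.
Proof.
elim: m z => [|m IH] z; first by rewrite /avgn/= mulr0 addr0.
rewrite avgnS (eq_avg IH) avgE !mxE !intrD !rmorphXn /= !intrD -natr1.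
rewrite (_ : (-1)%:~R = -1 :> R)// (_ : 1%:~R = 1 :> R)// (_ : 0%:~R = 0 :> R)//.
move: (z 0 0)%:~R (z 0 1)%:~R => a b; by field.
Qed.

Lemma markov_avgn m (h g : site -> R) (c : R) : 0 < c -> (forall z, 0 <= h z) ->
  (forall z, 0 <= g z <= 1) -> (forall z, g z != 0 -> c <= h z) ->
  forall z, avgn m g z <= avgn m h z / c.
Proof.
move=> c0 h0 g01 H z; rewrite mulrC -avgnZ; apply: le_avgn => y.
have [->|/H ch] := eqVneq (g y) 0; first by rewrite mulr_ge0// invr_ge0 ltW.
rewrite mulrC ler_pdivlMr//; have /andP[] := g01 y; nra.
Qed.

(* The coordinates z1 + z2 and z1 - z2 of the simple random walk of the plane are independent one-dimensional walks. *)
Definition srw2 N z : R := srw R N (z 0 0 + z 0 1) * srw R N (z 0 0 - z 0 1).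

Lemma srw2S N z : srw2 N.+1 z = 4^-1 * (srw2 N (z + pt 1 0) +
  srw2 N (z + pt (-1) 0) + srw2 N (z + pt 0 1) + srw2 N (z + pt 0 (-1))).
Proof.
rewrite /srw2 !mxE /=.
set a := z 0 0; set b := z 0 1.
rewrite (_ : a + 1 + (b + 0) = a + b + 1); last by lia.
rewrite (_ : a + 1 - (b + 0) = a - b + 1); last by lia.
rewrite (_ : a + -1 + (b + 0) = a + b - 1); last by lia.
rewrite (_ : a + -1 - (b + 0) = a - b - 1); last by lia.
rewrite (_ : a + 0 + (b + 1) = a + b + 1); last by lia.
rewrite (_ : a + 0 - (b + 1) = a - b - 1); last by lia.
rewrite (_ : a + 0 + (b + -1) = a + b - 1); last by lia.
rewrite (_ : a + 0 - (b + -1) = a - b + 1); last by lia.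
by field.
Qed.

Lemma srw2_0 z : srw2 0 z = delta 0 z.
Proof.
rewrite /srw2 /delta /= -natrM mulnb; congr (nat_of_bool _)%:R.
by rewrite site2P !mxE; lia.
Qed.

Lemma avg_srw2 N z : avg (srw2 N) z = 5^-1 * srw2 N z + 4 / 5 * srw2 N.+1 z.
Proof. by rewrite avgE srw2S; field. Qed.

(* The probability that the lazy walk makes N nonzero steps up to time m. *)
Definition bw m N : R := 'C(m, N)%:R * (4 / 5) ^+ N * (1 / 5) ^+ (m - N).

Lemma bw_ge0 m N : 0 <= bw m N.
Proof. by rewrite /bw !mulr_ge0// ?exprn_ge0//; lra. Qed.

Lemma bw_small m N : (m < N)%N -> bw m N = 0.
Proof. by move=> h; rewrite /bw bin_small// !mul0r. Qed.

Lemma bwS m N : bw m.+1 N.+1 = 5^-1 * bw m N.+1 + 4 / 5 * bw m N.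
Proof.
rewrite /bw binS natrD subSS exprS.
case: (ltnP N m) => h.
  by rewrite -[(m - N)%N](@subnSK) // exprS; field.
by rewrite bin_small//; field.
Qed.

(** Conditioning on the last step, which is nonzero with probability 4/5. *)
Lemma bw_sum m (s : nat -> R) : \sum_(N < m.+2) bw m.+1 N * s N =
  \sum_(N < m.+1) bw m N * (5^-1 * s N + 4 / 5 * s N.+1).
Proof.
rewrite big_ord_recl /=.
under eq_bigr => i _ do rewrite /bump /= add1n bwS mulrDl.
rewrite big_split/= addrA.
under [RHS]eq_bigr => i _ do rewrite mulrDr.
rewrite big_split/=; congr (_ + _); last by apply: eq_bigr => i _; ring.
rewrite [RHS]big_ord_recl /= big_ord_recr /= (bw_small (ltnSn m)) mulr0 mul0r addr0.
congr (_ + _); first by rewrite /bw !bin0 !subn0 exprS; field.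
by apply: eq_bigr => i _; rewrite /bump /= add1n; ring.
Qed.

(** The lazy walk is the simple walk run for a binomial number of steps. *)
Lemma heat_mix m z : heat m z = \sum_(N < m.+1) bw m N * srw2 N z.
Proof.
elim: m z => [|m IH] z.
  by rewrite big_ord1 /bw bin0 !expr0 !mulr1 mul1r srw2_0.
rewrite /heat avgnS -/(heat m) (eq_avg IH) (bw_sum m (fun N => srw2 N z)).
rewrite /avg exchange_big/= mulr_sumr; apply: eq_bigr => N _.
by rewrite -mulr_sumr mulrCA -/(avg _ _) avg_srw2.
Qed.

Lemma sum_bw m : \sum_(N < m.+1) bw m N = 1.
Proof.
have H k : \sum_(N < k.+1) bw k N = \sum_(N < k.+1) bw k N * 1.
  by under [RHS]eq_bigr do rewrite mulr1.
elim: m => [|m IH]; first by rewrite big_ord1 /bw bin0 !expr0 !mulr1.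
rewrite H (bw_sum m (fun=> 1)) -[RHS]IH; apply: eq_bigr => i _; by field.
Qed.

(* The sum is E (-1)^N, which controls the parity of the number of nonzero steps. *)
Lemma sum_bw_sign m : \sum_(N < m.+1) bw m N * (-1) ^+ N = (- (3 / 5)) ^+ m.
Proof.
elim: m => [|m IH]; first by rewrite big_ord1 /bw bin0 !expr0 !mulr1.
rewrite (bw_sum m (fun N => (-1) ^+ N)) exprS -IH mulr_sumr.
by apply: eq_bigr => i _; rewrite exprS; by field.
Qed.

(** C(m, N) / (N + 1) = C(m + 1, N + 1) / (m + 1), so the sum is a multiple of a binomial total
    without its first term. *)
Lemma sum_bw_inv m : \sum_(N < m.+1) bw m N / (N%:R + 1) <= 5 / 4 / (m%:R + 1).
Proof.
have -> : \sum_(N < m.+1) bw m N / (N%:R + 1) =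
    5 / 4 / (m%:R + 1) * \sum_(N < m.+1) bw m.+1 N.+1.
  rewrite mulr_sumr; apply: eq_bigr => N _.
  have := mul_bin_diag m.+1 N; rewrite /= => /(congr1 (fun n => n%:R : R)).
  rewrite !natrM => e.
  rewrite /bw subSS exprS natr1 (natr1 m).
  have N0 : N.+1%:R != 0 :> R by rewrite pnatr_eq0.
  have m0 : m.+1%:R != 0 :> R by rewrite pnatr_eq0.
  have -> : 'C(m, N)%:R = N.+1%:R * 'C(m.+1, N.+1)%:R / m.+1%:R :> R.
    by rewrite -e mulrC mulKf.
  by move: (_ ^+ N) (_ ^+ (m - N)) (N.+1%:R : R) N0 (m.+1%:R : R) m0 => a b x x0 y y0; field; rewrite x0 y0.
have c0 : 0 <= 5 / 4 / (m%:R + 1) :> R by rewrite !divr_ge0// addr_ge0.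
rewrite -[leRHS]mulr1 ler_wpM2l//.
have := sum_bw m.+1; rewrite big_ord_recl /= => <-.
by rewrite lerDr; exact: bw_ge0.
Qed.

Lemma srw2_ub N z : srw2 N z <= (N%:R + 1)^-1.
Proof.
rewrite -[leRHS]mul1r ler_pdivlMr ?ltr_wpDl//.
rewrite /srw2.
have := srw_ub R N (z 0 0 + z 0 1); have := srw_ub R N (z 0 0 - z 0 1).
have : 0 <= N%:R :> R by rewrite ler0n.
move: (N%:R) (srw _ _ _) (srw _ _ _) => n a b n0 ha hb.
have := sqr_ge0 (a - b); nra.
Qed.

Lemma heat_ub m z : heat m z <= 5 / 4 / (m%:R + 1).
Proof.
rewrite heat_mix; apply: le_trans (sum_bw_inv m).
by apply: ler_sum => N _; rewrite ler_wpM2l ?bw_ge0// srw2_ub.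
Qed.

(** The simple walk only reaches sites of the parity of its time. Adding or subtracting
    [sum_bw_sign] gives each parity probability at least (1 - (3/5)^m) / 2, hence at least 1/5. *)
Lemma sum_bw_parity m (b : bool) : (0 < m)%N ->
  1 / 5 <= \sum_(N < m.+1 | odd N == b) bw m N.
Proof.
move=> m0.
have e : \sum_(N < m.+1 | odd N == b) bw m N =
   (\sum_(N < m.+1) bw m N + (-1) ^+ b * \sum_(N < m.+1) bw m N * (-1) ^+ N) / 2.
  rewrite mulr_sumr -big_split/= mulr_suml big_mkcond/=; apply: eq_bigr => N _.
  rewrite -[X in _ * (_ * X)]signr_odd.
  by case: b; case: odd => /=; rewrite ?expr0 ?expr1; field.
rewrite {}e sum_bw sum_bw_sign.
have : `|(- (3 / 5)) ^+ m : R| <= 3 / 5.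
  rewrite normrX normrN ger0_norm; last lra.
  case: m m0 => // m _; rewrite exprS.
  have h0 : 0 <= 3 / 5 :> R by lra.
  have h1 : 3 / 5 <= 1 :> R by lra.
  by rewrite ler_piMr// exprn_ile1.
rewrite ler_norml => /andP[].
by move: (_ ^+ m) => q; case: b => /=; rewrite ?expr0 ?expr1; lra.
Qed.

(** Markov's inequality for 1 / (N + 1): it reaches 20 / (m + 1) with probability at most (5/4) / 20
    = 1/16. *)
Lemma sum_bw_tail m : \sum_(N < m.+1 | (20 * N.+1 <= m.+1)%N) bw m N <= 1 / 16.
Proof.
apply: (@le_trans _ _ (\sum_(N < m.+1) (m%:R + 1) / 20 * (bw m N / (N%:R + 1)))).
  rewrite big_mkcond/=; apply: ler_sum => N _; case: ifPn => h; last first.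
    by rewrite !(mulr_ge0, divr_ge0, addr_ge0, bw_ge0).
  rewrite mulrCA ler_peMr ?bw_ge0// ler_pdivlMr ?ltr_wpDl// mul1r.
  rewrite ler_pdivlMr// mulrC !natr1 -natrM ler_nat; lia.
rewrite -mulr_sumr; have := sum_bw_inv m.
have : 0 < m%:R + 1 :> R by rewrite ltr_wpDl.
move: (\sum_(_ < _) _) => q; move: (m%:R + 1) => x x0 h.
have : x * q <= x * (5 / 4 / x) by rewrite ler_pM2l.
by rewrite mulrCA divff ?gt_eqF// => {}h; lra.
Qed.

Lemma expR_le_1B (t : R) : 0 <= t <= 1 / 2 -> expR (- (2 * t)) <= 1 - t.
Proof.
move=> /andP[t0 t1]; have := expR_ge1Dx (2 * t).
have : expR (2 * t) * expR (- (2 * t)) = 1 by rewrite -expRD subrr expR0.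
have := expR_gt0 (- (2 * t)).
move: (expR (2 * t)) (expR _) => E F F0 EF h.
have : F * (1 + 2 * t) <= 1 by nra.
nra.
Qed.

(** A lower bound uniform over the diffusive scale fixed by M. Times N of the parity of z and above
    roughly m / 20 carry probability at least 1/5 - 1/16 >= 1/10, and at each of them both
    one-dimensional factors of [srw2] are of order N^(-1/2). *)
Lemma heat_lb (M : nat) : exists2 c : R, 0 < c & exists m0 : nat,
  forall (m U : nat) z, (m0 <= m)%N -> (U ^ 2 <= M * m)%N ->
    (`|(z 0 0 + z 0 1)%R| <= U)%N -> (`|(z 0 0 - z 0 1)%R| <= U)%N ->
    c / m%:R <= heat m z.
Proof.
(* A lower bound for (1 - t)^(2 U) with t = (2 U + 2) / N: this power is at least exp (- 4 U t), and
   4 U t <= 640 (M + 1) when U^2 <= M m and m <= 40 N. The constant leaves room. *)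
pose e : R := expR (- (2560 * (M%:R + 1))).
exists (e / 40); first by rewrite divr_gt0// expR_gt0.
(* Large enough to force 320 U <= m, hence 4 U + 4 <= N at all the times N that are kept. *)
exists (400 + 400 ^ 2 * M)%N => m U z hm hU hu hv.
have m0 : (0 < m)%N by lia.
have U1 : (320 * U <= m)%N by nia.
pose b := odd `|(z 0 0 + z 0 1)%R|.
have key N : (N < m.+1)%N -> (odd N == b) -> ~~ (20 * N.+1 <= m.+1)%N ->
    e / (4 * m%:R) <= srw2 N z.
  move=> Nm Nb; rewrite -ltnNge => Nl.
  have N0 : (0 < N)%N by lia.
  have NU : (4 * U + 4 <= N)%N by lia.
  have NM : (40 * N >= m)%N by lia.
  have h1 := @srw_offcenter_lb R N U (z 0 0 + z 0 1) ltac:(lia) hu ltac:(lia).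
  have h2 := @srw_offcenter_lb R N U (z 0 0 - z 0 1) ltac:(lia) hv ltac:(lia).
  have h3 := srw_central_lb R N0.
  have N0R : 0 < N%:R :> R by rewrite ltr0n.
  set t : R := (2 * U%:R + 2) / N%:R in h1 h2.
  have t0 : 0 <= t by rewrite divr_ge0// addr_ge0// mulr_ge0.
  have t1 : t <= 1 / 2.
    rewrite ler_pdivrMr//; have : (4 * U + 4)%:R <= N%:R :> R by rewrite ler_nat.
    by rewrite natrD natrM; lra.
  have y0 : 0 <= (1 - t) ^+ U by apply: exprn_ge0; lra.
  have yE : e <= (1 - t) ^+ U * (1 - t) ^+ U.
    rewrite -exprD.
    apply: (@le_trans _ _ (expR (- (2 * t)) ^+ (U + U))); last first.
      apply: lerXn2r; rewrite ?nnegrE ?expR_ge0//; first by lra.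
      by apply: expR_le_1B; rewrite t0.
    rewrite -expRM_natl ler_expR natrD mulrN lerN2.
    have : t * N%:R = 2 * U%:R + 2 by rewrite /t divfK// gt_eqF.
    have mM : 0 < m%:R :> R by rewrite ltr0n.
    have hM : U%:R ^+ 2 <= M%:R * m%:R :> R by rewrite -natrX -natrM ler_nat.
    have m1 : 1 <= m%:R :> R by rewrite ler1n.
    have NM' : m%:R <= 40 * N%:R :> R by rewrite -natrM ler_nat.
    have U0 : 0 <= U%:R :> R by [].
    have M0 : 0 <= M%:R :> R by [].
    move=> et.
    have : (U%:R + U%:R) * (2 * t) * N%:R <= 8 * (U%:R + 1) ^+ 2.
      by rewrite -mulrA -(mulrA 2) et; nra.
    have : (U%:R + 1) ^+ 2 <= 2 * (M%:R + 1) * m%:R :> R.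
      have := sqr_ge0 (U%:R - 1 : R).
      by move: (U%:R : R) (M%:R : R) (m%:R : R) hM m1 => u p q hM q1 sq; nra.
    move=> h4 h5.
    rewrite -(ler_pM2r N0R); apply: (le_trans h5); nra.
  rewrite /srw2.
  have := srw_ge0 R N (odd N : nat)%:Z.
  move: (srw R N (odd N : nat)%:Z) h1 h2 h3 => s h1 h2 h3 s0.
  apply: (@le_trans _ _ ((1 - t) ^+ U * s * ((1 - t) ^+ U * s))); last first.
    by apply: ler_pM => //; exact: mulr_ge0.
  have Nm' : N%:R <= m%:R :> R by rewrite ler_nat -ltnS.
  have m0' : 0 < 4 * m%:R :> R by rewrite mulr_gt0// ltr0n.
  rewrite ler_pdivrMr//.
  have e0 : 0 <= e by exact: expR_ge0.
  move: ((1 - t) ^+ U) y0 yE => y y0 yE.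
  have h6 : 1 <= s ^+ 2 * (4 * m%:R).
    by apply: le_trans h3 _; have := sqr_ge0 s; nra.
  have -> : y * s * (y * s) * (4 * m%:R) = y * y * (s ^+ 2 * (4 * m%:R)) by ring.
  by apply: le_trans yE _; rewrite ler_peMr// mulr_ge0.
rewrite heat_mix.
pose good N := (odd N == b) && ~~ (20 * N.+1 <= m.+1)%N.
have hs : 1 / 10 <= \sum_(N < m.+1 | good N) bw m N.
  have := sum_bw_parity b m0.
  rewrite (bigID (fun N : 'I__ => (20 * N.+1 <= m.+1)%N))/=.
  set x := \sum_(_ < _ | _) _; set y := \sum_(_ < _ | _) _.
  suff : x <= 1 / 16 by rewrite -/y; lra.
  apply: le_trans (sum_bw_tail m).
  rewrite /x [leLHS]big_mkcond [leRHS]big_mkcond/=; apply: ler_sum => N _.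
  by case: (odd N == b) => //=; case: ifP => // _; exact: bw_ge0.
apply: (@le_trans _ _ (\sum_(N < m.+1 | good N) bw m N * (e / (4 * m%:R)))).
  rewrite -mulr_suml.
  have h : 0 <= e / (4 * m%:R) by rewrite divr_ge0 ?expR_ge0// mulr_ge0.
  have -> : e / 40 / m%:R = 1 / 10 * (e / (4 * m%:R)).
    have : m%:R != 0 :> R by rewrite pnatr_eq0; lia.
    by move=> m0'; field.
  by rewrite ler_wpM2r.
rewrite big_mkcond/=; apply: ler_sum => N _; case: ifPn => [/andP[h1 h2]|_].
  by rewrite ler_wpM2l ?bw_ge0// key.
by rewrite mulr_ge0 ?bw_ge0// mulr_ge0 ?srw_ge0.
Qed.

(** The duplicate-free list stands for a sum over the whole lattice. The induction translates the
    list by each of the five steps, whose set is symmetric. *)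
Lemma sum_heat_le m (s : seq site) h : uniq s -> (forall z, 0 <= h z) ->
  \sum_(y <- s) heat m y * h y <= avgn m h 0.
Proof.
elim: m s h => [|m IH] s h us h0.
  rewrite /heat /avgn /= (bigID (fun y => y == 0))/= [X in _ + X]big1 => [|i /negbTE i0].
    rewrite addr0 (eq_bigr (fun=> h 0)) => [|i /eqP->]; last by rewrite /delta eqxx mul1r.
    rewrite big_const_seq iter_addr_0 (count_uniq_mem 0 us).
    by case: (0 \in s); rewrite ?mulr1n// mulr0n.
  by rewrite /delta i0 mul0r.
have -> : \sum_(y <- s) heat m.+1 y * h y =
   5^-1 * \sum_(d <- steps) \sum_(y <- [seq y + d | y <- s]) heat m y * h (y - d).
  rewrite /heat avgnS -/(heat m) /avg.
  under eq_bigr => y _ do rewrite -mulrA mulr_suml.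
  rewrite -mulr_sumr exchange_big/=; congr (_ * _); apply: eq_bigr => d _.
  by rewrite big_map; apply: eq_bigr => y _; rewrite addrK.
rewrite avgnS.
have -> : avg (avgn m h) 0 = 5^-1 * \sum_(d <- steps) avgn m (fun y => h (y - d)) 0.
  under [in RHS]eq_bigr => d _ do rewrite avgn_shift.
  by rewrite avgE /steps !big_cons big_nil !ptN !oppr0 !opprK !add0r; ring.
rewrite ler_wpM2l ?invr_ge0//; apply: ler_sum => d _.
by apply: IH => [|z//]; rewrite map_inj_uniq//; exact: addIr.
Qed.

End lazy_walk.

(** * Offspring generating function and its derivative near 1 *)

Section offspring_law.
Context (R : realType) (Q : nat -> R).
Hypothesis (Q_dist : is_distribution Q).

Definition EQ (h : nat -> \bar R) : \bar R := (\sum_(0 <= l <oo) ((Q l)%:E * h l))%E.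

Let Q0 l : 0 <= Q l. Proof. by case: Q_dist. Qed.

Local Open Scope ereal_scope.

Lemma EQ_ge0 h : (forall l, 0 <= h l) -> 0 <= EQ h.
Proof. by move=> h0; apply: nneseries_ge0 => l _ _; rewrite mule_ge0 ?lee_fin. Qed.

Lemma le_EQ h1 h2 : (forall l, 0 <= h1 l) -> (forall l, h1 l <= h2 l) -> EQ h1 <= EQ h2.
Proof.
move=> h10 H; apply: lee_nneseries => l; first by move=> _ _; rewrite mule_ge0 ?lee_fin.
by move=> _; apply: lee_wpmul2l; rewrite ?lee_fin.
Qed.

Lemma eq_EQ h1 h2 : h1 =1 h2 -> EQ h1 = EQ h2.
Proof. by move=> e; apply: eq_eseriesr => l _; rewrite e. Qed.

Lemma EQD h1 h2 : (forall l, 0 <= h1 l) -> (forall l, 0 <= h2 l) ->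
  EQ (fun l => h1 l + h2 l) = EQ h1 + EQ h2.
Proof.
move=> h10 h20; rewrite /EQ -nneseriesD; last 2 first.
- by move=> l _; rewrite mule_ge0 ?lee_fin.
- by move=> l _; rewrite mule_ge0 ?lee_fin.
by apply: eq_eseriesr => l _; rewrite ge0_muleDr.
Qed.

Lemma EQZ (c : R) h : (forall l, 0 <= h l) -> EQ (fun l => c%:E * h l) = c%:E * EQ h.
Proof.
move=> h0; rewrite /EQ -nneseriesZl; last by move=> l _; rewrite mule_ge0 ?lee_fin.
by apply: eq_eseriesr => l _; rewrite muleCA.
Qed.

Lemma EQ1 : EQ (fun=> 1) = 1.
Proof. by have [_ e] := Q_dist; rewrite -[RHS]e; apply: eq_eseriesr => l _; rewrite mule1. Qed.

Lemma EQ_point k : EQ (fun l => (l == k)%:R%:E) = (Q k)%:E.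
Proof.
rewrite /EQ (nneseriesD1 (n := k))// => [|l _]; last by rewrite mule_ge0 ?lee_fin.
rewrite eqxx mule1 eseries0 ?adde0// => l _ /=.
by case: eqP => //= _; rewrite mule0.
Qed.

Definition pgf (s : R) : R := fine (EQ (fun l => (s ^+ l)%:E)).
Definition dpgf (s : R) : R := fine (EQ (fun l => (l%:R * s ^+ l.-1)%:E)).

Hypothesis (Q_critical : dist_mean Q = 1).

Lemma EQ_mean : EQ (fun l => l%:R%:E) = 1.
Proof. by rewrite -Q_critical; apply: eq_eseriesr => l _; rewrite -EFinM mulrC. Qed.

Lemma pgf_fin s : (0 <= s <= 1)%R -> EQ (fun l => (s ^+ l)%:E) = (pgf s)%:E.
Proof.
move=> /andP[s0 s1]; rewrite /pgf fineK// ge0_fin_numE; last first.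
  by apply: EQ_ge0 => l; rewrite lee_fin exprn_ge0.
apply: le_lt_trans (_ : 1 < +oo); last exact: ltry.
rewrite -EQ1; apply: le_EQ => l; rewrite lee_fin ?exprn_ge0//.
exact: exprn_ile1.
Qed.

Lemma dpgf_fin s : (0 <= s <= 1)%R -> EQ (fun l => (l%:R * s ^+ l.-1)%:E) = (dpgf s)%:E.
Proof.
move=> /andP[s0 s1]; rewrite /dpgf fineK// ge0_fin_numE; last first.
  by apply: EQ_ge0 => l; rewrite lee_fin mulr_ge0 ?exprn_ge0.
apply: le_lt_trans (_ : 1 < +oo); last exact: ltry.
rewrite -EQ_mean; apply: le_EQ => l; rewrite lee_fin ?mulr_ge0 ?exprn_ge0//.
by rewrite ler_piMr// exprn_ile1.
Qed.

Lemma pgf_ge0 s : (0 <= s <= 1)%R -> (0 <= pgf s)%R.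
Proof.
move=> s01; rewrite -lee_fin -pgf_fin//; apply: EQ_ge0 => l.
by rewrite lee_fin exprn_ge0//; case/andP: s01.
Qed.

Lemma dpgf_ge0 s : (0 <= s <= 1)%R -> (0 <= dpgf s)%R.
Proof.
move=> s01; rewrite -lee_fin -dpgf_fin//; apply: EQ_ge0 => l.
by rewrite lee_fin mulr_ge0// exprn_ge0//; case/andP: s01.
Qed.

Lemma le_pgf s t : (0 <= s)%R -> (s <= t)%R -> (t <= 1)%R -> (pgf s <= pgf t)%R.
Proof.
move=> s0 st t1; rewrite -lee_fin -!pgf_fin ?s0 ?t1 ?(le_trans st)//= ?(le_trans s0)//.
by apply: le_EQ => l; rewrite lee_fin ?exprn_ge0// lerXn2r// nnegrE (le_trans s0).
Qed.

Lemma pgf1 : pgf 1 = 1%R.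
Proof. by rewrite /pgf (eq_EQ (h2 := fun=> 1)) ?EQ1// => l; rewrite expr1n. Qed.

Lemma dpgf1 : dpgf 1 = 1%R.
Proof.
by rewrite /dpgf (eq_EQ (h2 := fun l => l%:R%:E)) ?EQ_mean// => l; rewrite expr1n mulr1.
Qed.

Lemma pgf_le1 s : (0 <= s <= 1)%R -> (pgf s <= 1)%R.
Proof. by move=> /andP[s0 s1]; rewrite -pgf1; exact: le_pgf. Qed.

Hypothesis (Q_var_pos : 0 < dist_variance Q).
Hypothesis (Q_var_fin : dist_variance Q < +oo).

Lemma EQ_var : EQ (fun l => ((l%:R - 1) ^+ 2)%:E) = dist_variance Q.
Proof.
by rewrite /dist_variance Q_critical; apply: eq_eseriesr => l _; rewrite -EFinM mulrC.
Qed.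

(** Twice the variance: l (l - 1) <= 2 (l - 1)^2 for every natural l, so the second-order bounds
    below can be proved term by term. *)
Definition s2 : R := (2 * fine (dist_variance Q))%R.

Lemma s2_gt0 : (0 < s2)%R.
Proof. by rewrite mulr_gt0// fine_gt0// Q_var_pos. Qed.

Lemma EQ_s2 : EQ (fun l => (2 * (l%:R - 1) ^+ 2)%:E) = s2%:E.
Proof.
under eq_EQ do rewrite EFinM.
rewrite EQZ => [|l]; last by rewrite lee_fin sqr_ge0.
rewrite EQ_var /s2 EFinM fineK// ge0_fin_numE//; exact: ltW.
Qed.

(** If Q lived on {0, 1}, then (l - 1)^2 + l = 1 throughout, so variance plus mean would be 1 and
    the variance 0. *)
Lemma exists_branching : exists2 k, (2 <= k)%N & (0 < Q k)%R.
Proof.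
apply: contrapT => H.
have Qk k : (2 <= k)%N -> Q k = 0%R.
  move=> k2; apply/eqP; rewrite eq_le Q0 andbT leNgt; apply/negP => Qk0.
  by apply: H; exists k.
have : EQ (fun l => ((l%:R - 1) ^+ 2)%:E + l%:R%:E) = EQ (fun=> 1).
  apply: eq_eseriesr => -[|[|l]] _; last by rewrite Qk// !mul0e.
  - by rewrite -EFinD sub0r sqrrN expr1n addr0.
  - by rewrite -EFinD subrr expr0n add0r.
rewrite EQD => [|l|l]; rewrite ?lee_fin ?sqr_ge0//.
rewrite EQ_var EQ_mean EQ1 => h.
have vf : dist_variance Q \is a fin_num by rewrite ge0_fin_numE// ltW.
move: Q_var_pos h; rewrite -(fineK vf) -EFinD lte_fin => v0 [] h.
by move: h v0; lra.
Qed.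

Local Close Scope ereal_scope.

Lemma expr_1B_lb (w : R) l : 0 <= w <= 1 -> 1 - l%:R * w <= (1 - w) ^+ l.
Proof.
move=> /andP[w0 w1]; elim: l => [|l IH]; first by rewrite expr0 mul0r subr0.
rewrite exprS -natr1.
have : (1 - w) * (1 - l%:R * w) <= (1 - w) * (1 - w) ^+ l by rewrite ler_wpM2l// subr_ge0.
apply: le_trans; have : 0 <= l%:R * w ^+ 2 by rewrite mulr_ge0 ?sqr_ge0.
by rewrite expr2; move: (l%:R : R) => x; lra.
Qed.

Lemma pgf_ub (w : R) : 0 <= w <= 1 -> pgf (1 - w) <= 1 - w + s2 * w ^+ 2.
Proof.
move=> w01; have /andP[w0 w1] := w01.
(* Negative terms are moved across, so that both sides are expectations of nonnegative functions of
   l; [pgf_lb], [dpgf_ub] and [dpgf_lb] proceed likewise. *)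
have h : ((pgf (1 - w))%:E + w%:E * 1 <= 1 + (w ^+ 2)%:E * s2%:E)%E.
  rewrite -{1}EQ_mean -EQ1 -EQ_s2 -pgf_fin; last lra.
  have e0 l : (0 <= ((1 - w) ^+ l)%:E)%E by rewrite lee_fin exprn_ge0// subr_ge0.
  rewrite -!EQZ//; last by move=> l; rewrite lee_fin mulr_ge0 ?sqr_ge0.
  rewrite -!EQD//; try by (move=> l; rewrite mule_ge0// lee_fin ?sqr_ge0// mulr_ge0 ?sqr_ge0).
  apply: le_EQ => l; first by rewrite adde_ge0// -EFinM lee_fin mulr_ge0.
  rewrite -!EFinM -!EFinD lee_fin.
  have : (1 - w) ^+ l <= 1 - l%:R * w + l%:R * (l%:R - 1) * w ^+ 2.
    elim: l => [|l IH]; first by rewrite expr0; lra.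
    rewrite exprS; apply: (@le_trans _ _ ((1 - w) *
      (1 - l%:R * w + l%:R * (l%:R - 1) * w ^+ 2))).
      by rewrite ler_wpM2l// subr_ge0.
    rewrite -natr1.
    have : 0 <= l%:R * (l%:R - 1) :> R.
      case: l {IH} => [|l]; first by rewrite mul0r.
      by rewrite mulr_ge0// subr_ge0 ler1n.
    have : 0 <= l%:R :> R by [].
    rewrite !expr2; move: (l%:R : R) => x x0 hx.
    have : 0 <= x * (x - 1) * (w * w * w) by apply: mulr_ge0 => //; rewrite !mulr_ge0.
    have : 0 <= x * (w * w) by rewrite !mulr_ge0.
    lra.
  have : l%:R * (l%:R - 1) * w ^+ 2 <= w ^+ 2 * (2 * (l%:R - 1) ^+ 2).
    rewrite mulrC ler_wpM2l ?sqr_ge0// mulrC expr2 mulrA.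
    case: l => [|[|l]]; first lra.
      by rewrite subrr !mulr0.
    have h1 : 1 <= l.+1%:R :> R by rewrite ler1n.
    rewrite -natr1; move: (l.+1%:R : R) h1 => x x1; nra.
  lra.
move: h; rewrite -!EFinM -!EFinD lee_fin; lra.
Qed.

Definition good_deg : nat := sval (cid2 exists_branching).
(* Any offspring number >= 2 of positive probability gives a quadratic lower bound of the generating function at 1. *)
Definition cb : R := Q good_deg.

Lemma good_deg_ge2 : (2 <= good_deg)%N. Proof. by rewrite /good_deg; case: cid2. Qed.
Lemma cb_gt0 : 0 < cb. Proof. by rewrite /cb /good_deg; case: cid2. Qed.

(** Bernoulli's inequality for every l, with a gain of w^2 at the offspring number [good_deg]. *)
Lemma pgf_lb (w : R) : 0 <= w <= 1 -> 1 - w + cb * w ^+ 2 <= pgf (1 - w).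
Proof.
move=> w01; have /andP[w0 w1] := w01.
have h : (1 + (w ^+ 2)%:E * cb%:E <= (pgf (1 - w))%:E + w%:E * 1)%E.
  rewrite -{2}EQ_mean -EQ1 -EQ_point -pgf_fin; last lra.
  have e0 l : (0 <= ((1 - w) ^+ l)%:E)%E by rewrite lee_fin exprn_ge0// subr_ge0.
  rewrite -!EQZ//.
  rewrite -!EQD//; try by (move=> l; rewrite mule_ge0// lee_fin ?sqr_ge0).
  apply: le_EQ => l; first by rewrite adde_ge0// -EFinM lee_fin mulr_ge0 ?sqr_ge0.
  rewrite -!EFinM -!EFinD lee_fin.
  have := expr_1B_lb l w01.
  have [-> _|_] := eqVneq l good_deg; last by rewrite mulr0; lra.
  rewrite mulr1; have := good_deg_ge2; case: good_deg => [//|[//|k]] _.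
  elim: k => [|k IH]; first by rewrite expr2; lra.
  rewrite [(1 - w) ^+ _]exprS; move: IH; move: ((1 - w) ^+ k.+2 : R) => y IH.
  have : (1 - w) * (1 + w ^+ 2 - w * k.+2%:R) <= (1 - w) * y.
    by rewrite ler_wpM2l ?subr_ge0//; lra.
  rewrite -(natr1 k.+2).
  have : 2 <= k.+2%:R :> R by rewrite ler_nat.
  move: (k.+2%:R : R) => x x2 h.
  suff : w ^+ 3 <= x * w ^+ 2 by rewrite !exprS expr0; rewrite !exprS expr0 in h; lra.
  by rewrite exprS ler_wpM2r ?sqr_ge0//; lra.
move: h; rewrite -!EFinM -!EFinD lee_fin; lra.
Qed.

(** The term l (1 - w)^(l - 1) is at most l, and at most l - w at [good_deg]. *)
Lemma dpgf_ub (w : R) : 0 <= w <= 1 -> dpgf (1 - w) <= 1 - cb * w.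
Proof.
move=> w01; have /andP[w0 w1] := w01.
have h : ((dpgf (1 - w))%:E + w%:E * cb%:E <= 1)%E.
  rewrite -EQ_mean -EQ_point -dpgf_fin; last lra.
  have e0 l : (0 <= (l%:R * (1 - w) ^+ l.-1)%:E)%E.
    by rewrite lee_fin mulr_ge0// exprn_ge0// subr_ge0.
  rewrite -!EQZ//.
  rewrite -!EQD//; last by move=> l; rewrite -EFinM lee_fin mulr_ge0.
  apply: le_EQ => l; first by rewrite adde_ge0// -EFinM lee_fin mulr_ge0.
  rewrite -!EFinM -!EFinD lee_fin.
  have h1 : (1 - w) ^+ l.-1 <= 1 by apply: exprn_ile1; lra.
  have [->|_] := eqVneq l good_deg; last by rewrite mulr0 addr0 ler_piMr.
  have := good_deg_ge2; case: good_deg => [//|[//|k]] _ /=.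
  have : (1 - w) ^+ k.+1 <= 1 - w.
    by rewrite exprS ler_piMr ?subr_ge0// exprn_ile1//; lra.
  have : 2 <= k.+2%:R :> R by rewrite ler_nat.
  move: (k.+2%:R : R) ((1 - w) ^+ k.+1) => x y x2 hy.
  have : x * y <= x * (1 - w) by rewrite ler_wpM2l//; lra.
  have : 2 * w <= x * w by rewrite ler_wpM2r.
  lra.
move: h; rewrite -!EFinM -!EFinD lee_fin; lra.
Qed.

Lemma dpgf_lb (w : R) : 0 <= w <= 1 -> 1 - s2 * w <= dpgf (1 - w).
Proof.
move=> w01; have /andP[w0 w1] := w01.
have h : (1 <= (dpgf (1 - w))%:E + w%:E * s2%:E)%E.
  rewrite -EQ_mean -EQ_s2 -dpgf_fin; last lra.
  have e0 l : (0 <= (l%:R * (1 - w) ^+ l.-1)%:E)%E.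
    by rewrite lee_fin mulr_ge0// exprn_ge0// subr_ge0.
  rewrite -!EQZ//; last by move=> l; rewrite lee_fin mulr_ge0 ?sqr_ge0.
  rewrite -!EQD//; last by move=> l; rewrite mule_ge0// lee_fin mulr_ge0 ?sqr_ge0.
  apply: le_EQ => l; first by [].
  rewrite -!EFinM -!EFinD lee_fin.
  case: l => [|l] /=; first by rewrite mul0r add0r mulr_ge0// mulr_ge0 ?sqr_ge0.
  have := expr_1B_lb l w01; rewrite -natr1 addrK.
  have : 0 <= l%:R * (l%:R - 1) :> R.
    case: l => [|l]; first by rewrite mul0r.
    by rewrite mulr_ge0// subr_ge0 ler1n.
  have : 0 <= l%:R :> R by [].
  move: (l%:R : R) ((1 - w) ^+ l) => x y x0 hx hy.
  have : (x + 1) * (1 - x * w) <= (x + 1) * y by rewrite ler_wpM2l//; lra.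
  have : 0 <= x * (x - 1) * w by rewrite mulr_ge0.
  rewrite expr2; lra.
move: h; rewrite -!EFinM -!EFinD lee_fin; lra.
Qed.

End offspring_law.

(** * Recursions for the generating functional, the survival probability and the killed walk *)

Section recursions.
Context (R : realType) (Q : nat -> R).
Hypotheses (Q_dist : is_distribution Q) (Q_critical : dist_mean Q = 1%E).
Hypothesis (Q_var_pos : (0 < dist_variance Q)%E).
Hypothesis (Q_var_fin : (dist_variance Q < +oo)%E).
Notation site := 'rV[int]_2.
Implicit Types (a f : site -> R) (z t : site).
Notation s2 := (s2 Q).
Notation pgf := (pgf Q).
Notation dpgf := (dpgf Q).
Notation cb := (cb Q_dist Q_critical Q_var_pos Q_var_fin).

Definition gen_step a z : R := pgf (avg a z).
Definition gen_iter n a : site -> R := iter n gen_step a.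

Definition unit_valued a := forall z, 0 <= a z <= 1.

Lemma avg_unit a : unit_valued a -> unit_valued (avg a).
Proof.
by move=> h z; rewrite avg_ge0 ?avg_le1// => t; case/andP: (h t).
Qed.

Lemma gen_step_unit a : unit_valued a -> unit_valued (gen_step a).
Proof. by move=> h z; have := avg_unit h z => H; rewrite pgf_ge0 ?pgf_le1. Qed.

Lemma gen_iter_unit n a : unit_valued a -> unit_valued (gen_iter n a).
Proof. by move=> h; elim: n => [//|n IH]; exact: gen_step_unit. Qed.

Lemma gen_iterSr n a : gen_iter n.+1 a = gen_iter n (gen_step a).
Proof. exact: iterSr. Qed.

Lemma gen_iter_shift n a t z : gen_iter n (fun z => a (z + t)) z = gen_iter n a (z + t).
Proof.
elim: n z => [//|n IH] z.
by rewrite /gen_iter !iterS -/(gen_iter _ _) /gen_step (eq_avg IH) avg_shift.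
Qed.

Lemma pgf_ge_id x : 0 <= x <= 1 -> x <= pgf x.
Proof.
move=> x01; have := pgf_lb Q_dist Q_critical Q_var_pos Q_var_fin (_ : 0 <= 1 - x <= 1).
rewrite (_ : 1 - (1 - x) = x); last by ring.
move=> H; apply: le_trans (H _); last by lra.
by rewrite lerDl mulr_ge0 ?sqr_ge0// ltW// cb_gt0.
Qed.

(** The first-moment bound 1 - E prod a <= E sum (1 - a), obtained here from f(x) >= x. *)
Lemma gen_iter_ub n a z : unit_valued a ->
  1 - gen_iter n a z <= avgn n (fun z => 1 - a z) z.
Proof.
move=> h; elim: n z => [//|n IH] z.
rewrite avgnS; apply: le_trans (le_avg IH z).
have e : avg (fun z => 1 - gen_iter n a z) z = 1 - avg (gen_iter n a) z.
  by rewrite !avgE; field.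
rewrite e lerD2l lerN2; apply: pgf_ge_id.
by apply: avg_unit; exact: gen_iter_unit.
Qed.

(** The probability of survival to generation n, identified as such in [prob_survives]. *)
Definition surv n : R := 1 - iter n pgf 0.

Lemma iter_pgf01 n s : 0 <= s <= 1 -> 0 <= iter n pgf s <= 1.
Proof. by move=> h; elim: n => [//|n IH]; rewrite iterS pgf_ge0 ?pgf_le1. Qed.

Lemma surv01 n : 0 <= surv n <= 1.
Proof.
by have /andP[] := @iter_pgf01 n 0 ltac:(by rewrite lexx ler01); rewrite /surv; lra.
Qed.

Lemma survS n : surv n.+1 = 1 - pgf (1 - surv n).
Proof. by rewrite /surv iterS subKr. Qed.

Lemma cb_le1 : cb <= 1.
Proof.
have := pgf_lb Q_dist Q_critical Q_var_pos Q_var_fin (_ : 0 <= (1 : R) <= 1).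
rewrite lexx ler01 => /(_ isT); rewrite subrr expr1n mulr1 add0r => h.
by apply: (le_trans h); apply: pgf_le1 => //; rewrite lexx ler01.
Qed.

(** The quantity y = cb * surv satisfies y' <= y - y^2, which keeps it below 1 / (n + 1). *)
Lemma surv_ub n : cb * surv n <= (n%:R + 1)^-1.
Proof.
have c0 : 0 < cb by exact: cb_gt0.
elim: n => [|n IH].
  by rewrite add0r invr1 /surv /= subr0 mulr1 cb_le1.
have q01 := surv01 n.
have := pgf_lb Q_dist Q_critical Q_var_pos Q_var_fin q01.
rewrite survS -natr1; move: (surv n) q01 IH => q q01 IH h.
have {h} h : cb * (1 - pgf (1 - q)) <= cb * q - (cb * q) ^+ 2.
  rewrite exprMn expr2 -mulrA -mulrBr ler_wpM2l ?(ltW c0)//; lra.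
apply: (le_trans h).
have n0 : 0 <= n%:R :> R by [].
have n1 : 0 < n%:R + 1 :> R by lra.
have n2 : 0 < n%:R + 1 + 1 :> R by lra.
rewrite -[leRHS]mul1r ler_pdivlMr//.
move: IH; rewrite -[_^-1]mul1r ler_pdivlMr//.
have : 0 <= cb * q by rewrite mulr_ge0 ?(ltW c0)//; lra.
have : cb * q <= 1 by have := cb_le1; nra.
move: (cb * q) (n%:R : R) n0 {n1 n2} => y m m0 y1 y0 hy.
rewrite expr2; nra.
Qed.

(** The smallness of th makes th / (n + 1) a subsolution of q' = q - s2 q^2. *)
Lemma surv_lb (th : R) n : 0 <= th <= 1 -> s2 * th <= 1 / 2 -> th / (n%:R + 1) <= surv n.
Proof.
move=> th01 hth; elim: n => [|n IH].
  by rewrite add0r divr1 /surv /= subr0; case/andP: th01.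
rewrite survS -natr1; have q01 := surv01 n.
have n0 : 0 <= n%:R :> R by [].
have x0 : 0 <= th / (n%:R + 1) by rewrite divr_ge0//; lra.
set x := th / (n%:R + 1) in IH x0 *.
have x1 : 0 <= x <= 1 by rewrite x0/=; lra.
have h1 : pgf (1 - surv n) <= pgf (1 - x) by apply: le_pgf => //; lra.
have h2 := pgf_ub Q_dist Q_critical Q_var_pos Q_var_fin x1.
have h3 : th = x * (n%:R + 1) by rewrite /x divfK//; lra.
apply: (@le_trans _ _ (x - s2 * x ^+ 2)); last by lra.
rewrite ler_pdivrMr; last lra.
rewrite h3; rewrite h3 in hth; have s20 := s2_gt0 Q_var_pos Q_var_fin.
have h4 : 0 <= s2 * x by rewrite mulr_ge0// ltW.
have : s2 * x * (n%:R + 1 + 1) <= 1 by nra.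
rewrite expr2; nra.
Qed.

Lemma survS_le n : surv n.+1 <= surv n.
Proof.
rewrite survS; have := surv01 n => q01.
have := @pgf_ge_id (1 - surv n) ltac:(lra); lra.
Qed.

(** The left side is the probability of dying out after generation n and by generation n + k; each
    generation costs at most s2 * surv^2, and surv is nonincreasing. *)
Lemma surv_decr n k : surv n - surv (n + k) <= k%:R * s2 * surv n ^+ 2.
Proof.
have s20 := s2_gt0 Q_var_pos Q_var_fin.
have mono j : surv (n + j) <= surv n.
  elim: j => [|j IH]; first by rewrite addn0.
  by rewrite addnS; apply: le_trans IH; exact: survS_le.
elim: k => [|k IH]; first by rewrite addn0 subrr !mul0r.
rewrite addnS; have := pgf_ub Q_dist Q_critical Q_var_pos Q_var_fin (surv01 (n + k)).
rewrite survS -natr1 => h.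
have : s2 * surv (n + k) ^+ 2 <= s2 * surv n ^+ 2.
  have /andP[h1 _] := surv01 n; have /andP[h2 _] := surv01 (n + k).
  by rewrite ler_wpM2l ?(ltW s20)// lerXn2r ?nnegrE ?mono.
lra.
Qed.

(** One plus the harmonic number, hence positive already at n = 0. *)
Fixpoint harm n : R := if n is m.+1 then harm m + (m.+1)%:R^-1 else 1.

Lemma harm_ge1 n : 1 <= harm n.
Proof. by elim: n => [//|n IH] /=; rewrite ler_wpDr. Qed.

(** The chance of meeting a mark is at least the expected number of marks over a logarithm. In the
    induction the quadratic loss s2 (k P)^2, where P <= C / (n + 2), is absorbed by the increment 1
    / (n + 1) of [harm]. *)
Lemma gen_iter_lb (th C : R) a n : unit_valued a -> 0 <= th <= 1 -> 0 <= C ->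
  s2 * th * C * 2 <= 1 ->
  (forall m z, avgn m (fun z => 1 - a z) z <= C / (m%:R + 1)) ->
  forall z, th / harm n * avgn n (fun z => 1 - a z) z <= 1 - gen_iter n a z.
Proof.
move=> ha th01 C0 hth hC; have s20 := s2_gt0 Q_var_pos Q_var_fin.
elim: n => [|n IH] z.
  by rewrite divr1 ler_piMl; [| |case/andP: th01]; rewrite ?subr_ge0; case/andP: (ha z).
have h1 := harm_ge1 n.
set k := th / harm n in IH.
have k0 : 0 <= k by rewrite divr_ge0; lra.
have k1 : k <= 1 by rewrite ler_pdivrMr; lra.
set P := avgn n.+1 _ z.
have P0 : 0 <= P by apply: avgn_ge0 => t; rewrite subr_ge0; case/andP: (ha t).
have P1 : P <= 1 by apply: avgn_le1 => t; rewrite lerBlDr lerDl; case/andP: (ha t).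
have e : avg (gen_iter n a) z <= 1 - k * P.
  have -> : k * P = avg (fun z => k * avgn n (fun z => 1 - a z) z) z.
    by rewrite avgZ.
  rewrite lerBrDl -avgD -[leRHS](avg_cst 1 z); apply: le_avg => t.
  by have := IH t; lra.
have kP : 0 <= k * P <= 1 by rewrite mulr_ge0//= mulr_ile1.
have /andP[e0 e1] := avg_unit (gen_iter_unit n ha) z.
have h2 : gen_iter n.+1 a z <= pgf (1 - k * P).
  by rewrite /gen_iter iterS; apply: le_pgf => //; lra.
have h3 := pgf_ub Q_dist Q_critical Q_var_pos Q_var_fin kP.
apply: (@le_trans _ _ (k * P - s2 * (k * P) ^+ 2)); last by lra.
have hP := hC n.+1 z; rewrite -/P -natr1 in hP.
have n0 : 0 <= n%:R :> R by [].
have hn : 0 < n%:R + 1 + 1 :> R by lra.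
rewrite ler_pdivlMr// in hP.
have -> : th / harm n.+1 = k * (harm n / harm n.+1).
  by rewrite /k mulrA divfK//; lra.
have -> : k * P - s2 * (k * P) ^+ 2 = k * (1 - s2 * k * P) * P by ring.
rewrite ler_wpM2r// ler_wpM2l//.
have hS : harm n.+1 = harm n + (n.+1)%:R^-1 by [].
have hS1 : 0 < harm n.+1 by have := harm_ge1 n.+1; lra.
rewrite ler_pdivrMr//.
have kh : k * harm n = th by rewrite /k divfK//; lra.
rewrite hS; set u := (_^-1).
have u0 : 0 <= u by rewrite invr_ge0.
have u1 : u <= 1 by rewrite invf_le1 ?ler1n.
have un : u * (n%:R + 1) = 1 by rewrite /u -natr1 mulVf//; lra.
(* As P <= C u, harm n + u <= 2 harm n and k harm n = th, this is the hypothesis s2 th C 2 <= 1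
   times u. *)
suff : s2 * k * P * (harm n + u) <= u by lra.
have h4 : P * (n%:R + 1) <= C by nra.
have h5 : P <= C * u.
  by have : P * (n%:R + 1) * u <= C * u by [rewrite ler_wpM2r]; rewrite -mulrA (mulrC _ u) un mulr1.
have h6 : 0 <= s2 * k by rewrite mulr_ge0// ltW.
apply: (@le_trans _ _ (s2 * k * (C * u) * (2 * harm n))).
  have g1 : 0 <= s2 * k * P by rewrite mulr_ge0.
  have g2 : s2 * k * P <= s2 * k * (C * u) by rewrite ler_wpM2l.
  by apply: ler_pM => //; lra.
have -> : s2 * k * (C * u) * (2 * harm n) = (s2 * (k * harm n) * C * 2) * u by ring.
by rewrite kh ler_piMl.
Qed.

(** Time runs from the distinguished particle back to the root: side branches that leave the spine
    at step m + 1 still have m generations to run after their first displacement, whence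
    [gen_iter m a]. *)
Fixpoint killed a n : site -> R :=
  if n is m.+1 then fun z => avg (killed a m) z * dpgf (avg (gen_iter m a) z) else delta R 0.

Lemma dpgf_unit x : 0 <= x <= 1 -> 0 <= dpgf x <= 1.
Proof.
move=> x01; rewrite dpgf_ge0//=.
have := dpgf_ub Q_dist Q_critical Q_var_pos Q_var_fin (_ : 0 <= 1 - x <= 1).
rewrite (_ : 1 - (1 - x) = x); last by ring.
move=> H; apply: le_trans (H _) _; first by lra.
by rewrite lerBlDr lerDl mulr_ge0 ?(ltW (cb_gt0 _ _ _ _))//; lra.
Qed.

Lemma killed_ge0 a n z : unit_valued a -> 0 <= killed a n z.
Proof.
move=> h; elim: n z => [|n IH] z /=; first exact: delta_ge0.
rewrite mulr_ge0 ?avg_ge0//.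
by have /dpgf_unit/andP[] := avg_unit (gen_iter_unit n h) z.
Qed.

Lemma killed_le_heat a n z : unit_valued a -> killed a n z <= heat R n z.
Proof.
move=> h; elim: n z => [//|n IH] z /=.
apply: le_trans (le_avg IH z); apply: ler_piMr.
  by apply: avg_ge0 => t; exact: killed_ge0.
by have /dpgf_unit/andP[] := avg_unit (gen_iter_unit n h) z.
Qed.

(** For nonnegative f, a bound on the total mass over the lattice without an infinite sum. *)
Definition massle f (M : R) := forall s : seq site, uniq s -> \sum_(y <- s) f y <= M.

Lemma massle_avg f M : massle f M -> massle (avg f) M.
Proof.
move=> H s us; rewrite /avg -mulr_sumr exchange_big/=.
have -> : M = 5^-1 * \sum_(d <- steps) M.
  by rewrite /steps !big_cons big_nil; field.
rewrite ler_wpM2l ?invr_ge0//; apply: ler_sum => d _.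
have := H [seq y + d | y <- s]; rewrite big_map; apply.
by rewrite map_inj_uniq//; exact: addIr.
Qed.

Lemma massle_delta0 : massle (delta R 0) 1.
Proof.
move=> s us; have := @sum_heat_le R 0 s (fun=> 1) us (fun=> ler01).
by under eq_bigr do rewrite mulr1.
Qed.

(** On the good set the mass loses the fraction be n. The rest is compared with [heat] and costs be
    n * dl rather than dl, so the new bound is (1 - be n) (dl + Pi) + be n * dl = dl + (1 - be n)
    Pi: the error dl is paid only once. *)
Lemma killed_mass_ub a (be : nat -> R) (dl : R) (good : nat -> pred site) n :
  unit_valued a -> 0 <= dl -> (forall m, 0 <= be m <= 1) ->
  (forall m z, good m z -> be m <= 1 - dpgf (avg (gen_iter m a) z)) ->
  (forall m, be m != 0 -> massle (fun z => heat R m.+1 z * (~~ good m z)%:R) dl) ->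
  massle (killed a n) (dl + \prod_(m < n) (1 - be m)).
Proof.
move=> ha dl0 be01 hbe hdl; elim: n => [|n IH] s us.
  rewrite big_ord0; apply: le_trans (massle_delta0 us) _; by rewrite lerDr.
rewrite big_ord_recr /=; set Pi := \prod_(_ < _) _ in IH *.
have /andP[b0 b1] := be01 n.
apply: (@le_trans _ _ (\sum_(y <- s) ((1 - be n) * avg (killed a n) y +
   be n * (heat R n.+1 y * (~~ good n y)%:R)))).
  apply: ler_sum => y _.
  have k0 : 0 <= avg (killed a n) y by apply: avg_ge0 => t; exact: killed_ge0.
  have /dpgf_unit/andP[d0 d1] := avg_unit (gen_iter_unit n ha) y.
  have kh : avg (killed a n) y <= heat R n.+1 y.
    by apply: le_avg => t; exact: killed_le_heat.
  have := hbe n y; case: (good n y) => /= [/(_ isT)|_]; first by nra.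
  have : avg (killed a n) y * dpgf (avg (gen_iter n a) y) <= avg (killed a n) y.
    by rewrite ler_piMr.
  have : be n * avg (killed a n) y <= be n * avg (heat R n) y by rewrite ler_wpM2l.
  rewrite mulr1. lra.
rewrite big_split/=.
rewrite -[X in X + _]mulr_sumr -[X in _ + X]mulr_sumr.
have h1 := massle_avg IH us.
have h2 : be n * (\sum_(i <- s) heat R n.+1 i * (~~ good n i)%:R) <= be n * dl.
  have [->|bn] := eqVneq (be n) 0; first by rewrite !mul0r.
  by rewrite ler_wpM2l//; apply: hdl.
have : (1 - be n) * \sum_(i <- s) avg (killed a n) i <= (1 - be n) * (dl + Pi).
  by rewrite ler_wpM2l//; lra.
rewrite -/(heat R n.+1) in h2 *; lra.
Qed.

(** The killing rate at z is at most s2 times the mean of 1 - a after m + 1 steps from z. Weighting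
    z by the heat kernel at time m + 1 composes the two walks, hence 2 (m + 1) steps from the
    origin. *)
Lemma killed_mass_lb a n : unit_valued a ->
  massle (fun z => heat R n z - killed a n z)
    (s2 * \sum_(m < n) avgn (m.+1 + m.+1) (fun z => 1 - a z) 0).
Proof.
move=> ha; elim: n => [|n IH] s us.
  by rewrite big_ord0 mulr0 big1//= => i _; rewrite /heat /avgn /= subrr.
rewrite big_ord_recr /=.
apply: (@le_trans _ _ (\sum_(y <- s) (avg (fun z => heat R n z - killed a n z) y +
   s2 * (heat R n.+1 y * avgn n.+1 (fun z => 1 - a z) y)))); last first.
  rewrite big_split/= -[X in _ + X]mulr_sumr mulrDr lerD//; first exact: massle_avg.
  rewrite ler_wpM2l ?(ltW (s2_gt0 Q_var_pos Q_var_fin))//.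
  have := @sum_heat_le R n.+1 s (avgn n.+1 (fun z => 1 - a z)) us.
  rewrite -avgnD; apply => z.
  by apply: avgn_ge0 => t; rewrite subr_ge0; case/andP: (ha t).
apply: ler_sum => y _.
have -> : avg (fun z => heat R n z - killed a n z) y = heat R n.+1 y - avg (killed a n) y.
  by rewrite /heat avgnS !avgE; field.
have k0 : 0 <= avg (killed a n) y by apply: avg_ge0 => t; exact: killed_ge0.
have kh : avg (killed a n) y <= heat R n.+1 y.
  by apply: le_avg => t; exact: killed_le_heat.
have ua := avg_unit (gen_iter_unit n ha) y.
have := dpgf_lb Q_dist Q_critical Q_var_pos Q_var_fin (_ : 0 <= 1 - avg (gen_iter n a) y <= 1).
rewrite subKr => /(_ ltac:(lra)) => h.
have h2 : 1 - avg (gen_iter n a) y <= avgn n.+1 (fun z => 1 - a z) y.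
  apply: (@le_trans _ _ (avg (fun z => 1 - gen_iter n a z) y)).
    by rewrite le_eqVlt; apply/orP; left; apply/eqP; rewrite !avgE; field.
  by apply: le_avg => t; exact: gen_iter_ub.
have s20 := s2_gt0 Q_var_pos Q_var_fin.
rewrite (_ : avg (heat R n) y = heat R n.+1 y)//.
move: (avg (killed a n) y) (heat R n.+1 y) (avgn _ _ _) (avg (gen_iter n a) y) (dpgf _)
  k0 kh ua h h2 => k p P x dd k0 kp x01 hd hP.
have : s2 * (1 - x) <= s2 * P by rewrite ler_wpM2l// ltW.
have : 0 <= s2 * (1 - x) by rewrite mulr_ge0 ?(ltW s20)//; lra.
move: (s2 * (1 - x)) hd => w hd w0 wP.
have : k * (1 - w) <= k * dd by rewrite ler_wpM2l//; lra.
have h3 : k * w <= p * w by rewrite ler_wpM2r.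
have h4 : p * w <= p * (s2 * P) by rewrite ler_wpM2l//; lra.
move=> h5; lra.
Qed.

End recursions.

(** * Random variables with countably many values *)

Section discrete.
Context d (T : measurableType d) (R : realType) (P : probability T R).

Lemma discrete_preimage (E : countType) (X : T -> E) (A : set E) :
  discrete_rv X -> measurable (X @^-1` A).
Proof.
move=> dX; have -> : X @^-1` A = \bigcup_(e : E) (if `[< A e >] then X @^-1` [set e] else set0).
  apply/seteqP; split => w /=.
    by move=> Aw; exists (X w) => //; case: asboolP.
  by move=> [e _]; case: asboolP => //= Ae ->.
apply: countable_bigcupT_measurable; first exact: countableP.
by move=> e; case: asboolP.
Qed.

Lemma discrete_comp (E E' : countType) (X : T -> E) (f : E -> E') :
  discrete_rv X -> discrete_rv (f \o X).
Proof. by move=> dX x; exact: (discrete_preimage (f @^-1` [set x]) dX). Qed.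

Lemma discrete_cst (E : countType) (e : E) : discrete_rv (fun _ : T => e).
Proof.
move=> x; have [->|xe] := eqVneq x e.
  by rewrite (_ : _ @^-1` _ = setT)//; apply/seteqP; split.
by rewrite (_ : _ @^-1` _ = set0)//; apply/seteqP; split => // w /= ex; case/eqP: xe.
Qed.

Lemma discrete_bind (E E' : countType) (X : T -> E) (Y : E -> T -> E') :
  discrete_rv X -> (forall e, discrete_rv (Y e)) -> discrete_rv (fun w => Y (X w) w).
Proof.
move=> dX dY x.
have -> : (fun w => Y (X w) w) @^-1` [set x] =
    \bigcup_(e : E) ((X @^-1` [set e]) `&` (Y e @^-1` [set x])).
  apply/seteqP; split => w /=; first by move=> h; exists (X w).
  by move=> [e _ [/= <-]].
apply: countable_bigcupT_measurable; first exact: countableP.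
by move=> e; apply: measurableI; [exact: dX|exact: dY].
Qed.

Lemma discrete_pair (E1 E2 E' : countType) (f : E1 -> E2 -> E') X Y :
  discrete_rv X -> discrete_rv Y -> discrete_rv (fun w : T => f (X w) (Y w)).
Proof.
move=> dX dY; apply: (discrete_bind (Y := fun e w => f e (Y w)) dX) => e.
exact: (discrete_comp (f e) dY).
Qed.

Lemma discrete_map (I : Type) (E : countType) (X : I -> T -> E) (s : seq I) :
  (forall i, discrete_rv (X i)) -> discrete_rv (fun w => [seq X i w | i <- s]).
Proof.
move=> dX; elim: s => [|i s IH]; first exact: discrete_cst.
exact: (discrete_pair cons (dX i) IH).
Qed.

Lemma discrete_measurable_fun d' (T' : measurableType d') (E : countType) (X : T -> E)
  (h : E -> T') (D : set T) : measurable D -> discrete_rv X ->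
  measurable_fun D (fun w => h (X w)).
Proof.
move=> mD dX _ A mA; apply: measurableI => //.
exact: (discrete_preimage (h @^-1` A) dX).
Qed.

Local Open Scope ereal_scope.

(** The values of X are indexed by their codes, which makes the countable decomposition a series
    over nat; a number that codes no value contributes 0. *)
Lemma disintegrate (E : countType) (X : T -> E) (G : set T) (Phi : T -> \bar R) :
  discrete_rv X -> measurable G -> measurable_fun setT Phi -> (forall w, 0 <= Phi w) ->
  \int[P]_(w in G) Phi w = \sum_(k <oo)
    if choice.unpickle k is Some e then
      if choice.pickle e == k then \int[P]_(w in G `&` X @^-1` [set e]) Phi w else 0
    else 0.
Proof.
move=> dX mG mPhi Phi0.
pose F k : set T := G `&` [set w | choice.pickle (X w) = k].
have mF k : measurable (F k).
  apply: measurableI => //.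
  exact: (discrete_preimage [set e | choice.pickle e = k] dX).
have {1}-> : G = \bigcup_k F k.
  apply/seteqP; split => w; first by move=> Gw; exists (choice.pickle (X w)).
  by move=> [k _ []].
rewrite ge0_integral_bigcup//; first last.
- by move=> i j _ _ [w [[_ /= <-] [_ /= <-]]].
- exact: measurable_funTS.
apply: eq_eseriesr => k _.
case ek: (choice.unpickle k) => [e|]; last first.
  rewrite (_ : F k = set0) ?integral_set0//; apply/seteqP; split => // w [_ /= h].
  by move: ek; rewrite -h choice.pickleK.
case: eqP => [pk|pk].
  congr (integral _ _ _); congr (_ `&` _); apply/seteqP; split => w /=.
    by move=> h; apply: (pcan_inj choice.pickleK); rewrite h pk.
  by move=> ->.
rewrite (_ : F k = set0) ?integral_set0//; apply/seteqP; split => // w [_ /= h].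
by move: ek; rewrite -h choice.pickleK => -[e1]; apply: pk; rewrite -e1.
Qed.

(** Used with X the state of the process at time n: an identity proved on each fibre of X holds
    after summation. *)
Lemma integral_disint (E : countType) (X : T -> E) (G G' : set T)
    (Phi Phi' : T -> \bar R) (c : R) :
  discrete_rv X -> measurable G -> measurable G' ->
  measurable_fun setT Phi -> (forall w, 0 <= Phi w) ->
  measurable_fun setT Phi' -> (forall w, 0 <= Phi' w) ->
  (forall e, \int[P]_(w in G `&` X @^-1` [set e]) Phi w =
     c%:E * \int[P]_(w in G' `&` X @^-1` [set e]) Phi' w) ->
  \int[P]_(w in G) Phi w = c%:E * \int[P]_(w in G') Phi' w.
Proof.
move=> dX mG mG' mPhi Phi0 mPhi' Phi0' H.
rewrite (disintegrate dX mG)// (disintegrate dX mG')// -nneseriesZl; last first.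
  move=> k _; case: choice.unpickle => // e; case: eqP => // _.
  exact: integral_ge0.
apply: eq_eseriesr => k _.
case: choice.unpickle => [e|]; last by rewrite mule0.
by case: eqP => _; rewrite ?mule0.
Qed.

End discrete.

(** * Independent coordinates of the branching random walk and the law of fresh broods *)

Section brw.
Context d (T : measurableType d) (R : realType) (P : probability T R).
Context (Q : nat -> R) (B : branching_random_walk P 2 Q).
Hypothesis (Q_dist : is_distribution Q).
Notation site := 'rV[int]_2.
Notation coord := (label + label * nat)%type.

Definition coord_label (c : coord) : label := match c with inl v => v | inr (v, _) => v end.
Definition coord_events (c : coord) : set (set T) :=
  match c with
  | inl v => events_of (offspring B v)
  | inr (v, i) => events_of (displacement B v i)
  end.

Lemma coord_events_measurable c A : coord_events c A -> measurable A.
Proof.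
case: c => [v|[v i]] [E _ <-]; apply: discrete_preimage.
- exact: offspring_rv.
- exact: displacement_rv.
Qed.

Local Open Scope ereal_scope.

(** G is independent of the coordinates in S jointly. Conditioning on a coordinate means
    intersecting G with one of its events and removing it from S, as in [indep_of_cond]. *)
Definition indep_of (G : set T) (S : set coord) := measurable G /\
  forall (J : seq coord) (A : coord -> set T), uniq J ->
    (forall j, j \in J -> S j /\ coord_events j (A j)) ->
    P (G `&` \bigcap_(j in [set` J]) A j) = P G * \prod_(j <- J) P (A j).

Lemma indep_ofT : indep_of setT setT.
Proof.
split=> // J A uJ HJ; rewrite probability_setT mul1e setTI.
have := @brw_independent _ _ _ _ _ _ B [fset j in J]%fset A.
rewrite (_ : [set` [fset j in J]%fset] = [set` J]); last first.
  by apply/seteqP; split => j /=; rewrite in_fset_.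
move=> -> => [|j]; last first.
  by rewrite in_fset_ => /HJ[_]; case: j => [v|[v i]].
apply: perm_big; apply: uniq_perm => // j.
by rewrite in_fset_.
Qed.

Lemma indep_ofS G S S' : S' `<=` S -> indep_of G S -> indep_of G S'.
Proof.
move=> SS [mG H]; split=> // J A uJ HJ; apply: H => // j /HJ[h1 h2]; split=> //.
exact: SS.
Qed.

Lemma indep_of_prob G S c E : indep_of G S -> S c -> coord_events c E ->
  P (G `&` E) = P G * P E.
Proof.
move=> [mG H] Sc Ec; have := H [:: c] (fun=> E) isT.
rewrite big_seq1 => <-.
  by congr (P (_ `&` _)); apply/seteqP; split => w; [move=> ? j|apply; rewrite /= inE].
by move=> j; rewrite inE => /eqP ->.
Qed.

Lemma indep_of_cond G S c E : indep_of G S -> S c -> coord_events c E ->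
  indep_of (G `&` E) (S `\ c).
Proof.
move=> GS Sc Ec; have [mG H] := GS; split.
  by apply: measurableI => //; exact: coord_events_measurable Ec.
move=> J A uJ HJ.
have cJ : c \notin J by apply/negP => /HJ[[_ /=]].
pose A' j := if j == c then E else A j.
have A'c : A' c = E by rewrite /A' eqxx.
have := H (c :: J) A'; rewrite /= cJ uJ => /(_ isT).
rewrite big_cons A'c muleA -(indep_of_prob GS Sc Ec).
rewrite (eq_big_seq (fun j => P (A j))); last first.
  by move=> j jJ; rewrite /A'; case: eqP cJ jJ => // -> /negbTE ->.
move=> <-; last first.
  move=> j; rewrite inE /A' => /orP[/eqP->|jJ]; first by rewrite eqxx.
  case: eqP => [->//|_]; have [[]] := HJ _ jJ; by split.
congr (P _); rewrite -setIA; congr (_ `&` _); apply/seteqP; split => w /=.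
  move=> [Ew Aw] j /=; rewrite inE /A'; case: eqP => //= _ jJ; exact: Aw.
move=> h; split; first by have := h c; rewrite /A' /= inE eqxx; apply.
move=> j /= jJ; have := h j; rewrite /A' /= inE jJ orbT => /(_ isT).
by case: eqP cJ jJ => // -> /negbTE ->.
Qed.

Definition eavg (k : site -> \bar R) : \bar R := (5^-1)%:E * \sum_(e <- steps) k e.

Lemma site_ball_steps (x : site) :
  site_ball (0%R : site) (1%R : R) x <-> x \in steps.
Proof.
rewrite /site_ball /site_dist /= big_ord_recl big_ord1 !mxE !sub0r.
have -> : lift ord0 ord0 = 1%R :> 'I_2 by apply/val_inj.
set a := x 0%R 0%R; set b := x 0%R 1%R.
have -> : ((- a)%:~R ^+ 2 + (- b)%:~R ^+ 2 : R)%R = (a ^+ 2 + b ^+ 2)%:~R :> R.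
  by rewrite rmorphD /= !rmorphXn /= !rmorphN /= !sqrrN.
have -> : (Num.sqrt ((a ^+ 2 + b ^+ 2)%:~R : R) <= 1)%R = (a ^+ 2 + b ^+ 2 <= 1)%R.
  rewrite -[X in (_ <= X)%R = _](sqrtr1 R) ler_psqrt ?nnegrE ?ler01 ?ler0z ?addr_ge0 ?sqr_ge0//.
  by rewrite -(ler_int R).
rewrite /steps !inE !site2P !ptE0 !ptE1 !mxE -/a -/b; split; last first.
  by move=> /orP[|/orP[|/orP[|/orP[]]]] /andP[/eqP-> /eqP->].
move=> h; have : (`|a| <= 1)%R by nia.
have : (`|b| <= 1)%R by nia.
move=> ha hb; move: h; nia.
Qed.

Lemma uniq_steps : uniq steps.
Proof. by rewrite /= !inE !site2P !ptE0 !ptE1 !mxE. Qed.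

Lemma displacement_step v i e : e \in steps ->
  P (displacement B v i @^-1` [set e]) = (5^-1)%:E.
Proof.
move=> /site_ball_steps h; rewrite displacement_law indicE mem_set//.
by rewrite div1r.
Qed.

(** The five steps already carry the whole mass 5 * (1/5) = 1. *)
Lemma displacement_nostep v i :
  P (displacement B v i @^-1` [set e | e \notin steps]) = 0.
Proof.
set D := displacement B v i.
have mD : discrete_rv D by exact: displacement_rv.
have Dst x : x \in steps -> P (D @^-1` [set x]) = (5^-1)%:E by exact: displacement_step.
have : P (D @^-1` [set e | e \notin steps]) + P (D @^-1` [set e | e \in steps]) = 1.
  have m1 : measurable (D @^-1` [set e | e \notin steps]) by exact: discrete_preimage.
  have m2 : measurable (D @^-1` [set e | e \in steps]) by exact: discrete_preimage.
  rewrite -measureU//; last by apply/seteqP; split => // w [/= /negP].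
  rewrite (_ : _ `|` _ = setT); first exact: probability_setT.
  by apply/seteqP; split => // w _ /=; case: (D w \in steps); [right|left].
have -> : P (D @^-1` [set e | e \in steps]) = 1.
  have -> : D @^-1` [set e | e \in steps] = \big[setU/set0]_(e <- steps) D @^-1` [set e].
    rewrite -bigcup_seq; apply/seteqP; split => w /=; first by exists (D w).
    by move=> [e es /= ->].
  have : forall s : seq site, uniq s -> {subset s <= steps} ->
      P (\big[setU/set0]_(e <- s) D @^-1` [set e]) = \sum_(e <- s) (5^-1)%:E.
    elim => [|e s IH] /=; first by rewrite !big_nil measure0.
    move=> /andP[es us] ss; rewrite !big_cons measureU//.
    - congr (_ + _); first by apply: Dst; rewrite ss// inE eqxx.
      by apply: IH => // x xs; rewrite ss// inE xs orbT.
    - by apply: bigsetU_measurable => x _; exact: mD.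
    - rewrite -bigcup_seq; apply/seteqP; split => // w [/= we [x xs /= xw]].
      by move: es; rewrite -we xw xs.
  move=> /(_ steps uniq_steps (fun x h => h)) ->.
  by rewrite /steps !big_cons big_nil adde0 -!EFinD; congr EFin; lra.
set p := P _ => h.
have pf : p \is a fin_num by apply: fin_num_measure; exact: discrete_preimage.
by move: h; rewrite -(fineK pf) -EFinD => -[h]; congr EFin; lra.
Qed.

(** Conditions on a single offspring number; [k l] is the conditional expectation of Phi given the
    value l. *)
Lemma integral_offspring G S v (Phi : T -> \bar R) (k : nat -> \bar R) :
  indep_of G S -> S (inl v) -> measurable_fun setT Phi -> (forall w, 0 <= Phi w) ->
  (forall l, 0 <= k l) ->
  (forall l, \int[P]_(w in G `&` offspring B v @^-1` [set l]) Phi w =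
     P (G `&` offspring B v @^-1` [set l]) * k l) ->
  \int[P]_(w in G) Phi w = P G * EQ Q k.
Proof.
move=> GS Sv mPhi Phi0 k0 H; have [mG _] := GS.
have {1}-> : G = \bigcup_l (G `&` offspring B v @^-1` [set l]).
  by rewrite -setI_bigcupr; apply/seteqP; split => w; [move=> ?; split=> //; exists (offspring B v w)|case].
rewrite ge0_integral_bigcup//; first last.
- by move=> i j _ _ [w [[_ /= <-] [_ /= <-]]].
- exact: measurable_funTS.
- by move=> l; apply: measurableI => //; exact: offspring_rv.
have pf : P G \is a fin_num by exact: fin_num_measure.
rewrite -(fineK pf) /EQ -nneseriesZl; last first.
  by move=> l _; rewrite mule_ge0// lee_fin; case: Q_dist.
apply: eq_eseriesr => l _; rewrite H fineK// (indep_of_prob GS Sv); last by exists [set l].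
by rewrite offspring_law muleA.
Qed.

Lemma integral_displacement G S v i (Phi : T -> \bar R) (k : site -> \bar R) :
  indep_of G S -> S (inr (v, i)) -> measurable_fun setT Phi -> (forall w, 0 <= Phi w) ->
  (forall e, 0 <= k e) ->
  (forall e, \int[P]_(w in G `&` displacement B v i @^-1` [set e]) Phi w =
     P (G `&` displacement B v i @^-1` [set e]) * k e) ->
  \int[P]_(w in G) Phi w = P G * eavg k.
Proof.
move=> GS Sv mPhi Phi0 k0 H; have [mG _] := GS.
set D := displacement B v i in H *.
have mD : discrete_rv D by exact: displacement_rv.
have Dst x : x \in steps -> P (D @^-1` [set x]) = (5^-1)%:E by exact: displacement_step.
have mGD A : measurable (G `&` D @^-1` A).
  by apply: measurableI => //; exact: discrete_preimage.
have {1}-> : G = (G `&` D @^-1` [set e | e \notin steps]) `|`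
    (G `&` D @^-1` [set e | e \in steps]).
  rewrite -setIUr; apply/seteqP; split => w; last by case.
  by move=> Gw; split=> //=; case: (D w \in steps); [right|left].
rewrite ge0_integral_setU//; last 2 first.
- exact: measurable_funTS.
- by rewrite disj_set2E; apply/eqP/seteqP; split => // w [[_ /= /negP h] [_ /= /h]].
rewrite null_set_integral ?add0e//; last 2 first.
- exact: measurable_funTS.
- apply/eqP; rewrite eq_le measure_ge0 andbT -(displacement_nostep v i).
  by apply: le_measure; [rewrite inE; exact: mGD|rewrite inE; exact: discrete_preimage|exact: subIsetr].
have pf : P G \is a fin_num by exact: fin_num_measure.
suff : forall s : seq site, uniq s -> {subset s <= steps} ->
    \int[P]_(w in G `&` D @^-1` [set e | e \in s]) Phi w =
    P G * ((5^-1)%:E * \sum_(e <- s) k e).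
  by move=> /(_ steps uniq_steps (fun x h => h)).
elim => [|e s IH] /=.
  move=> _ _; rewrite big_nil mule0 mule0.
  by rewrite (_ : _ `&` _ = set0) ?integral_set0//; apply/seteqP; split => // w [_ /=].
move=> /andP[es us] ss.
have -> : G `&` D @^-1` [set x | x \in e :: s] =
    (G `&` D @^-1` [set e]) `|` (G `&` D @^-1` [set x | x \in s]).
  rewrite -setIUr -preimage_setU; congr (_ `&` _ @^-1` _); apply/seteqP; split => x /=.
    by rewrite inE => /orP[/eqP|]; [left|right].
  by rewrite inE => -[->|->]; rewrite ?eqxx ?orbT.
rewrite ge0_integral_setU//; last 2 first.
- exact: measurable_funTS.
- rewrite disj_set2E; apply/eqP/seteqP; split => // w [[_ /= we] [_ /=]].
  by rewrite we (negbTE es).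
rewrite H IH//; last by move=> x xs; rewrite ss// inE xs orbT.
rewrite (indep_of_prob GS Sv); last by exists [set e].
rewrite Dst ?ss ?inE ?eqxx// big_cons.
rewrite (ge0_muleDr (5^-1)%:E)//; last exact: sume_ge0.
have S0 : 0 <= \sum_(x <- s) k x by exact: sume_ge0.
have c0 : 0 <= (5^-1 : R)%:E by rewrite lee_fin invr_ge0.
by rewrite ge0_muleDr ?mule_ge0// !muleA.
Qed.

(** Expectation over l independent uniform steps as an iterated average; [Ebrood] and [Ebroods] add
    the random offspring number and several parents. One generation thus becomes a computation with
    explicit sums. *)
Fixpoint Edisp (l : nat) (h : seq site -> \bar R) : \bar R :=
  if l is m.+1 then eavg (fun e => Edisp m (fun s => h (e :: s))) else h [::].

Definition Ebrood (h : seq site -> \bar R) : \bar R := EQ Q (fun l => Edisp l h).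

Fixpoint Ebroods (m : nat) (F : seq (seq site) -> \bar R) : \bar R :=
  if m is m'.+1 then Ebrood (fun s => Ebroods m' (fun ss => F (s :: ss))) else F [::].

Definition brood (v : label) (w : T) : seq site :=
  [seq displacement B v i w | i <- iota 0 (offspring B v w)].

Lemma discrete_brood v : discrete_rv (brood v).
Proof.
apply: (discrete_bind (Y := fun l w => [seq displacement B v i w | i <- iota 0 l])).
  exact: offspring_rv.
by move=> l; apply: discrete_map => i; exact: displacement_rv.
Qed.

Lemma eavg_ge0 k : (forall e, 0 <= k e) -> 0 <= eavg k.
Proof. by move=> k0; rewrite mule_ge0 ?sume_ge0// lee_fin invr_ge0. Qed.

Lemma Edisp_ge0 l h : (forall s, 0 <= h s) -> 0 <= Edisp l h.
Proof. by elim: l h => [|l IH] h h0 //=; apply: eavg_ge0 => e; exact: IH. Qed.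

Lemma Ebrood_ge0 h : (forall s, 0 <= h s) -> 0 <= Ebrood h.
Proof. by move=> h0; apply: EQ_ge0 => // l; exact: Edisp_ge0. Qed.

Lemma Ebroods_ge0 m F : (forall s, 0 <= F s) -> 0 <= Ebroods m F.
Proof. by elim: m F => [|m IH] F F0 //=; apply: Ebrood_ge0 => s; exact: IH. Qed.

(** Coordinates are consumed one by one: the offspring number of the first label, its displacements,
    then the remaining labels. Each is removed from S as soon as it has been conditioned on. *)
Lemma integral_broods (vs : seq label) G S (F : seq (seq site) -> \bar R) :
  uniq vs -> indep_of G S -> (forall c, coord_label c \in vs -> S c) ->
  (forall ss, 0 <= F ss) ->
  \int[P]_(w in G) F [seq brood v w | v <- vs] = P G * Ebroods (size vs) F.
Proof.
elim: vs G S F => [|v vs IH] G S F.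
  move=> _ [mG _] _ F0 /=; rewrite (_ : (fun w => F _) = cst (F [::]))//.
  by rewrite integral_cst// muleC.
move=> /= /andP[vvs uvs] GS HS F0.
have dm : discrete_rv (fun w => [seq brood v w | v <- vs]).
  by apply: discrete_map => x; exact: discrete_brood.
have d1 : discrete_rv (fun w => [seq brood v w | v <- v :: vs]).
  by apply: discrete_map => x; exact: discrete_brood.
(* Here the displacements of v with indices a, ..., a + l - 1 are still to be integrated, followed
   by the broods of the other labels. *)
have key l a G' S' (h : seq site -> seq (seq site) -> \bar R) :
    indep_of G' S' -> (forall c, coord_label c \in vs -> S' c) ->
    (forall i, (a <= i)%N -> S' (inr (v, i))) -> (forall s ss, 0 <= h s ss) ->
    \int[P]_(w in G') h [seq displacement B v i w | i <- iota a l] [seq brood v w | v <- vs]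
    = P G' * Edisp l (fun s => Ebroods (size vs) (h s)).
  elim: l a G' S' h => [|l IHl] a G' S' h GS' HS' HS'v h0 /=; first by rewrite (IH G' S').
  apply: (integral_displacement GS' (HS'v a (leqnn a))).
  - apply: (discrete_measurable_fun (X := fun w => ([seq displacement B v i w | i <- a :: iota a.+1 l], [seq brood v w | v <- vs])) (fun p => h p.1 p.2)) => //.
    by apply: discrete_pair => //; apply: discrete_map => i; exact: displacement_rv.
  - by [].
  - by move=> e; apply: Edisp_ge0 => s; exact: Ebroods_ge0.
  move=> e; rewrite -(IHl a.+1 _ (S' `\ inr (v, a)) (fun s => h (e :: s)))//.
  - by apply: eq_integral => w; rewrite inE => -[_ /= ->].
  - by apply: indep_of_cond => //; [exact: HS'v|exists [set e]].
  - move=> c cvs; split; [exact: HS'|move=> /= ce].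
    by move: cvs; rewrite ce /= (negbTE vvs).
  - move=> i ai; split; first by apply: HS'v; exact: ltnW.
    by move=> [ia]; move: ai; rewrite ia ltnn.
apply: (integral_offspring GS); first by apply: HS; exact: mem_head.
- exact: (discrete_measurable_fun F).
- by [].
- by move=> l; apply: Edisp_ge0 => s; exact: Ebroods_ge0.
move=> l; rewrite -(key l 0%N _ (S `\ inl v) (fun s ss => F (s :: ss)))//.
- by apply: eq_integral => w; rewrite inE /brood => -[_ /= ->].
- by apply: indep_of_cond => //; [apply: HS; exact: mem_head|exists [set l]].
- move=> c cvs; split; first by apply: HS; rewrite inE cvs orbT.
  by move=> /= ce; move: cvs; rewrite ce /= (negbTE vvs).
- by move=> i _; split => //; apply: HS; exact: mem_head.
Qed.

End brw.

(** * The Markov property of labelled generations *)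

Section state.
Context d (T : measurableType d) (R : realType) (P : probability T R).
Context (Q : nat -> R) (B : branching_random_walk P 2 Q).
Hypothesis (Q_dist : is_distribution Q).
Notation site := 'rV[int]_2.
Notation coord := (label + label * nat)%type.
Notation brood := (brood B).
Notation indep_of := (indep_of B).
Notation coord_events := (coord_events B).

(** Labels accompany the positions because they determine which coordinates the next generation
    reads. *)
Definition st n w : seq (label * site) := [seq (u, location B u w) | u <- generation B n w].

Definition assemble (ys : seq (label * site)) (ss : seq (seq site)) :=
  flatten [seq [seq (i :: p.1.1, p.1.2 + nth 0 p.2 i) | i <- iota 0 (size p.2)] | p <- zip ys ss].

Lemma st_labels n w : unzip1 (st n w) = generation B n w.
Proof. by rewrite /unzip1 -map_comp map_id. Qed.

Lemma stS n w : st n.+1 w = assemble (st n w) [seq brood u w | u <- generation B n w].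
Proof.
rewrite /st /=; elim: (generation B n w) => [//|u s IH].
rewrite /assemble /= map_cat IH; congr (_ ++ _).
rewrite size_map size_iota -map_comp; apply/eq_in_map => i; rewrite mem_iota => /= iu.
by rewrite (nth_map 0%N) ?size_iota// nth_iota.
Qed.

Lemma size_generation n w u : u \in generation B n w -> size u = n.
Proof.
elim: n u => [|n IH] u /=; first by rewrite inE => /eqP->.
by move=> /allpairsPdep[v [i [/IH <- _ ->]]].
Qed.

Lemma uniq_generation n w : uniq (generation B n w).
Proof.
elim: n => [//|n IH] /=; apply: allpairs_uniq_dep => // [v _|]; first exact: iota_uniq.
by move=> [v i] [v' i'] _ _ /= [-> ->].
Qed.

Lemma discrete_st n : discrete_rv (st n).
Proof.
elim: n => [|n IH]; first by move=> x; exact: (@discrete_cst _ T (seq (label * site)) [:: ([::], 0)] x).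
pose Y ys w := assemble ys [seq brood u w | u <- unzip1 ys].
rewrite (_ : st n.+1 = fun w => Y (st n w) w).
  apply: (discrete_bind (E := seq (label * site)) (Y := Y)) => // ys.
  apply: (discrete_comp (E := seq (seq site)) (assemble ys)
    (X := fun w => [seq brood u w | u <- unzip1 ys])).
  by apply: discrete_map => u; exact: discrete_brood.
by apply/funext => w; rewrite /Y stS st_labels.
Qed.

Local Open Scope ereal_scope.

Lemma indep_of_conds G S (J : seq coord) (A : coord -> set T) : indep_of G S -> uniq J ->
  (forall j, j \in J -> S j /\ coord_events j (A j)) ->
  indep_of (G `&` \bigcap_(j in [set` J]) A j) (S `\` [set` J]).
Proof.
elim: J G S => [|c J IH] G S GS.
  move=> _ _; rewrite (_ : \bigcap_(_ in _) _ = setT); last first.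
    by apply/seteqP; split => // w _ j.
  by rewrite setIT; apply: indep_ofS GS => c [].
move=> /= /andP[cJ uJ] H.
have [Sc Ac] := H c (mem_head _ _).
have := IH _ _ (indep_of_cond GS Sc Ac) uJ.
rewrite (_ : G `&` A c `&` _ = G `&` \bigcap_(j in [set` c :: J]) A j); last first.
  rewrite -setIA; congr (_ `&` _); apply/seteqP; split => w /=.
    by move=> [Acw Aw] j /=; rewrite inE => /orP[/eqP->//|/Aw].
  move=> Aw; split; first by apply: Aw; rewrite /= mem_head.
  by move=> j /= jJ; apply: Aw; rewrite /= inE jJ orbT.
move=> H1; apply: indep_ofS (H1 _).
  move=> j [Sj /= jJ]; rewrite inE in jJ; split; last by move=> jJ'; apply: jJ; rewrite jJ' orbT.
  by split=> // /= jc; apply: jJ; rewrite jc eqxx.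
move=> j jJ; have [|Sj Aj] := H j; first by rewrite inE jJ orbT.
by split=> //; split=> //= jc; move: cJ; rewrite -jc jJ.
Qed.

Lemma integral_broods_st n G S ys (F : seq (seq site) -> \bar R) :
  indep_of G S -> G `<=` st n @^-1` [set ys] ->
  (forall c, size (coord_label c) = n -> S c) -> (forall ss, 0 <= F ss) ->
  \int[P]_(w in G) F [seq brood v w | v <- unzip1 ys] = P G * Ebroods Q (size ys) F.
Proof.
move=> GS Gys HS F0.
have [->|/set0P[w Gw]] := eqVneq G set0; first by rewrite integral_set0 measure0 mul0e.
have e := Gys w Gw; have eg : unzip1 ys = generation B n w by rewrite -st_labels e.
rewrite -(size_map fst ys) -/(unzip1 ys); apply: (integral_broods Q_dist _ GS) => //.
  by rewrite eg; exact: uniq_generation.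
by move=> c; rewrite eg => /size_generation; exact: HS.
Qed.

(** For the step, condition on the state at time n: the next state reads only coordinates at labels
    of length n, whereas the tested coordinates J sit at labels of length at least n + 1. *)
Lemma st_indep n ys : indep_of (st n @^-1` [set ys]) [set c | (n <= size (coord_label c))%N].
Proof.
elim: n ys => [|n IH] ys.
  have [->|h] := eqVneq ys [:: ([::], 0%R)].
    rewrite (_ : _ @^-1` _ = setT); last by apply/seteqP; split.
    by apply: indep_ofS (@indep_ofT _ _ _ _ _ B).
  rewrite (_ : _ @^-1` _ = set0); last first.
    by apply/seteqP; split => // w /= e; case/eqP: h.
  by split => // J A _ _; rewrite set0I measure0 mul0e.
split; first exact: discrete_st.
move=> J A uJ HJ.
set C := \bigcap_(j in _) _.
have mC : measurable C.
  apply: fin_bigcap_measurable => // j /= /HJ[_]; exact: coord_events_measurable.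
pose p := \prod_(j <- J) P (A j).
have pf : p \is a fin_num.
  rewrite /p big_seq; apply: prode_fin_num => j jJ; apply: fin_num_measure.
  by have [_] := HJ j jJ; exact: coord_events_measurable.
pose Phi w : \bar R := (\1_[set ys] (st n.+1 w))%:E.
have mPhi : measurable_fun setT Phi.
  exact: (discrete_measurable_fun (fun s => (\1_[set ys] s)%:E) _ (@discrete_st n.+1)).
have Phi0 w : 0 <= Phi w by rewrite lee_fin.
have PhiE G : measurable G -> \int[P]_(w in G) Phi w = P (st n.+1 @^-1` [set ys] `&` G).
  move=> mG; rewrite -integral_indic//; last exact: discrete_st.
have key ys0 G : measurable G -> indep_of (G `&` st n @^-1` [set ys0])
      [set c | size (coord_label c) = n] ->
    \int[P]_(w in G `&` st n @^-1` [set ys0]) Phi w =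
    P (G `&` st n @^-1` [set ys0]) *
      Ebroods Q (size ys0) (fun ss => (\1_[set ys] (assemble ys0 ss))%:E).
  move=> mG iG; rewrite -(integral_broods_st (n := n) (ys := ys0) iG)//.
  by apply: eq_integral => w; rewrite inE => -[_ /= e]; rewrite /Phi stS -e st_labels.
rewrite -PhiE// -[in RHS](setIT (_ @^-1` _)) -PhiE// muleC -/p -(fineK pf).
apply: (integral_disint (@discrete_st n)) => // ys0.
have [mS _] := IH ys0.
have HJ' j : j \in J -> (n <= size (coord_label j))%N /\ coord_events j (A j).
  by move=> /HJ[/= h1 h2]; split=> //; exact: ltnW.
have i1 := indep_of_conds (IH ys0) uJ HJ'.
rewrite key//; last first.
  rewrite setIC; apply: indep_ofS i1 => c /= e; split; first by rewrite /= e.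
  by move=> /= /HJ[/=]; rewrite e ltnn.
rewrite key//; last first.
  by rewrite setTI; apply: indep_ofS (IH ys0) => c /= ->.
rewrite setTI setIC (fineK pf).
have [_ ->//] := IH ys0.
by rewrite (muleC (P _)) muleA.
Qed.

Lemma one_step n (F : seq (label * site) -> \bar R) : (forall s, 0 <= F s) ->
  \int[P]_w F (st n.+1 w) =
  \int[P]_w Ebroods Q (size (st n w)) (fun ss => F (assemble (st n w) ss)).
Proof.
move=> F0.
rewrite -[RHS]mul1e; apply: (integral_disint (@discrete_st n)) => //.
- exact: (discrete_measurable_fun F _ (@discrete_st n.+1)).
- exact: (discrete_measurable_fun (fun ys => Ebroods Q (size ys) (fun ss => F (assemble ys ss)))
   _ (@discrete_st n)).
- by move=> w; apply: Ebroods_ge0.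
move=> ys; rewrite !setTI mul1e.
transitivity (\int[P]_(w in st n @^-1` [set ys])
   F (assemble ys [seq brood v w | v <- unzip1 ys])).
  by apply: eq_integral => w; rewrite inE => /= e; rewrite stS -e st_labels.
rewrite (@integral_broods_st n _ _ ys (fun ss => F (assemble ys ss)) (st_indep n ys))//; last first.
  by move=> c /= ->.
transitivity (\int[P]_(w in st n @^-1` [set ys])
   (cst (Ebroods Q (size ys) (fun ss => F (assemble ys ss)))) w).
  have mD : measurable (st n @^-1` [set ys]) by exact: discrete_st.
  by rewrite (integral_cst P mD) muleC.
by apply: eq_integral => w; rewrite inE => /= ->.
Qed.

End state.

(** * One generation acting on product and spine functionals *)

Section functionals.
Context (R : realType) (Q : nat -> R).
Hypothesis (Q_dist : is_distribution Q) (Q_critical : dist_mean Q = 1%E).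
Notation site := 'rV[int]_2.
Implicit Types (a psi : site -> R).

Definition lap a (s : seq site) : R := \prod_(x <- s) a x.

(* The sum over one distinguished particle v of psi v times the product of a over the other particles. *)
Fixpoint sp psi a (s : seq site) : R :=
  if s is x :: s' then psi x * lap a s' + a x * sp psi a s' else 0.

Lemma lap_cat a s t : lap a (s ++ t) = lap a s * lap a t.
Proof. exact: big_cat. Qed.

Lemma lap_ge0 a s : (forall x, 0 <= a x) -> 0 <= lap a s.
Proof. by move=> h; apply: prodr_ge0. Qed.

Lemma lap_le1 a s : unit_valued a -> lap a s <= 1.
Proof. by move=> h; apply: prodr_ile1 => x _; exact: h. Qed.

Lemma sp_cat psi a s t : sp psi a (s ++ t) = sp psi a s * lap a t + lap a s * sp psi a t.
Proof.
elim: s => [|x s IH] /=; first by rewrite /lap big_nil; ring.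
by rewrite IH lap_cat [lap a (x :: s)]big_cons -/(lap a s); ring.
Qed.

Lemma sp_ge0 psi a s : (forall x, 0 <= psi x) -> (forall x, 0 <= a x) -> 0 <= sp psi a s.
Proof. by move=> h1 h2; elim: s => [//|x s IH] /=; rewrite addr_ge0// mulr_ge0// lap_ge0. Qed.

Local Open Scope ereal_scope.

Lemma eavg_EFin (f : site -> R) : eavg (fun e => (f e)%:E) = (5^-1 * \sum_(e <- steps) f e)%:E.
Proof. by rewrite /eavg sumEFin. Qed.

Lemma eq_eavg k1 k2 : k1 =1 k2 -> eavg k1 = eavg k2 :> \bar R.
Proof. by move=> e; congr (_ * _); apply: eq_bigr. Qed.

Lemma eavgD k1 k2 : (forall e, 0 <= k1 e) -> (forall e, 0 <= k2 e) ->
  eavg (fun e => k1 e + k2 e) = eavg k1 + eavg k2 :> \bar R.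
Proof.
move=> h1 h2; rewrite /eavg big_split /= ge0_muleDr//; exact: sume_ge0.
Qed.

Lemma eavgZ (c : R) k : (forall e, 0 <= k e) ->
  eavg (fun e => c%:E * k e) = c%:E * eavg k :> \bar R.
Proof.
move=> h; rewrite /eavg muleCA; congr (_ * _); rewrite ge0_sume_distrr//.
Qed.

Lemma eq_Edisp l h1 h2 : h1 =1 h2 -> Edisp l h1 = Edisp l h2 :> \bar R.
Proof.
elim: l h1 h2 => [|l IH] h1 h2 e /=; first by rewrite e.
by apply: eq_eavg => x; apply: IH => s; rewrite e.
Qed.

Lemma EdispD l h1 h2 : (forall e, 0 <= h1 e) -> (forall e, 0 <= h2 e) ->
  Edisp l (fun e => h1 e + h2 e) = Edisp l h1 + Edisp l h2 :> \bar R.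
Proof.
elim: l h1 h2 => [//|l IH] h1 h2 p1 p2 /=.
rewrite -eavgD; [|by move=> e; exact: Edisp_ge0|by move=> e; exact: Edisp_ge0].
by apply: eq_eavg => e; rewrite IH.
Qed.

Lemma EdispZ l (c : R) h : (0 <= c)%R -> (forall e, 0 <= h e) ->
  Edisp l (fun e => c%:E * h e) = c%:E * Edisp l h :> \bar R.
Proof.
move=> c0; elim: l h => [//|l IH] h p /=.
rewrite -eavgZ; last by move=> e; exact: Edisp_ge0.
by apply: eq_eavg => e; rewrite IH.
Qed.

Lemma eq_Ebrood h1 h2 : h1 =1 h2 -> Ebrood Q h1 = Ebrood Q h2.
Proof. by move=> e; apply: eq_EQ => l; exact: eq_Edisp. Qed.

Lemma EbroodD h1 h2 : (forall e, 0 <= h1 e) -> (forall e, 0 <= h2 e) ->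
  Ebrood Q (fun e => h1 e + h2 e) = Ebrood Q h1 + Ebrood Q h2.
Proof.
move=> p1 p2; rewrite /Ebrood -EQD//; [|by move=> l; exact: Edisp_ge0|by move=> l; exact: Edisp_ge0].
by apply: eq_EQ => l; rewrite EdispD.
Qed.

Lemma EbroodZ (c : R) h : (0 <= c)%R -> (forall e, 0 <= h e) ->
  Ebrood Q (fun e => c%:E * h e) = c%:E * Ebrood Q h.
Proof.
move=> c0 p; rewrite /Ebrood -EQZ//; last by move=> l; exact: Edisp_ge0.
by apply: eq_EQ => l; rewrite EdispZ.
Qed.

Lemma eq_Ebroods m F1 F2 : F1 =1 F2 -> Ebroods Q m F1 = Ebroods Q m F2.
Proof.
elim: m F1 F2 => [|m IH] F1 F2 e /=; first by rewrite e.
by apply: eq_Ebrood => s; apply: IH => ss; rewrite e.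
Qed.

Lemma EbroodsD m F1 F2 : (forall e, 0 <= F1 e) -> (forall e, 0 <= F2 e) ->
  Ebroods Q m (fun e => F1 e + F2 e) = Ebroods Q m F1 + Ebroods Q m F2.
Proof.
elim: m F1 F2 => [//|m IH] F1 F2 p1 p2 /=.
rewrite -EbroodD; [|by move=> s; exact: Ebroods_ge0|by move=> s; exact: Ebroods_ge0].
by apply: eq_Ebrood => s; rewrite IH.
Qed.

Lemma EbroodsZ m (c : R) F : (0 <= c)%R -> (forall e, 0 <= F e) ->
  Ebroods Q m (fun e => c%:E * F e) = c%:E * Ebroods Q m F.
Proof.
move=> c0; elim: m F => [//|m IH] F p /=.
rewrite -EbroodZ//; last by move=> s; exact: Ebroods_ge0.
by apply: eq_Ebrood => s; rewrite IH.
Qed.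

Lemma Edisp_lap l a x : (forall x, 0 <= a x)%R ->
  Edisp l (fun s => (lap a [seq x + d | d <- s])%:E)%R = (avg a x ^+ l)%:E.
Proof.
move=> a0; elim: l => [|l IH] /=; first by rewrite /lap big_nil.
transitivity (eavg (fun e => ((a (x + e)) * avg a x ^+ l)%:E)%R).
  apply: eq_eavg => e; rewrite EFinM -IH -EdispZ//; last by move=> s; rewrite lee_fin lap_ge0.
  by apply: eq_Edisp => s; rewrite -EFinM [X in X%:E]big_cons.
by rewrite eavg_EFin -mulr_suml mulrA exprS.
Qed.

(** Any of the l children may be the distinguished one and the other l - 1 contribute avg a each, as
    in the derivative of s^l. *)
Lemma Edisp_sp l psi a x : (forall x, 0 <= psi x)%R -> (forall x, 0 <= a x)%R ->
  Edisp l (fun s => (sp psi a [seq x + d | d <- s])%:E)%R =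
  (avg psi x * (l%:R * avg a x ^+ l.-1))%:E.
Proof.
move=> p0 a0; elim: l => [|l IH] /=; first by rewrite mul0r mulr0.
transitivity (eavg (fun e => ((psi (x + e)) * avg a x ^+ l)%:E +
    (a (x + e) * (avg psi x * (l%:R * avg a x ^+ l.-1)))%:E)%R).
  apply: eq_eavg => e; rewrite (EFinM (psi _)) (EFinM (a _)) -IH -Edisp_lap//.
  rewrite -!EdispZ//; last 2 first.
  - by move=> s; rewrite lee_fin sp_ge0.
  - by move=> s; rewrite lee_fin lap_ge0.
  rewrite -EdispD; last 2 first.
  - by move=> s; rewrite -EFinM lee_fin mulr_ge0// lap_ge0.
  - by move=> s; rewrite -EFinM lee_fin mulr_ge0// sp_ge0.
  by apply: eq_Edisp => s; rewrite -!EFinM -EFinD.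
under eq_eavg do rewrite -EFinD.
rewrite eavg_EFin big_split/= -!mulr_suml mulrDr !mulrA -/(avg psi x) -/(avg a x).
rewrite /avg; congr (_%:E)%R.
case: l {IH} => [|l]; first by rewrite /=; ring.
by rewrite /= exprS -(natr1 l.+1) /avg; ring.
Qed.

Definition posasm (xs : seq site) (ss : seq (seq site)) : seq site :=
  flatten [seq [seq (p.1 + d)%R | d <- p.2] | p <- zip xs ss].

Lemma Ebroods_lap a xs : unit_valued a ->
  Ebroods Q (size xs) (fun ss => (lap a (posasm xs ss))%:E) = (lap (gen_step Q a) xs)%:E.
Proof.
move=> ha; have a0 x : (0 <= a x)%R by case/andP: (ha x).
have g0 x : (0 <= gen_step Q a x)%R by case/andP: (gen_step_unit Q_dist ha x).
elim: xs => [|x xs IH]; first by rewrite /= /lap !big_nil.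
rewrite [size _]/= [LHS]/=.
transitivity (Ebrood Q (fun s => (lap (gen_step Q a) xs)%:E * (lap a [seq x + d | d <- s]%R)%:E)).
  apply: eq_Ebrood => s; rewrite muleC -IH -EbroodsZ ?lap_ge0//; last by move=> ss; rewrite lee_fin lap_ge0.
  by apply: eq_Ebroods => ss; rewrite -EFinM -lap_cat.
rewrite EbroodZ ?lap_ge0//; last by move=> s; rewrite lee_fin lap_ge0.
rewrite /Ebrood; under eq_EQ do rewrite Edisp_lap//.
rewrite pgf_fin//; last exact: avg_unit.
by rewrite -EFinM [in RHS]/lap big_cons mulrC.
Qed.

Definition spine_step psi a x : R := (avg psi x * dpgf Q (avg a x))%R.

Lemma spine_step_ge0 psi a x : (forall x, 0 <= psi x)%R -> unit_valued a ->
  (0 <= spine_step psi a x)%R.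
Proof. by move=> h1 h2; rewrite mulr_ge0 ?avg_ge0// dpgf_ge0//; exact: avg_unit. Qed.

(** A distinguished child singles out its parent: the family of that parent yields avg psi times f'
    at avg a, that is [spine_step], and every other family yields [gen_step Q a]. *)
Lemma Ebroods_sp psi a xs : (forall x, 0 <= psi x)%R -> unit_valued a ->
  Ebroods Q (size xs) (fun ss => (sp psi a (posasm xs ss))%:E) =
  (sp (spine_step psi a) (gen_step Q a) xs)%:E.
Proof.
move=> p0 ha; have a0 x : (0 <= a x)%R by case/andP: (ha x).
have g0 x : (0 <= gen_step Q a x)%R by case/andP: (gen_step_unit Q_dist ha x).
have s0 x : (0 <= spine_step psi a x)%R by exact: spine_step_ge0.
elim: xs => [//|x xs IH].
rewrite [size _]/= [LHS]/=.
transitivity (Ebrood Q (fun s =>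
   (lap (gen_step Q a) xs)%:E * (sp psi a [seq x + d | d <- s]%R)%:E +
   (sp (spine_step psi a) (gen_step Q a) xs)%:E * (lap a [seq x + d | d <- s]%R)%:E)).
  apply: eq_Ebrood => s; rewrite [X in _ = X + _]muleC [X in _ = _ + X]muleC -IH -Ebroods_lap//.
  rewrite -!EbroodsZ ?lap_ge0 ?sp_ge0//; last 2 first.
  - by move=> ss; rewrite lee_fin sp_ge0.
  - by move=> ss; rewrite lee_fin lap_ge0.
  rewrite -EbroodsD; last 2 first.
  - by move=> ss; rewrite -EFinM lee_fin mulr_ge0 ?lap_ge0 ?sp_ge0.
  - by move=> ss; rewrite -EFinM lee_fin mulr_ge0 ?lap_ge0 ?sp_ge0.
  by apply: eq_Ebroods => ss; rewrite -!EFinM -EFinD -sp_cat.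
rewrite EbroodD; last 2 first.
- by move=> s; rewrite -EFinM lee_fin mulr_ge0 ?lap_ge0 ?sp_ge0.
- by move=> s; rewrite -EFinM lee_fin mulr_ge0 ?lap_ge0 ?sp_ge0.
rewrite !EbroodZ ?lap_ge0 ?sp_ge0//; last 2 first.
- by move=> s; rewrite lee_fin lap_ge0.
- by move=> s; rewrite lee_fin sp_ge0.
rewrite /Ebrood; under eq_EQ do rewrite Edisp_sp//.
under [X in _ + _ * X]eq_EQ do rewrite Edisp_lap//.
under eq_EQ do rewrite EFinM.
have au : (0 <= avg a x <= 1)%R by exact: avg_unit.
rewrite EQZ//; last first.
  by move=> l; rewrite lee_fin mulr_ge0// exprn_ge0//; case/andP: au.
rewrite pgf_fin// dpgf_fin// -!EFinM -EFinD /= /spine_step /gen_step.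
by congr (_%:E); ring.
Qed.

End functionals.

(** * Expectations of the functionals over n generations *)

Section expectations.
Context d (T : measurableType d) (R : realType) (P : probability T R).
Context (Q : nat -> R) (B : branching_random_walk P 2 Q).
Hypothesis (Q_dist : is_distribution Q) (Q_critical : dist_mean Q = 1%E).
Notation site := 'rV[int]_2.
Implicit Types (a psi : site -> R).

Definition pos n w : seq site := [seq location B u w | u <- generation B n w].

Lemma pos_st n w : pos n w = unzip2 (st B n w).
Proof. by rewrite /unzip2 -map_comp. Qed.

Lemma unzip2_assemble ys ss : unzip2 (assemble ys ss) = posasm (unzip2 ys) ss.
Proof.
rewrite /assemble /posasm; elim: ys ss => [|y ys IH] [|s ss]//=.
have := IH ss; rewrite /unzip2 map_cat => ->; congr (_ ++ _).
rewrite -map_comp -[in RHS](mkseq_nth 0 s) /mkseq -map_comp.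
by [].
Qed.

Lemma discrete_pos n : discrete_rv (pos n).
Proof.
rewrite (_ : pos n = unzip2 \o st B n); last by apply/funext => w; rewrite pos_st.
exact: (discrete_comp (E := seq (label * site)) _ (@discrete_st _ _ _ _ _ B n)).
Qed.

Local Open Scope ereal_scope.

Lemma one_step_pos n (F : seq site -> \bar R) : (forall s, 0 <= F s) ->
  \int[P]_w F (pos n.+1 w) =
  \int[P]_w Ebroods Q (size (pos n w)) (fun ss => F (posasm (pos n w) ss)).
Proof.
move=> F0; rewrite (_ : (fun w => F (pos n.+1 w)) = fun w => (F \o unzip2) (st B n.+1 w)).
  rewrite one_step//; last by move=> s /=.
  congr integral; apply/funext => w; have -> : size (pos n w) = size (st B n w) by rewrite !size_map.
  by apply: eq_Ebroods => ss; rewrite /= unzip2_assemble pos_st.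
by apply/funext => w; rewrite pos_st.
Qed.

Lemma expect_lap n a : unit_valued a ->
  \int[P]_w (lap a (pos n w))%:E = (gen_iter Q n a 0%R)%:E.
Proof.
elim: n a => [|n IH] a ha.
  transitivity (\int[P]_(w in setT) (cst (a 0%R)%:E) w).
    by apply: eq_integral => w _; rewrite /lap /pos /= big_cons big_nil mulr1.
  by rewrite integral_cst// [X in _ * X]probability_setT mule1.
rewrite (one_step_pos n (F := fun s => (lap a s)%:E)); last first.
  by move=> s; rewrite lee_fin lap_ge0// => x; case/andP: (ha x).
under eq_integral do rewrite Ebroods_lap//.
by rewrite IH ?gen_iterSr//; exact: gen_step_unit.
Qed.

Fixpoint spine_weight psi a n : site -> R :=
  if n is m.+1 then fun z => (avg (spine_weight psi a m) z * dpgf Q (avg (gen_iter Q m a) z))%R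
  else psi.

(** [one_step_pos] peels off the last generation, while [spine_weight] unfolds at the root; this
    reconciles the two directions. *)
Lemma spine_weightSr psi a n :
  spine_weight psi a n.+1 = spine_weight (spine_step Q psi a) (gen_step Q a) n.
Proof.
elim: n => [//|n IH].
apply/funext => z; rewrite [in RHS]/= -IH -gen_iterSr.
by [].
Qed.

Lemma expect_sp n psi a : (forall x, 0 <= psi x)%R -> unit_valued a ->
  \int[P]_w (sp psi a (pos n w))%:E = (spine_weight psi a n 0%R)%:E.
Proof.
elim: n psi a => [|n IH] psi a p0 ha.
  transitivity (\int[P]_(w in setT) (cst (psi 0%R)%:E) w).
    by apply: eq_integral => w _; rewrite /= /lap big_nil mulr0 mulr1 addr0.
  by rewrite integral_cst// [X in _ * X]probability_setT mule1.
rewrite (one_step_pos n (F := fun s => (sp psi a s)%:E)); last first.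
  by move=> s; rewrite lee_fin sp_ge0// => x; case/andP: (ha x).
under eq_integral do rewrite Ebroods_sp//.
rewrite IH ?spine_weightSr//; last exact: gen_step_unit.
by move=> x; exact: spine_step_ge0.
Qed.

Lemma spine_weight_shift psi a n t z :
  spine_weight (fun z => psi (z + t)%R) (fun z => a (z + t)%R) n z = spine_weight psi a n (z + t).
Proof.
elim: n z => [//|n IH] z /=.
rewrite (eq_avg IH) avg_shift; congr (_ * dpgf _ _)%R.
by rewrite -avg_shift; apply: eq_avg => x; exact: gen_iter_shift.
Qed.

Lemma killedE a n : killed Q a n = spine_weight (delta R 0%R) a n.
Proof. by elim: n => [//|n IH] /=; rewrite IH. Qed.

(** Seen from the distinguished particle at y, the root is at -y. *)
Lemma expect_sp_delta n a y : unit_valued a ->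
  \int[P]_w (sp (delta R y) (fun z => a (z - y)%R) (pos n w))%:E = (killed Q a n (- y)%R)%:E.
Proof.
move=> ha; rewrite expect_sp//.
rewrite killedE -[(- y)%R in RHS]add0r -spine_weight_shift; congr EFin.
congr (spine_weight _ _ _ _); apply/funext => z.
by rewrite /delta subr_eq0.
Qed.

End expectations.

(** * Deterministic inequalities for finite configurations *)

Section lists.
Context (R : realType).
Notation site := 'rV[int]_2.
Implicit Types (a psi : site -> R) (s : seq site).

(** The sites accessible in n steps. The expected number of particles elsewhere is 0, so sums over
    positions can be taken over this finite list. *)
Fixpoint reach n : seq site :=
  if n is m.+1 then undup [seq y + d | y <- reach m, d <- steps] else [:: 0].

Lemma uniq_reach n : uniq (reach n).
Proof. by case: n => [//|n]; exact: undup_uniq. Qed.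

Lemma avgn_reach n (h : site -> R) : (forall z, z \in reach n -> h z = 0) -> avgn n h 0 = 0.
Proof.
elim: n h => [|n IH] h H; first by apply: H; rewrite inE.
rewrite avgnSr; apply: IH => z zn; rewrite /avg big_seq big1 ?mulr0// => d ds.
by apply: H; rewrite mem_undup; apply/allpairsP; exists (z, d).
Qed.

Definition crowd (bs s : seq site) (y : site) : nat := count (fun z => z - y \in bs) s.
Definition vacant (bs s : seq site) (y : site) : nat := count (fun x => y + x \notin s) bs.

Lemma sp1 psi a s : (forall z, z \in s -> a z = 1) -> sp psi a s = \sum_(z <- s) psi z.
Proof.
elim: s => [|x s IH] H /=; first by rewrite big_nil.
have Hs z : z \in s -> a z = 1 by move=> zs; apply: H; rewrite inE zs orbT.
rewrite big_cons IH// H ?mem_head// mul1r; congr (_ + _).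
by rewrite /lap big_seq big1 ?mulr1.
Qed.

Lemma sp_le psi a s : (forall z, 0 <= psi z) -> unit_valued a ->
  sp psi a s <= \sum_(z <- s) psi z.
Proof.
move=> p0 ha; elim: s => [|x s IH] /=; first by rewrite big_nil.
have a0 z : 0 <= a z by case/andP: (ha z).
rewrite big_cons lerD//; first by rewrite ler_piMr// lap_le1.
by apply: le_trans IH; rewrite ler_piMl ?sp_ge0//; case/andP: (ha x).
Qed.

(** Each particle at y gives the same product over the others, and the missing factor a y completes
    it to [lap a s]. *)
Lemma sp_delta_lap y a s : sp (delta R y) a s * a y = \sum_(z <- s) delta R y z * lap a s.
Proof.
rewrite -mulr_suml; elim: s => [|x s IH] /=; first by rewrite big_nil !mul0r.
rewrite big_cons [lap a (x :: s)]big_cons -/(lap a s) mulrDl -[X in _ + X]mulrA IH.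
by rewrite (_ : delta R y x = (x == y)%:R)//; case: eqP => [->|_] /=; ring.
Qed.

Lemma sum_indicator (p : pred site) s : \sum_(z <- s) (p z)%:R = (count p s)%:R :> R.
Proof. by elim: s => [|x s IH]; rewrite ?big_nil// big_cons IH /= natrD. Qed.

(** Particles are grouped by their position in Ys; the others are counted with full weight and
    vanish in expectation when Ys is [reach n]. *)
Lemma split_sum (f : site -> R) (Ys s : seq site) : (forall z, 0 <= f z <= 1) ->
  \sum_(z <- s) f z <= \sum_(y <- Ys) f y * \sum_(z <- s) delta R y z
     + \sum_(z <- s) (z \notin Ys)%:R.
Proof.
move=> f01.
have -> : \sum_(y <- Ys) f y * \sum_(z <- s) delta R y z =
   \sum_(z <- s) \sum_(y <- Ys) f y * delta R y z.
  by rewrite exchange_big/=; apply: eq_bigr => y _; rewrite mulr_sumr.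
rewrite -big_split/=; apply: ler_sum => z _; have /andP[f0 f1] := f01 z.
case/boolP: (z \in Ys) => zY /=; last first.
  rewrite -[leLHS]add0r lerD// sumr_ge0// => y _.
  by rewrite mulr_ge0 ?delta_ge0//; case/andP: (f01 y).
rewrite addr0 (big_rem z zY)/= /delta eqxx mulr1 lerDl sumr_ge0// => y _.
by rewrite mulr_ge0//; case/andP: (f01 y).
Qed.

(** If y + x is vacant, no particle z has z - y = x, so all factors are 1 and the spine functional
    counts the particles at y. *)
Lemma vacant_count_le (Ys s : seq site) (x : site) :
  (count (fun z => z + x \notin s) s)%:R <=
  \sum_(y <- Ys) sp (delta R y) (fun z => 1 - delta R x (z - y)) s
   + \sum_(z <- s) (z \notin Ys)%:R.
Proof.
rewrite -sum_indicator; apply: le_trans (split_sum Ys s _) _.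
  by move=> z; case: (_ \notin _); rewrite /= ?lexx ?ler01.
rewrite lerD2r; apply: ler_sum => y _.
have a0 z : 0 <= 1 - delta R x (z - y).
  by rewrite /delta; case: (_ == _); rewrite /= ?subr0 ?subrr.
case/boolP: (y + x \in s) => ys /=.
  by rewrite mul0r sp_ge0// => z; exact: delta_ge0.
rewrite mul1r sp1// => z zs; rewrite /delta; case: eqP => [h|_]; last by rewrite subr0.
by move: ys; rewrite -h addrC subrK zs.
Qed.

Lemma lap_ball (sg : R) bs s y :
  lap (fun z => 1 - sg * (z - y \in bs)%:R) s = (1 - sg) ^+ crowd bs s y.
Proof.
rewrite /crowd; elim: s => [|x s IH]; first by rewrite /lap big_nil.
rewrite /lap big_cons -/(lap _ s) IH /=.
by case: (_ \in bs); rewrite /= ?mulr1 ?mulr0 ?subr0 ?mul1r// exprS.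
Qed.

(** D counts the particles at a site, S is their spine functional and N the number of particles in
    the ball around it. Since (1 - sg)^N <= 1 / (1 + sg N) <= 1/2 and 1 - sg >= 3/4, one gets S <= 2
    D / 3, whence the factor 3. *)
Lemma spine_deficit (sg D S : R) (N : nat) : 0 <= sg <= 1 / 4 -> 0 <= D ->
  S * (1 - sg) = D * (1 - sg) ^+ N -> 1 <= sg * N%:R -> D <= 3 * (D - S).
Proof.
move=> /andP[sg0 sg1] D0 e h.
have q0 : 0 <= 1 - sg by lra.
have hN : (1 - sg) ^+ N <= 1 / 2.
  apply: (@le_trans _ _ (expR (- sg) ^+ N)).
    by apply: lerXn2r; rewrite ?nnegrE ?expR_ge0//; exact: expR_ge1Dx.
  rewrite -expRM_natl mulrN expRN mulrC div1r lef_pV2 ?posrE ?expR_gt0//.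
  by apply: le_trans (expR_ge1Dx _); lra.
have h2 : D * (1 - sg) ^+ N <= D * (1 / 2) by rewrite ler_wpM2l.
rewrite -e in h2.
have p0 : 0 <= S * (1 - sg) by rewrite e mulr_ge0// exprn_ge0.
have [S0|S0] := lerP 0 S; last by lra.
have : S * sg <= S * (1 / 4) by rewrite ler_wpM2l.
lra.
Qed.

(** With 0 in bs a particle belongs to its own crowd, so [lap] and [sp] at y differ by a factor 1 -
    sg and [spine_deficit] applies. *)
Lemma crowd_count_le (sg : R) (bs Ys s : seq site) : 0 <= sg <= 1 / 4 -> 0 \in bs ->
  (count (fun z => 1 <= sg * (crowd bs s z)%:R) s)%:R <=
  3 * \sum_(y <- Ys) (\sum_(z <- s) delta R y z -
      sp (delta R y) (fun z => 1 - sg * (z - y \in bs)%:R) s)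
   + \sum_(z <- s) (z \notin Ys)%:R.
Proof.
move=> /andP[sg0 sg1] bs0; rewrite -sum_indicator; apply: le_trans (split_sum Ys s _) _.
  by move=> z; rewrite ler0n lern1 leq_b1.
rewrite lerD2r mulr_sumr; apply: ler_sum => y _.
pose a z : R := 1 - sg * (z - y \in bs)%:R; rewrite -/a.
have ha : unit_valued a.
  by move=> z; rewrite /a; case: (_ \in _); rewrite /= ?mulr1 ?mulr0; lra.
have := @sp_le (delta R y) a s (fun=> delta_ge0 _ _ _) ha.
have := sp_delta_lap y a s; rewrite -mulr_suml lap_ball.
have -> : a y = 1 - sg by rewrite /a subrr bs0 mulr1.
have : 0 <= \sum_(z <- s) delta R y z by apply: sumr_ge0 => z _; exact: delta_ge0.
move: (\sum_(z <- s) _) (sp _ _ _) => D S D0 e SD.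
case: (lerP 1 (sg * _)) => [h|_] /=; last by rewrite mul0r mulr_ge0// subr_ge0.
by rewrite mul1r; apply: spine_deficit e h; rewrite ?sg0.
Qed.

End lists.

(** * Expected numbers of particles with a vacant neighbour or a crowded ball *)

Section bounds.
Context d (T : measurableType d) (R : realType) (P : probability T R).
Context (Q : nat -> R) (B : branching_random_walk P 2 Q).
Hypothesis (Q_dist : is_distribution Q) (Q_critical : dist_mean Q = 1%E).
Notation site := 'rV[int]_2.
Implicit Types (a psi : site -> R).
Notation pos := (pos B).

Lemma pos_measurable_fun n (F : seq site -> \bar R) :
  measurable_fun setT (fun w => F (pos n w)).
Proof.
exact: (discrete_measurable_fun (E := seq site) F measurableT (@discrete_pos _ _ _ _ _ B n)).
Qed.

(** For a = 1 there is no killing, because f'(1) = 1 by criticality; [expect_sum], the many-to-one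
    formula, follows. *)
Lemma spine_weight1 psi n : spine_weight Q psi (fun=> 1) n = avgn n psi.
Proof.
have g1 m : gen_iter Q m (fun=> 1) = fun=> 1.
  elim: m => [//|m IH]; rewrite /gen_iter iterS -/(gen_iter _ _ _) IH.
  by apply/funext => z; rewrite /gen_step avg_cst pgf1.
elim: n => [//|n IH]; apply/funext => z /=.
by rewrite IH g1 avg_cst dpgf1// mulr1.
Qed.

Local Open Scope ereal_scope.

Lemma expect_sum n psi : (forall z, 0 <= psi z)%R ->
  \int[P]_w (\sum_(z <- pos n w) psi z)%:E = (avgn n psi 0)%:E.
Proof.
move=> p0; rewrite -spine_weight1 -(expect_sp B)//.
  by apply: eq_integral => w _; rewrite sp1.
by move=> z; rewrite ler01 lexx.
Qed.

Lemma expect_outside n : \int[P]_w (\sum_(z <- pos n w) (z \notin reach n)%:R)%:E = 0.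
Proof.
rewrite (@expect_sum n (fun z => (z \notin reach n)%:R))//.
by rewrite avgn_reach// => z ->.
Qed.

Lemma expect_vacant n x (M : R) : massle (killed Q (fun z => 1 - delta R x z)%R n) M ->
  \int[P]_w (count (fun z => (z + x)%R \notin pos n w) (pos n w))%:R%:E <= M%:E.
Proof.
pose a z : R := (1 - delta R x z)%R; rewrite -/a => HM.
have ha : unit_valued a.
  by move=> z; rewrite /a /delta; case: (_ == _); rewrite /= ?subr0 ?subrr ?lexx ?ler01.
have a0 z : (0 <= a z)%R by case/andP: (ha z).
pose F y s := sp (delta R y) (fun z => a (z - y)%R) s.
have F0 y s : (0 <= F y s)%R by apply: sp_ge0 => z; [exact: delta_ge0|exact: a0].
pose out s : R := (\sum_(z <- s) (z \notin reach n)%:R)%R.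
have out0 s : (0 <= out s)%R by apply: sumr_ge0.
apply: (@le_trans _ _ (\int[P]_w (\sum_(y <- reach n) (F y (pos n w))%:E + (out (pos n w))%:E))).
  apply: ge0_le_integral => //.
  - exact: (@pos_measurable_fun n (fun s => (count (fun z => (z + x)%R \notin s) s)%:R%:E)).
  - exact: (@pos_measurable_fun n (fun s => \sum_(y <- reach n) (F y s)%:E + (out s)%:E)).
  - move=> w _; rewrite sumEFin -EFinD lee_fin; exact: vacant_count_le.
rewrite ge0_integralD//; last 4 first.
- by move=> w _; apply: sume_ge0 => y _; rewrite lee_fin.
- exact: (@pos_measurable_fun n (fun s => \sum_(y <- reach n) (F y s)%:E)).
- by move=> w _; rewrite lee_fin.
- exact: (@pos_measurable_fun n (fun s => (out s)%:E)).
rewrite expect_outside adde0 ge0_integral_sum//; last 2 first.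
- by move=> y; exact: (@pos_measurable_fun n (fun s => (F y s)%:E)).
- by move=> y w _; rewrite lee_fin.
rewrite (eq_bigr (fun y => (killed Q a n (- y)%R)%:E)); last first.
  by move=> y _; rewrite expect_sp_delta.
rewrite sumEFin lee_fin -(big_map -%R xpredT (killed Q a n)).
by apply: HM; rewrite map_inj_uniq ?uniq_reach//; exact: oppr_inj.
Qed.

Lemma expect_crowd n (sg : R) (bs : seq site) (M : R) : (0 <= sg <= 1 / 4)%R -> 0%R \in bs ->
  massle (fun z => heat R n z - killed Q (fun z => 1 - sg * (z \in bs)%:R) n z)%R M ->
  \int[P]_w (count (fun z => 1 <= sg * (crowd bs (pos n w) z)%:R)%R (pos n w))%:R%:E <= (3 * M)%:E.
Proof.
move=> sg01 bs0; pose a z : R := (1 - sg * (z \in bs)%:R)%R; rewrite -/a => HM.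
have ha : unit_valued a.
  by move=> z; rewrite /a; case: (_ \in _); rewrite /= ?mulr1 ?mulr0; lra.
have a0 z : (0 <= a z)%R by case/andP: (ha z).
pose F y s := sp (delta R y) (fun z => a (z - y)%R) s.
have F0 y s : (0 <= F y s)%R by apply: sp_ge0 => z; [exact: delta_ge0|exact: a0].
pose G y s : R := (\sum_(z <- s) delta R y z - F y s)%R.
have G0 y s : (0 <= G y s)%R by rewrite subr_ge0 sp_le.
pose out s : R := (\sum_(z <- s) (z \notin reach n)%:R)%R.
have out0 s : (0 <= out s)%R by apply: sumr_ge0.
have EG y : \int[P]_w (G y (pos n w))%:E = (heat R n (- y)%R - killed Q a n (- y)%R)%:E.
  have : \int[P]_w (G y (pos n w))%:E + \int[P]_w (F y (pos n w))%:E = (heat R n (- y)%R)%:E.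
    rewrite -ge0_integralD//; last 4 first.
    - by move=> w _; rewrite lee_fin.
    - exact: (@pos_measurable_fun n (fun s => (G y s)%:E)).
    - by move=> w _; rewrite lee_fin.
    - exact: (@pos_measurable_fun n (fun s => (F y s)%:E)).
    transitivity (\int[P]_w (\sum_(z <- pos n w) delta R y z)%:E).
      by apply: eq_integral => w _; rewrite -EFinD /G subrK.
    rewrite expect_sum; last by move=> z; exact: delta_ge0.
    by rewrite avgn_delta sub0r.
  rewrite expect_sp_delta// EFinB => <-.
  by rewrite addeK.
apply: (@le_trans _ _ (\int[P]_w (3%:E * \sum_(y <- reach n) (G y (pos n w))%:E + (out (pos n w))%:E))).
  apply: ge0_le_integral => //.
  - exact: (@pos_measurable_fun n (fun s => (count (fun z => 1 <= sg * (crowd bs s z)%:R)%R s)%:R%:E)).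
  - exact: (@pos_measurable_fun n (fun s => 3%:E * \sum_(y <- reach n) (G y s)%:E + (out s)%:E)).
  - move=> w _; rewrite sumEFin -EFinM -EFinD lee_fin; exact: crowd_count_le.
have mS : measurable_fun setT (fun w => \sum_(y <- reach n) (G y (pos n w))%:E).
  exact: (@pos_measurable_fun n (fun s => \sum_(y <- reach n) (G y s)%:E)).
rewrite ge0_integralD//; last 4 first.
- by move=> w _; rewrite mule_ge0 ?sume_ge0// => y _; rewrite lee_fin.
- exact: measurable_funeM.
- by move=> w _; rewrite lee_fin.
- exact: (@pos_measurable_fun n (fun s => (out s)%:E)).
rewrite expect_outside adde0 ge0_integralZl//; last first.
  by move=> w _; apply: sume_ge0 => y _; rewrite lee_fin.
rewrite ge0_integral_sum//; last 2 first.
- by move=> y; exact: (@pos_measurable_fun n (fun s => (G y s)%:E)).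
- by move=> y w _; rewrite lee_fin.
rewrite (eq_bigr (fun y => (heat R n (- y) - killed Q a n (- y))%R%:E)); last by [].
rewrite sumEFin -EFinM lee_fin ler_wpM2l//.
rewrite -(big_map -%R xpredT (fun z => heat R n z - killed Q a n z)%R).
by apply: HM; rewrite map_inj_uniq ?uniq_reach//; exact: oppr_inj.
Qed.

End bounds.

Lemma countable_enum (E : countType) : exists (code : E -> nat) (inv : nat -> option E),
  (forall v, inv (code v) = Some v) /\ (forall k v, inv k = Some v -> code v = k).
Proof.
exists choice.pickle, (@choice.pickle_inv E); split; first exact: choice.pickleK_inv.
by move=> k v h; have := @choice.pickle_invK E k; rewrite h.
Qed.

(** * From the typical particle to expected numbers of particles *)

Section typical.
Context d (T : measurableType d) (R : realType) (P : probability T R).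
Context (Q : nat -> R) (B : branching_random_walk P 2 Q).
Hypotheses (Q_dist : is_distribution Q) (Q_critical : dist_mean Q = 1%E).
Hypothesis (Q_var_pos : (0 < dist_variance Q)%E).
Hypothesis (Q_var_fin : (dist_variance Q < +oo)%E).
Notation site := 'rV[int]_2.
Notation pos := (pos B).
Notation st := (st B).

Lemma mem_st n u x w : ((u, x) \in st n w) = (u \in generation B n w) && (location B u w == x).
Proof.
apply/mapP/andP => [[v vg [-> ->]]|[ug /eqP <-]]; first by [].
by exists u.
Qed.

Lemma uniq_st n w : uniq (st n w).
Proof. by rewrite map_inj_uniq ?uniq_generation// => u v []. Qed.

(** [evolution] records which particles exist and where, not their order in the list, hence the
    invariance under permutation. The event is a countable union, over duplicate-free lists, of the
    events that the state has the same entries. *)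
Lemma evolution_st n (K : pred (seq (label * site))) :
  (forall s t, perm_eq s t -> K s = K t) -> evolution B n [set w | K (st n w)].
Proof.
move=> HK; rewrite /evolution; set G := [set E | _].
pose E := g_sigma_algebraType G.
suff : @measurable _ E [set w | K (st n w)] by [].
have mem p : @measurable _ E [set w | p \in st n w].
  case: p => u x; have [un|un] := eqVneq (size u) n; last first.
    rewrite (_ : [set _ | _] = set0); first exact: measurable0.
    apply/seteqP; split => // w /=; rewrite mem_st => /andP[/size_generation un' _].
    by rewrite un' eqxx in un.
  apply: sub_sigma_algebra; exists u, x; split; first by rewrite un.
  apply/seteqP; split => w /=; rewrite mem_st un.
    by move=> /andP[? /eqP].
  by move=> [-> ->]; rewrite eqxx.
have eqs (s : seq (label * site)) : @measurable _ E [set w | forall p, (p \in st n w) = (p \in s)].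
  rewrite (_ : [set _ | _] = \bigcap_(p : label * site) [set w | (p \in st n w) = (p \in s)]); last first.
    by apply/seteqP; split => w /= h p; [move=> _|]; exact: h.
  rewrite -[X in measurable X]setCK; apply: measurableC.
  rewrite setC_bigcap; apply: countable_bigcupT_measurable; first exact: countableP.
  move=> p; apply: measurableC; case: (p \in s); first exact: mem.
  rewrite (_ : [set _ | _] = ~` [set w | p \in st n w]); first by apply: measurableC; exact: mem.
  by apply/seteqP; split => w /= /negP; case: (_ \in _).
rewrite (_ : [set w | K (st n w)] = \bigcup_(s : seq (label * site))
   (if K s && uniq s then [set w | forall p, (p \in st n w) = (p \in s)] else set0)).
  apply: countable_bigcupT_measurable; first exact: countableP.
  by move=> s; case: ifP => // _; exact: eqs.
apply/seteqP; split => w /=.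
  by move=> Kw; exists (st n w) => //; rewrite Kw uniq_st.
move=> [s _]; case: ifP => // /andP[Ks us] /= h.
by rewrite (HK _ s)//; apply: uniq_perm => //; exact: uniq_st.
Qed.

Lemma survivesE n : survives B n = [set w | generation B n w != [::]].
Proof. by apply/seteqP; split => w /= /eqP. Qed.

Lemma discrete_generation n : discrete_rv (generation B n).
Proof.
rewrite (_ : generation B n = unzip1 \o st n); last by apply/funext => w; rewrite /= st_labels.
exact: (discrete_comp (E := seq (label * site)) _ (@discrete_st _ _ _ _ _ B n)).
Qed.

Lemma measurable_survives n : measurable (survives B n).
Proof.
rewrite survivesE.
exact: (discrete_preimage (E := seq label) [set s | s != [::]] (@discrete_generation n)).
Qed.

Lemma discrete_location u : discrete_rv (location B u).
Proof.
elim: u => [|i u IH]; first by move=> x; exact: (@discrete_cst _ T site 0 x).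
exact: (discrete_pair (E1 := site) (E2 := site) (E' := site) +%R IH (@displacement_rv _ _ _ _ _ _ B u i)).
Qed.

Section bad_event.
Variables (n : nat) (tau : T -> label).
Hypothesis tau_typical : typical_particle B n tau.
Variable bad : seq site -> site -> bool.
Hypothesis bad_perm : forall s t y, perm_eq s t -> bad s y = bad t y.

Let D := survives B n `&` [set w | bad (pos n w) (location B (tau w) w)].

Let DE v := survives B n `&` tau @^-1` [set v] `&` [set w | bad (pos n w) (location B v w)].

Let measurable_DE v : measurable (DE v).
Proof.
apply: measurableI; first exact: (tau_typical.1 v).
have h := discrete_pair (E1 := seq site) (E2 := site) (E' := bool) bad
  (@discrete_pos _ _ _ _ _ B n) (@discrete_location v).
exact: (discrete_preimage (E := bool) [set b | b] h).
Qed.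

Let DE_D : D = \bigcup_(v : label) DE v.
Proof.
apply/seteqP; split => w; first by move=> [sw bw]; exists (tau w).
by move=> [v _ [[sw /= tv] bw]]; split => //=; rewrite tv.
Qed.

Lemma measurable_bad_event : measurable D.
Proof.
rewrite DE_D; apply: countable_bigcupT_measurable; first exact: countableP.
exact: measurable_DE.
Qed.

Local Open Scope ereal_scope.

Let share w : R := ((count (bad (pos n w)) (pos n w))%:R / (size (pos n w))%:R)%R.

Let ind v w : R :=
  (((v \in generation B n w) && bad (pos n w) (location B v w))%:R / (size (generation B n w))%:R)%R.

Let ind_ge0 v w : (0 <= ind v w)%R.
Proof. by rewrite divr_ge0. Qed.

Let measurable_ind v : measurable_fun setT (fun w => (ind v w)%:E).
Proof.
have h1 := discrete_pair (E1 := seq site) (E2 := site) (E' := bool) bad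
  (@discrete_pos _ _ _ _ _ B n) (@discrete_location v).
have h2 := discrete_pair (E1 := bool) (E2 := seq label) (E' := (bool * seq label)%type) pair h1
  (@discrete_generation n).
exact: (discrete_measurable_fun (E := (bool * seq label)%type)
  (fun p => (((v \in p.2) && p.1)%:R / (size p.2)%:R)%:E) measurableT h2).
Qed.

(** The generators of [evolution] read the location of v only where v is born, so the event is
    split: v unborn, where tau = v has probability 0, and v born at a bad place, which is an event
    of [evolution] to which the uniform law applies. *)
Let DE_le v : P (DE v) <= \int[P]_(w in survives B n) (ind v w)%:E.
Proof.
have mS := measurable_survives n.
pose K1 (s : seq (label * site)) := v \notin unzip1 s.
pose K2 (s : seq (label * site)) := has (fun p => (p.1 == v) && bad (unzip2 s) p.2) s.
have K1p s t : perm_eq s t -> K1 s = K1 t.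
  by move=> /(perm_map fst)/perm_mem st; rewrite /K1 /unzip1 st.
have K2p s t : perm_eq s t -> K2 s = K2 t.
  move=> pst; rewrite /K2 (perm_has _ pst); apply: eq_has => p.
  by rewrite (bad_perm _ (perm_map snd pst)).
have E1 := evolution_st (n := n) K1p; have E2 := evolution_st (n := n) K2p.
have [mtau Htau] := tau_typical.
have H1 := Htau v _ E1; have H2 := Htau v _ E2.
have K2E w : K2 (st n w) = (v \in generation B n w) && bad (pos n w) (location B v w).
  rewrite /K2 has_map -/(unzip2 _) -pos_st; apply/hasP/andP.
    by move=> [u ug /= /andP[/eqP <- bu]].
  by move=> [vg bv]; exists v => //=; rewrite eqxx.
have K1E w : K1 (st n w) = (v \notin generation B n w) by rewrite /K1 st_labels.
set A1 := [set w | K1 (st n w)] in E1 H1; set A2 := [set w | K2 (st n w)] in E2 H2.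
have mA1 : measurable A1.
  exact: (discrete_preimage (E := seq (label * site)) [set s | K1 s] (@discrete_st _ _ _ _ _ B n)).
have mA2 : measurable A2.
  exact: (discrete_preimage (E := seq (label * site)) [set s | K2 s] (@discrete_st _ _ _ _ _ B n)).
have P1 : P (A1 `&` survives B n `&` tau @^-1` [set v]) = 0.
  rewrite H1; apply: integral0_eq => w [/= ]; rewrite /A1 /= K1E => /negbTE -> _.
  by rewrite mul0r.
have P2 : P (A2 `&` survives B n `&` tau @^-1` [set v]) <= \int[P]_(w in survives B n) (ind v w)%:E.
  rewrite H2.
  rewrite (eq_integral (fun w => (ind v w)%:E)); last first.
    move=> w; rewrite inE => -[]; rewrite /A2 /= K2E => /andP[h1 h2] _.
    by rewrite /ind h1 h2.
  apply: ge0_subset_integral => //; [exact: measurableI|exact: measurable_funTS|].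
  by move=> w _; rewrite lee_fin; exact: ind_ge0.
have m1 : measurable (A1 `&` survives B n `&` tau @^-1` [set v]).
  by rewrite -setIA; apply: measurableI.
have m2 : measurable (A2 `&` survives B n `&` tau @^-1` [set v]).
  by rewrite -setIA; apply: measurableI.
apply: le_trans P2; rewrite -[leRHS]add0e -P1.
apply: le_trans (measureU2 _ m1 m2).
apply: le_measure; rewrite ?inE//; first exact: measurableU.
move=> w [[sw tw] bw].
case/boolP: (v \in generation B n w) => vg; [right|left]; split=> //; split=> //=.
  by rewrite /A2 /= K2E vg.
by rewrite /A1 /= K1E.
Qed.

Let sum_ind (code : label -> nat) (inv : nat -> option label) (N : nat) w :
  (forall v, inv (code v) = Some v) -> (forall k v, inv k = Some v -> code v = k) ->
  (\sum_(0 <= k < N) oapp (ind^~ w) 0 (inv k) <= share w)%R.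
Proof.
move=> inv1 inv2.
have sz : size (pos n w) = size (generation B n w) by rewrite size_map.
pose S := [seq code v | v <- generation B n w & bad (pos n w) (location B v w)].
have -> : share w = ((size S)%:R / (size (generation B n w))%:R)%R.
  rewrite /share sz; congr (_%:R / _)%R.
  rewrite size_map size_filter.
  by have -> : pos n w = [seq location B u w | u <- generation B n w] by []; rewrite count_map.
apply: (@le_trans _ _ (\sum_(0 <= k < N) (k \in S)%:R / (size (generation B n w))%:R)%R).
  apply: ler_sum => k _; case ek: (inv k) => [v|] /=; last by rewrite divr_ge0.
  rewrite /ind ler_wpM2r ?invr_ge0// ler_nat; case: andP => // -[vg bv] /=.
  by rewrite lt0b -(inv2 _ _ ek); apply: map_f; rewrite mem_filter bv.
rewrite -mulr_suml ler_wpM2r ?invr_ge0// -natr_sum ler_nat.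
rewrite -sum1_size big_mkord /= -(big_mkord xpredT (fun k => (k \in S) : nat)).
rewrite -big_mkcond /= sum1_count -size_filter sum1_size.
apply: uniq_leq_size; first by rewrite filter_uniq// iota_uniq.
by move=> k; rewrite mem_filter => /andP[].
Qed.

Lemma bad_event_le : P D <= \int[P]_(w in survives B n) (share w)%:E.
Proof.
have mS := measurable_survives n.
have [code [inv [inv1 inv2]]] := countable_enum label.
pose F k := oapp DE set0 (inv k).
have mF k : measurable (F k).
  by rewrite /F; case: (inv k) => [v|] /=; [exact: (measurable_DE v)|exact: measurable0].
have -> : D = \bigcup_k F k.
  rewrite DE_D; apply/seteqP; split => w.
    by move=> [v _ h]; exists (code v) => //; rewrite /F inv1.
  move=> [k _]; rewrite /F; case: (inv k) => [v h|//].
  by exists v.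
have mshare : measurable_fun setT (fun w => (share w)%:E).
  exact: (pos_measurable_fun B n (fun s => ((count (bad s) s)%:R / (size s)%:R)%:E)).
pose g k w : R := oapp (ind^~ w) 0%R (inv k).
have g0 k w : (0 <= g k w)%R by rewrite /g; case: (inv k) => [v|] //=; exact: ind_ge0.
have mg k : measurable_fun (survives B n) (fun w => (g k w)%:E).
  apply: measurable_funTS; rewrite /g; case: (inv k) => [v|] /=; first exact: measurable_ind.
  exact: measurable_cst.
rewrite measure_bigcup//; last first.
  move=> i j _ _ [w []]; rewrite /F.
  case ei: (inv i) => [v|//]; case ej: (inv j) => [v'|//].
  by move=> [[_ /= e] _] [[_ /= e'] _]; rewrite -(inv2 _ _ ei) -(inv2 _ _ ej) -e -e'.
rewrite (eq_eseriesl (Q := xpredT)); last by move=> k; rewrite in_setT.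
apply: lime_le; first exact: is_cvg_nneseries.
apply: nearW => N.
apply: (@le_trans _ _ (\sum_(0 <= k < N) \int[P]_(w in survives B n) (g k w)%:E)).
  apply: lee_sum => k _; rewrite /F /g; case: (inv k) => [v|]; last by rewrite measure0 integral0.
  exact: DE_le.
rewrite -ge0_integral_sum//; last by move=> k w _; rewrite lee_fin.
apply: ge0_le_integral => //.
- by move=> w _; apply: sume_ge0 => k _; rewrite lee_fin.
- exact: emeasurable_sum.
- exact: measurable_funTS.
- by move=> w _; rewrite sumEFin lee_fin; exact: (sum_ind N w inv1 inv2).
Qed.

(** The share of bad particles is at most 1, and at most their number over m once the generation has
    m particles. *)
Lemma typical_bound (m : R) : (0 < m)%R ->
  P D <= P (survives B n `&` [set w | ((size (generation B n w))%:R < m)%R]) +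
    (m^-1)%:E * \int[P]_w (count (bad (pos n w)) (pos n w))%:R%:E.
Proof.
move=> m0; have mS := measurable_survives n.
set A := [set w | _].
have mA : measurable A.
  exact: (discrete_preimage (E := seq label) [set s | ((size s)%:R < m)%R] (@discrete_generation n)).
apply: (le_trans bad_event_le).
pose cnt s : R := (count (bad s) s)%:R.
have cnt0 s : (0 <= cnt s)%R by [].
have mc : measurable_fun setT (fun w => (cnt (pos n w))%:E).
  exact: (pos_measurable_fun B n (fun s => (cnt s)%:E)).
have mi : measurable_fun setT (fun w => (\1_A w : R)%:E).
  by apply/measurable_EFinP; exact: measurable_indic.
apply: (@le_trans _ _ (\int[P]_(w in survives B n) ((\1_A w : R)%:E + (m^-1)%:E * (cnt (pos n w))%:E))).
  apply: ge0_le_integral => //.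
  - by move=> w _; rewrite lee_fin divr_ge0.
  - apply: measurable_funTS.
    exact: (pos_measurable_fun B n (fun s => ((count (bad s) s)%:R / (size s)%:R)%:E)).
  - apply: measurable_funTS; apply: emeasurable_funD => //; exact: measurable_funeM.
  - move=> w sw; rewrite -EFinM -EFinD lee_fin /share.
    have sz : size (pos n w) = size (generation B n w) by rewrite size_map.
    have s0 : (0 < (size (pos n w))%:R :> R)%R.
      rewrite sz ltr0n lt0n size_eq0; by move/eqP: sw.
    have c1 : (cnt (pos n w) <= (size (pos n w))%:R)%R by rewrite ler_nat count_size.
    rewrite indicE; have [Aw|Aw] := boolP (w \in A).
      apply: (@le_trans _ _ 1%R); first by rewrite ler_pdivrMr// mul1r.
      by rewrite lerDl mulr_ge0// invr_ge0 ltW.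
    rewrite add0r mulrC ler_wpM2r// lef_pV2 ?posrE// leNgt sz.
    by apply/negP => h; move/negP: Aw; apply; rewrite inE.
have m1 : (0 <= m^-1)%R by rewrite invr_ge0 ltW.
have g1 w : survives B n w -> 0 <= (\1_A w : R)%:E by move=> _; rewrite lee_fin.
have g2 w : survives B n w -> 0 <= (m^-1)%:E * (cnt (pos n w))%:E.
  by move=> _; rewrite mule_ge0 ?lee_fin.
have g3 : measurable_fun (survives B n) (fun w => (\1_A w : R)%:E) by exact: measurable_funTS.
have g4 : measurable_fun (survives B n) (fun w => (m^-1)%:E * (cnt (pos n w))%:E).
  by apply: measurable_funTS; exact: measurable_funeM.
have g5 : measurable_fun (survives B n) (fun w => (cnt (pos n w))%:E) by exact: measurable_funTS.
have g6 w : survives B n w -> 0 <= (cnt (pos n w))%:E by rewrite lee_fin.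
rewrite ge0_integralD//.
apply: leeD; first by rewrite integral_indic// setIC.
rewrite ge0_integralZl//.
apply: lee_wpmul2l; first by rewrite lee_fin.
by apply: ge0_subset_integral => // w _; rewrite lee_fin.
Qed.

End bad_event.

Notation surv := (surv Q).

Lemma iter_cst n (s : R) z : gen_iter Q n (fun=> s) z = iter n (pgf Q) s.
Proof.
by elim: n z => [//|n IH] z; rewrite /gen_iter !iterS -/(gen_iter _ _ _) /gen_step (eq_avg IH) avg_cst.
Qed.

Lemma lap_cst (s : R) (l : seq site) : lap (fun=> s) l = s ^+ size l.
Proof. by rewrite /lap big_const_seq count_predT iter_mulr_1. Qed.

Local Open Scope ereal_scope.

Lemma expect_power n (s : R) : (0 <= s <= 1)%R ->
  \int[P]_w (s ^+ size (generation B n w))%:E = (iter n (pgf Q) s)%:E.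
Proof.
move=> s01; rewrite -(iter_cst n s 0%R) -(expect_lap B)//.
by apply: eq_integral => w _; rewrite lap_cst size_map.
Qed.

Lemma size_measurable_fun n (F : nat -> \bar R) :
  measurable_fun setT (fun w => F (size (generation B n w))).
Proof.
exact: (discrete_measurable_fun (E := seq label) (F \o size) measurableT (@discrete_generation n)).
Qed.

Lemma prob_survives n : P (survives B n) = (surv n)%:E.
Proof.
have mS := measurable_survives n.
have h : P (~` survives B n) = (iter n (pgf Q) 0%R)%:E.
  rewrite -expect_power ?lexx ?ler01//.
  have -> : P (~` survives B n) = \int[P]_w (\1_(~` survives B n) w : R)%:E.
    by rewrite integral_indic ?setIT//; exact: measurableC.
  apply: eq_integral => w _; congr (_%:E); rewrite indicE survivesE.
  case: (generation B n w =P [::]) => [e|/eqP ne].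
    by rewrite e expr0 mem_set//= e.
  rewrite memNset/=; last by apply; exact: ne.
  by rewrite expr0n size_eq0 (negbTE ne).
have := probability_setC P mS; rewrite h => e.
have pf : P (survives B n) \is a fin_num by exact: fin_num_measure.
by move: e; rewrite -(fineK pf) -EFinB => -[e]; congr EFin; rewrite /surv e; lra.
Qed.

(** A generation of fewer than m particles dies out within k generations with probability at least 1
    - m * surv k >= 1/2, while [surv_decr] bounds the probability of dying out in that window. *)
Lemma small_population n k (m : R) : (surv k * m <= 1 / 2)%R ->
  P (survives B n `&` [set w | ((size (generation B n w))%:R < m)%R]) <=
  (2 * (k%:R * s2 Q * surv n ^+ 2))%:E.
Proof.
move=> hk; set A := [set w | _]; have mS := measurable_survives n.
have mA : measurable A.
  exact: (discrete_preimage (E := seq label) [set s | ((size s)%:R < m)%R] (@discrete_generation n)).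
have mSA : measurable (survives B n `&` A) by exact: measurableI.
have q01 := surv01 Q_dist k.
have q1 : (0 <= 1 - surv k <= 1)%R by lra.
have pf : P (survives B n `&` A) \is a fin_num by exact: fin_num_measure.
(* As 0^0 = 1, the power of 0 is the indicator of extinction by generation n; the right side
   integrates to the probability of extinction by generation n + k. *)
have : (2^-1)%:E * P (survives B n `&` A) + \int[P]_w (0 ^+ size (generation B n w))%:E <=
    \int[P]_w ((1 - surv k) ^+ size (generation B n w))%:E.
  have -> : P (survives B n `&` A) = \int[P]_w (\1_(survives B n `&` A) w : R)%:E.
    by rewrite integral_indic ?setIT.
  have g1 : measurable_fun setT (fun w => (\1_(survives B n `&` A) w : R)%:E).
    by apply/measurable_EFinP; exact: measurable_indic.
  have g2 w : setT w -> 0 <= (\1_(survives B n `&` A) w : R)%:E by rewrite lee_fin.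
  have c2 : (0 <= 2^-1 :> R)%R by rewrite invr_ge0.
  have g3 : measurable_fun setT (fun w => (2^-1)%:E * (\1_(survives B n `&` A) w : R)%:E).
    exact: measurable_funeM.
  have g4 w : setT w -> 0 <= (2^-1)%:E * (\1_(survives B n `&` A) w : R)%:E.
    by move=> _; rewrite mule_ge0 ?lee_fin.
  have g5 : measurable_fun setT (fun w => (0 ^+ size (generation B n w) : R)%:E).
    exact: (@size_measurable_fun n (fun k => (0 ^+ k)%:E)).
  have g6 w : setT w -> 0 <= (0 ^+ size (generation B n w) : R)%:E.
    by move=> _; rewrite lee_fin exprn_ge0.
  rewrite -ge0_integralZl// -ge0_integralD//.
  apply: ge0_le_integral => //.
  - by move=> w _; rewrite adde_ge0.
  - exact: emeasurable_funD.
  - exact: (@size_measurable_fun n (fun j => ((1 - surv k) ^+ j)%:E)).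
  move=> w _; rewrite -EFinM -EFinD lee_fin indicE.
  have e0 : (0 <= (1 - surv k) ^+ size (generation B n w))%R by apply: exprn_ge0; lra.
  case: (generation B n w =P [::]) => [e|/eqP ne].
    rewrite memNset/=; last by move=> [h _]; exact: h.
    by rewrite e /= !expr0 mulr0 add0r.
  rewrite [X in (_ + X)%R]expr0n size_eq0 (negbTE ne) addr0.
  have [|_] := boolP (w \in _); last by rewrite mulr0.
  rewrite inE => -[_ /= wA]; rewrite mulr1.
  have := expr_1B_lb (size (generation B n w)) q01.
  apply: le_trans.
  have : ((size (generation B n w))%:R * surv k <= m * surv k)%R.
    by rewrite ler_wpM2r//; [case/andP: q01|exact: ltW].
  lra.
rewrite !expect_power ?lexx ?ler01// -(fineK pf) -EFinM -EFinD !lee_fin.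
have -> : iter n (pgf Q) (1 - surv k)%R = (1 - surv (n + k))%R.
  by rewrite /surv !subKr iterD.
have := surv_decr Q_dist Q_critical Q_var_pos Q_var_fin n k.
rewrite /surv; lra.
Qed.

End typical.

(** * Harmonic numbers and the product of survival rates *)

Section harmonic.
Context (R : realType).

Lemma ln_le_harm n : ln (n%:R + 1) <= harm R n.
Proof.
elim: n => [|n IH] /=; first by rewrite add0r ln1.
have n0 : 0 < n%:R + 1 :> R by rewrite ltr_wpDl.
rewrite -natr1 (_ : n%:R + 1 + 1 = (n%:R + 1) * (1 + (n%:R + 1)^-1)); last first.
  by rewrite mulrDr mulr1 divff// gt_eqF.
have v0 : 0 < (n%:R + 1 : R)^-1 by rewrite invr_gt0.
have v1 : 0 < 1 + (n%:R + 1 : R)^-1 by lra.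
have h : ln (1 + (n%:R + 1 : R)^-1) <= (n%:R + 1 : R)^-1 by apply: le_ln1Dx; lra.
by rewrite lnM ?posrE// lerD.
Qed.

Lemma harmS_le_ln n : harm R n.+1 <= 2 + ln (n%:R + 1).
Proof.
elim: n => [|n IH].
  by rewrite /= add0r ln1 invr1; lra.
rewrite -[harm R n.+2]/(harm R n.+1 + (n.+2)%:R^-1).
apply: (le_trans (lerD IH (lexx _))).
rewrite -addrA lerD2l -lerBrDl -!natr1.
have n0 : 0 < n%:R + 1 :> R by rewrite ltr_wpDl.
have n1 : 0 < n%:R + 1 + 1 :> R by lra.
rewrite -ln_div ?posrE// -[X in ln X]invrK lnV ?posrE ?invr_gt0 ?divr_gt0//.
rewrite invf_div.
have -> : (n%:R + 1) / (n%:R + 1 + 1) = 1 + - (n%:R + 1 + 1)^-1 :> R.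
  by field; rewrite gt_eqF.
rewrite lerNr; apply: le_ln1Dx; rewrite ltrN2 invf_lt1//.
by have : 0 <= n%:R :> R by []; lra.
Qed.

Lemma harm_le_ln n : harm R n <= 2 + ln (n%:R + 1).
Proof. by apply: le_trans (harmS_le_ln n); rewrite /= lerDl. Qed.

Lemma harmE n : harm R n = 1 + \sum_(m < n) (m%:R + 1)^-1.
Proof.
elim: n => [|n IH]; first by rewrite big_ord0 addr0.
by rewrite big_ord_recr /= IH addrA natr1.
Qed.

(** Put t = 1 / ((m + 1) harm m). Then harm (m + 1) = harm m (1 + t) and 1 - g t <= exp (- g t) <=
    (1 + t)^(-g), so the product telescopes to (harm a / harm n)^g. *)
Lemma prod_harm_ub (g : R) (be : nat -> R) (a n : nat) : (a <= n)%N -> 0 <= g ->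
  (forall m, 0 <= be m <= 1) ->
  (forall m, (a <= m < n)%N -> g / (m.+1%:R * harm R m) <= be m) ->
  \prod_(m < n) (1 - be m) <= expR (g * (ln (harm R a) - ln (harm R n))).
Proof.
move=> an g0 be01; have hpos m : 0 < harm R m.
  by have := harm_ge1 R m; lra.
rewrite -(subnKC an); elim: (n - a)%N => [|k IH] H.
  rewrite addn0 subrr mulr0 expR0; apply: prodr_ile1 => i _.
  by have := be01 i; lra.
rewrite addnS big_ord_recr /=.
have h1 := IH (fun m hm => H m ltac:(lia)).
have {}H := H (a + k)%N ltac:(lia).
set m := (a + k)%N in H h1 *.
have be1 : 0 <= 1 - be m by have := be01 m; lra.
apply: (le_trans (ler_wpM2r be1 h1)).
have hS : harm R m.+1 = harm R m * (1 + (m.+1%:R * harm R m)^-1).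
  rewrite mulrDr mulr1 /=; congr (_ + _).
  by rewrite invfM mulrCA divff ?mulr1// gt_eqF.
set t := (m.+1%:R * harm R m)^-1 in hS H.
have t0 : 0 < t by rewrite invr_gt0 mulr_gt0.
have -> : ln (harm R a) - ln (harm R m.+1) =
   ln (harm R a) - ln (harm R m) - ln (1 + t).
  have t1 : 0 < 1 + t by lra.
  rewrite hS lnM ?posrE//.
  by rewrite opprD addrA.
rewrite (mulrBr g (_ - _)) expRD ler_wpM2l ?expR_ge0//.
have lt1 : ln (1 + t) <= t by apply: le_ln1Dx; lra.
apply: (@le_trans _ _ (expR (- (g * t)))); last first.
  by rewrite ler_expR lerN2 ler_wpM2l.
by apply: le_trans (expR_ge1Dx _); lra.
Qed.

Lemma harm_mono (a n : nat) : (a <= n)%N -> harm R a <= harm R n.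
Proof.
move=> an; rewrite -(subnKC an); elim: (n - a)%N => [|k IH]; first by rewrite addn0.
by rewrite addnS /=; apply: le_trans IH _; rewrite lerDl.
Qed.

End harmonic.

(** * Mass lost by the killed walk for one marked site and for a marked ball *)

Section asymptotics.
Context (R : realType) (Q : nat -> R).
Hypotheses (Q_dist : is_distribution Q) (Q_critical : dist_mean Q = 1%E).
Hypothesis (Q_var_pos : (0 < dist_variance Q)%E).
Hypothesis (Q_var_fin : (dist_variance Q < +oo)%E).
Notation site := 'rV[int]_2.
Notation cb := (cb Q_dist Q_critical Q_var_pos Q_var_fin).
Notation s2 := (s2 Q).

Definition normsq (z : site) : int := z 0 0 ^+ 2 + z 0 1 ^+ 2.

(** Converts Euclidean bounds to the rotated coordinates of [heat_lb], at the scale M = 4 (K +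
    1). *)
Lemma close_coords (K m : nat) (z x : site) :
  normsq z <= (K * m)%N%:Z -> normsq x <= m%:Z ->
  (maxn `|((z - x) 0 0 + (z - x) 0 1)%R|%N `|((z - x) 0 0 - (z - x) 0 1)%R|%N ^ 2
    <= 4 * K.+1 * m)%N.
Proof.
rewrite !mxE /normsq.
set z0 := z 0 0; set z1 := z 0 1; set x0 := x 0 0; set x1 := x 0 1.
rewrite PoszM => hz hx.
have key (u : int) : u ^+ 2 <= 4 * (z0 ^+ 2 + z1 ^+ 2 + (x0 ^+ 2 + x1 ^+ 2)) ->
   (`|u|%N ^ 2 <= 4 * K.+1 * m)%N.
  rewrite -abszX -lez_nat gez0_abs ?sqr_ge0// => hu; apply: (le_trans hu).
  by rewrite !PoszM (_ : K.+1%:Z = K%:Z + 1); [lra|lia].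
have sq (a b c e : int) : (a - c + (b - e)) ^+ 2 <= 4 * (a ^+ 2 + b ^+ 2 + (c ^+ 2 + e ^+ 2)).
  rewrite -subr_ge0 (_ : _ - _ = (a + c) ^+ 2 + (a - b) ^+ 2 + (a + e) ^+ 2 +
    (c + b) ^+ 2 + (c - e) ^+ 2 + (b + e) ^+ 2); last by ring.
  by rewrite !addr_ge0 ?sqr_ge0.
have h1 := key _ (sq z0 z1 x0 x1).
have := sq z0 (- z1) x0 (- x1); rewrite !sqrrN -opprD => /key h2.
by rewrite /maxn; case: ifP.
Qed.

(** Small enough for [gen_iter_lb] with C = 5/4, the constant of [heat_ub], and for [surv_lb]. *)
Definition theta : R := (4 * (1 + s2))^-1.

Lemma theta01 : 0 < theta <= 1.
Proof.
have s0 := s2_gt0 Q_var_pos Q_var_fin.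
have p0 : 0 < 4 * (1 + s2) by lra.
by rewrite /theta invr_gt0 p0 /= invf_le1//; lra.
Qed.

Lemma s2_theta : s2 * theta * (5 / 4) * 2 <= 1 /\ s2 * theta <= 1 / 2.
Proof.
have s0 := s2_gt0 Q_var_pos Q_var_fin.
have [h0 _] := andP theta01.
have : theta * (4 * (1 + s2)) = 1 by rewrite /theta mulVf// gt_eqF//; lra.
move: theta h0 => t t0 e; split; nra.
Qed.

Lemma delta_unit (x : site) : unit_valued (fun z => 1 - delta R x z).
Proof. by move=> z; rewrite /delta; case: (_ == _); rewrite /= ?subr0 ?subrr ?lexx ?ler01. Qed.

(** [gen_iter_lb] bounds from below the chance w that a side branch reaches x, and 1 - f'(1 - w) >=
    cb w. *)
Lemma branching_kill_lb (x z : site) m :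
  cb * (theta / harm R m * heat R m.+1 (z - x)) <=
  1 - dpgf Q (avg (gen_iter Q m (fun z => 1 - delta R x z)) z).
Proof.
have s0 := s2_gt0 Q_var_pos Q_var_fin.
set a := fun z => _; have ha : unit_valued a by exact: delta_unit.
have [t0 t1] := andP theta01; have [hs _] := s2_theta.
have ua := avg_unit (gen_iter_unit Q_dist m ha) z.
have w01 : 0 <= 1 - avg (gen_iter Q m a) z <= 1 by lra.
have := dpgf_ub Q_dist Q_critical Q_var_pos Q_var_fin w01; rewrite subKr => h.
have dE j y : avgn j (fun z => 1 - a z) y = heat R j (y - x).
  by rewrite -avgn_delta; apply: eq_avgn => u; rewrite /a subKr.
have hk y : theta / harm R m * heat R m (y - x) <= 1 - gen_iter Q m a y.
  rewrite -dE; apply: (gen_iter_lb Q_dist Q_critical Q_var_pos Q_var_fin (C := 5 / 4)) => //.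
  - by rewrite (ltW t0).
  - by move=> j u; rewrite dE; exact: heat_ub.
have : theta / harm R m * heat R m.+1 (z - x) <= 1 - avg (gen_iter Q m a) z.
  have -> : theta / harm R m * heat R m.+1 (z - x) =
     avg (fun y => theta / harm R m * heat R m (y - x)) z.
    rewrite avgZ; congr (_ * _); rewrite -avgn_delta avgnS.
    by apply: eq_avg => y; rewrite avgn_delta.
  apply: (@le_trans _ _ (avg (fun y => 1 - gen_iter Q m a y) z)); first exact: le_avg.
  by rewrite le_eqVlt; apply/orP; left; apply/eqP; rewrite !avgE; field.
have c0 := cb_gt0 Q_dist Q_critical Q_var_pos Q_var_fin.
move=> /(ler_wpM2l (ltW c0)) h2; lra.
Qed.

(** Chebyshev's inequality: the second moment after m + 1 steps is 4 (m + 1) / 5. *)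
Lemma heat_far_mass (K m : nat) : (0 < K)%N ->
  massle (fun z => heat R m.+1 z * (~~ (normsq z <= (K * m.+1)%N%:Z))%:R) (K%:R^-1).
Proof.
move=> K0 s us.
apply: le_trans (sum_heat_le m.+1 us (h := fun z => (~~ (normsq z <= (K * m.+1)%N%:Z))%:R) _) _.
  by [].
have c0 : 0 < (K * m.+1)%:R :> R by rewrite ltr0n muln_gt0 K0.
apply: le_trans (markov_avgn m.+1 (h := fun z : site => (z 0 0 ^+ 2 + z 0 1 ^+ 2)%:~R) c0 _ _ _ 0) _.
- by move=> z; rewrite ler0z addr_ge0 ?sqr_ge0.
- by move=> z; rewrite ler0n lern1 leq_b1.
- move=> z; rewrite pnatr_eq0 eqb0 negbK -ltNge => /ltW h.
  by rewrite -[leLHS]/((K * m.+1)%N%:Z%:~R) ler_int.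
rewrite avgn_normsq !mxE expr0n /= !add0r ler_pdivrMr// natrM mulrA mulVf ?mul1r.
  by rewrite ler_piMl//; lra.
by rewrite pnatr_eq0 -lt0n.
Qed.

(** Killing is counted only from time a >= |x|^2 on, when x is within the diffusive scale, and only
    while the squared norm of the walk is at most K times its time; [heat_far_mass] bounds the
    exceptional mass by 1 / K. *)
Lemma vacant_mass (K : nat) : (0 < K)%N -> exists2 g : R, 0 < g & exists m0 : nat,
  forall (n a : nat) (x : site), (m0 <= a)%N -> (a <= n)%N ->
    normsq x <= a%:Z ->
    massle (killed Q (fun z => 1 - delta R x z) n)
      (K%:R^-1 + expR (g * (ln (harm R a) - ln (harm R n)))).
Proof.
move=> K0.
have [c c0 [m0 hc]] := heat_lb R (4 * K.+1).
have c1 : 0 < Num.min c 1 by rewrite lt_min c0 ltr01.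
have cb0 := cb_gt0 Q_dist Q_critical Q_var_pos Q_var_fin.
have cb1 := cb_le1 Q_dist Q_critical Q_var_pos Q_var_fin.
have [t0 t1] := andP theta01.
(* The minimum with 1 ensures g <= 1, so that each rate [be m] is at most 1. *)
pose g := cb * theta * Num.min c 1.
have g0 : 0 < g by rewrite !mulr_gt0.
have g1 : g <= 1.
  rewrite /g mulr_ile1 ?mulr_ge0 ?(ltW cb0) ?(ltW t0) ?(ltW c1)//.
    by rewrite mulr_ile1 ?(ltW cb0) ?(ltW t0).
  by rewrite ge_min lexx orbT.
exists g => //; exists m0 => n a x m0a an xa.
pose be m : R := if (a <= m)%N then g / (m.+1%:R * harm R m) else 0.
have be01 m : 0 <= be m <= 1.
  rewrite /be; case: ifP => _; last by rewrite lexx ler01.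
  have h1 := harm_ge1 R m.
  have h2 : 1 <= m.+1%:R :> R by rewrite ler1n.
  have h3 : 1 <= m.+1%:R * harm R m by nra.
  rewrite divr_ge0 ?(ltW g0)//=; last by lra.
  by rewrite ler_pdivrMr; lra.
pose good m : pred site := fun z => (m < a)%N || (normsq z <= (K * m.+1)%N%:Z).
move=> s us.
have h := @killed_mass_ub R Q Q_dist Q_critical Q_var_pos Q_var_fin (fun z => 1 - delta R x z)
  be K%:R^-1 good n (delta_unit x) _ be01 _ _ s us.
apply: le_trans (h _ _ _) _.
- by rewrite invr_ge0.
- move=> m z; rewrite /good /be; case: (ltnP m a) => ma /=.
    move=> _; have := avg_unit (gen_iter_unit Q_dist m (delta_unit x)) z.
    by move=> /(dpgf_unit Q_dist Q_critical Q_var_pos Q_var_fin); lra.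
  move=> hz; apply: le_trans (branching_kill_lb x z m).
  have hm := harm_ge1 R m.
  have m1 : 0 < m.+1%:R :> R by rewrite ltr0n.
  have : c / m.+1%:R <= heat R m.+1 (z - x).
    pose U := maxn `|((z - x) 0 0 + (z - x) 0 1)%R|%N `|((z - x) 0 0 - (z - x) 0 1)%R|%N.
    apply: (hc m.+1 U); [exact: leq_trans m0a (leqW ma)| |exact: leq_maxl|exact: leq_maxr].
    by apply: close_coords => //; apply: (le_trans xa); rewrite lez_nat leqW.
  rewrite ler_pdivrMr// => hh.
  have -> : g / (m.+1%:R * harm R m) = cb * (theta / harm R m * (Num.min c 1 / m.+1%:R)).
    by rewrite /g; field; rewrite !gt_eqF//; lra.
  rewrite ler_wpM2l ?(ltW cb0)// ler_wpM2l//; first by rewrite divr_ge0 ?(ltW t0)//; lra.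
  rewrite ler_pdivrMr//; apply: le_trans hh.
  by rewrite ge_min lexx.
- move=> m; rewrite /be; case: leqP => [am _|_]; last by rewrite eqxx.
  move=> s' us'; apply: le_trans (heat_far_mass m K0 us').
  by apply: ler_sum => y _; rewrite /good ltnNge am.
rewrite lerD2l; apply: prod_harm_ub => //; first exact: ltW.
by move=> m /andP[am _]; rewrite /be am.
Qed.

Lemma avgn_ball (sg : R) (bs : seq site) k : uniq bs -> 0 <= sg ->
  avgn k (fun z => sg * (z \in bs)%:R) 0 <= sg * ((size bs)%:R * (5 / 4 / (k%:R + 1))).
Proof.
move=> ubs sg0; rewrite avgnZ ler_wpM2l//.
elim: bs ubs => [_|x bs IH /= /andP[xbs ubs]].
  rewrite (eq_avgn _ (h2 := fun=> 0)) => [|z]; last by rewrite in_nil.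
  by rewrite avgn_cst mul0r.
rewrite (eq_avgn _ (h2 := fun z => delta R x z + (z \in bs)%:R)); last first.
  move=> z; rewrite inE /delta; case: eqP => [->|_] /=; last by rewrite add0r.
  by rewrite (negbTE xbs) addr0.
rewrite avgnD_fun avgn_delta -natr1 mulrDl mul1r addrC lerD//; first exact: IH.
exact: heat_ub.
Qed.

(** After 2 m + 2 steps each site of bs is hit with probability at most (5/4) / (2 m + 3) <= 1 / (m
    + 1), and the sum over m is harmonic. *)
Lemma crowd_mass (sg : R) (bs : seq site) n : uniq bs -> 0 <= sg <= 1 ->
  massle (fun z => heat R n z - killed Q (fun z => 1 - sg * (z \in bs)%:R) n z)
    (s2 * (sg * (size bs)%:R * harm R n)).
Proof.
move=> ubs /andP[sg0 sg1] s us.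
have s0 := s2_gt0 Q_var_pos Q_var_fin.
have ha : unit_valued (fun z : site => 1 - sg * (z \in bs)%:R).
  by move=> z; case: (_ \in _); rewrite /= ?mulr1 ?mulr0; lra.
apply: le_trans (killed_mass_lb Q_dist Q_critical Q_var_pos Q_var_fin n ha us) _.
rewrite ler_wpM2l ?(ltW s0)// harmE.
apply: (@le_trans _ _ (sg * (size bs)%:R * \sum_(m < n) (m%:R + 1)^-1)); last first.
  by rewrite ler_wpM2l ?mulr_ge0// lerDr.
rewrite mulr_sumr; apply: ler_sum => m _.
rewrite (eq_avgn _ (h2 := fun z => sg * (z \in bs)%:R)); last by move=> z; rewrite subKr.
apply: le_trans (avgn_ball _ ubs sg0) _.
rewrite -[leRHS]mulrA ler_wpM2l// ler_wpM2l//.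
rewrite natrD -(natr1 m); have m0 : 0 <= m%:R :> R by [].
rewrite ler_pdivrMr; last by lra.
rewrite [leRHS]mulrC ler_pdivlMr; last by lra.
by lra.
Qed.

End asymptotics.

(** * Lattice balls around the origin *)

Section balls.
Context (R : realType).
Notation site := 'rV[int]_2.

Definition ball0 (r : R) : seq site := fset_set (site_ball (0 : site) r).

Lemma uniq_ball0 r : uniq (ball0 r).
Proof. exact: fset_uniq. Qed.

Lemma mem_ball0 r x : (x \in ball0 r) = (site_dist R (0 : site) x <= r :> R).
Proof.
rewrite /ball0 in_fset_set; last exact: finite_site_ball.
by apply/idP/idP; rewrite inE.
Qed.

Lemma site_dist_shift (y z : site) : site_dist R y z = site_dist R (0 : site) (z - y) :> R.
Proof.
rewrite /site_dist; congr Num.sqrt; apply: eq_bigr => i _.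
by rewrite !mxE sub0r opprB.
Qed.

Lemma site_dist_normsq (x : site) : site_dist R (0 : site) x = Num.sqrt (normsq x)%:~R :> R.
Proof.
rewrite /site_dist big_ord_recl big_ord1 !mxE !sub0r.
have -> : lift ord0 ord0 = 1 :> 'I_2 by apply/val_inj.
by rewrite /normsq rmorphD /= !rmorphXn /= !rmorphN /= !sqrrN.
Qed.

Lemma normsq_ball0 r x : 0 <= r -> x \in ball0 r -> (normsq x)%:~R <= r ^+ 2.
Proof.
move=> r0; rewrite mem_ball0 site_dist_normsq => h.
have n0 : 0 <= (normsq x)%:~R :> R by rewrite ler0z addr_ge0 ?sqr_ge0.
by rewrite -(sqr_sqrtr n0) lerXn2r ?nnegrE ?sqrtr_ge0.
Qed.

Lemma ball0_0 r : 0 <= r -> 0 \in ball0 r.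
Proof.
by move=> r0; rewrite mem_ball0 site_dist_normsq /normsq !mxE expr0n /= addr0 sqrtr0.
Qed.

Lemma shift_abs (u : int) (n : nat) : `|u| <= n%:Z ->
  (`|(u + n%:Z)%R| < (n + n).+1)%N /\ u = `|(u + n%:Z)%R|%N%:Z - n%:Z.
Proof. by lia. Qed.

Lemma abs_of_sqr_lt (u v : int) (n : nat) : u ^+ 2 + v ^+ 2 < (n%:Z + 1) ^+ 2 -> `|u| <= n%:Z.
Proof.
move=> huv; rewrite -ltzD1 -(ltr_pXn2r (ltn0Sn 1)) ?nnegrE ?addr_ge0//.
by rewrite real_normK ?num_real//; apply: le_lt_trans huv; rewrite lerDl sqr_ge0.
Qed.

(** The ball lies in a square of 2 floor(r) + 1 <= 3 r sites a side. *)
Lemma size_ball0 r : 1 <= r -> (size (ball0 r))%:R <= 9 * r ^+ 2.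
Proof.
move=> r1; pose N := Num.truncn r.
have r0 : 0 <= r by lra.
have hN : N%:R <= r by rewrite truncn_le.
have hN1 : r < N.+1%:R by exact: truncnS_gt.
pose I := iota 0 (N + N).+1.
pose box : seq site := [seq pt (i%:Z - N%:Z) (j%:Z - N%:Z) | i <- I, j <- I].
have h : (size (ball0 r) <= size box)%N.
  apply: uniq_leq_size; first exact: uniq_ball0.
  move=> x /(normsq_ball0 r0) hx.
  have {}hx : normsq x < (N%:Z + 1) ^+ 2.
    rewrite -(ltr_int R); apply: (le_lt_trans hx); rewrite rmorphXn rmorphD /= natr1.
    by rewrite ltrXn2r// nnegrE ?ltW.
  have [h0 h1] : `|x 0 0| <= N%:Z /\ `|x 0 1| <= N%:Z.
    by split; [exact: abs_of_sqr_lt hx|move: hx; rewrite /normsq addrC; exact: abs_of_sqr_lt].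
  apply/allpairsP; exists (`|(x 0 0 + N%:Z)%R|%N, `|(x 0 1 + N%:Z)%R|%N) => /=.
  have [m0 e0] := shift_abs h0; have [m1 e1] := shift_abs h1.
  split; rewrite ?mem_iota//.
  by apply/eqP; rewrite site2P ptE0 ptE1 -e0 -e1 !eqxx.
move: h; rewrite size_allpairs size_iota -(ler_nat R) natrM => h; apply: (le_trans h).
have : (N + N).+1%:R <= 3 * r by rewrite -natr1 natrD; lra.
have : 0 <= (N + N).+1%:R :> R by [].
by move: ((N + N).+1%:R : R) => t t0 ht; rewrite expr2; nra.
Qed.

End balls.

(** * Bad events of the typical particle on the scale of the survival probability *)

Section typical_asymptotics.
Context d (T : measurableType d) (R : realType) (P : probability T R).
Context (Q : nat -> R) (B : branching_random_walk P 2 Q).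
Hypotheses (Q_dist : is_distribution Q) (Q_critical : dist_mean Q = 1%E).
Hypothesis (Q_var_pos : (0 < dist_variance Q)%E).
Hypothesis (Q_var_fin : (dist_variance Q < +oo)%E).
Notation site := 'rV[int]_2.
Notation pos := (pos B).
Notation cb := (cb Q_dist Q_critical Q_var_pos Q_var_fin).
Notation s2 := (s2 Q).
Notation surv := (surv Q).

Lemma num_unoccupiedE n (r : R) y w :
  num_unoccupied B n (site_ball y r) w = vacant (ball0 r) (pos n w) y.
Proof.
rewrite /num_unoccupied /vacant -size_filter.
rewrite -(size_map (fun x => y + x)); apply: perm_size; apply: uniq_perm.
- exact: fset_uniq.
- by rewrite map_inj_uniq ?filter_uniq ?uniq_ball0//; exact: addrI.
move=> z; rewrite in_fset_set; last first.
  by apply: sub_finite_set (finite_site_ball y r); exact: subIsetl.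
have posP x : x \in pos n w <-> exists2 u, u \in generation B n w & location B u w = x.
  split; first by move=> /mapP[u ug ->]; exists u.
  by move=> [u ug <-]; exact: map_f.
apply/idP/mapP.
  rewrite inE => -[yz uz]; exists (z - y); last by rewrite addrC subrK.
  rewrite mem_filter mem_ball0 -site_dist_shift addrC subrK; apply/andP; split=> //.
  by apply/negP => /posP[u ug uz']; exact: (uz u).
move=> [x]; rewrite mem_filter mem_ball0 => /andP[hx xr] ->; rewrite inE; split.
  by rewrite /site_ball /= site_dist_shift addrC addKr.
by move=> u ug ux; move/negP: hx; apply; apply/posP; exists u.
Qed.

Lemma num_particlesE n (r : R) y w :
  num_particles B n (site_ball y r) w = crowd (ball0 r) (pos n w) y.
Proof.
rewrite /num_particles /crowd count_map; apply: eq_count => u /=.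
rewrite mem_ball0 -site_dist_shift.
by apply/idP/idP; rewrite inE.
Qed.

Lemma vacant_perm bs (s t : seq site) y : perm_eq s t -> vacant bs s y = vacant bs t y.
Proof. by move=> /perm_mem st; apply: eq_count => x; rewrite st. Qed.

Lemma crowd_perm bs (s t : seq site) y : perm_eq s t -> crowd bs s y = crowd bs t y.
Proof. by move=> /permP; exact. Qed.

Lemma surv_gt0 n : 0 < surv n.
Proof.
have [t0 t1] := andP (theta01 Q_var_pos Q_var_fin).
have [_ h] := s2_theta Q_var_pos Q_var_fin.
apply: lt_le_trans (surv_lb Q_dist Q_critical Q_var_pos Q_var_fin n _ h).
  by rewrite divr_gt0// ltr_wpDl.
by rewrite (ltW t0).
Qed.

Local Open Scope ereal_scope.

(** The term e pays for small populations and C M for bad particles in large ones. C and N depend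
    neither on the bad event nor on tau. *)
Lemma typical_small (e : R) : (0 < e)%R -> exists2 C : R, (0 <= C)%R & exists N : nat,
  forall n tau (bad : seq site -> site -> bool) (M : R), (N <= n)%N ->
    typical_particle B n tau ->
    (forall s t y, perm_eq s t -> bad s y = bad t y) ->
    \int[P]_w (count (bad (pos n w)) (pos n w))%:R%:E <= M%:E ->
    P (survives B n `&` [set w | bad (pos n w) (location B (tau w) w)]) <=
    ((e + C * M) * surv n)%:E.
Proof.
move=> e0.
have s0 := s2_gt0 Q_var_pos Q_var_fin.
have c0 := cb_gt0 Q_dist Q_critical Q_var_pos Q_var_fin.
have [t0 t1] := andP (theta01 Q_var_pos Q_var_fin).
have [_ hth] := s2_theta Q_var_pos Q_var_fin.
(* With k about x = rho (n + 1), the bound 2 k s2 surv^2 of [small_population] is at most 4 x s2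
   surv^2 = e * (cb * surv * (n + 1)) * surv, hence at most e * surv by [surv_ub]. *)
pose rho : R := (e * cb / (4 * s2))%R.
have r0 : (0 < rho)%R by rewrite divr_gt0// mulr_gt0.
(* This makes M / m = C M theta / (n + 1) for m = cb x / 2, and theta / (n + 1) <= surv n by
   [surv_lb]. *)
pose C : R := (2 / (cb * rho * theta Q))%R.
have crt : (0 < cb * rho * theta Q)%R by apply: mulr_gt0 => //; exact: mulr_gt0.
have C0 : (0 <= C)%R by apply/ltW; rewrite divr_gt0.
(* From here on x >= 1, so k <= x + 1 <= 2 x. *)
exists C => //; exists (Num.truncn rho^-1).+1 => n tau bad M nN tt bp HM.
have rn : (1 <= rho * (n%:R + 1))%R.
  rewrite -ler_pdivrMl// mulr1.
  have := truncnS_gt rho^-1; have : ((Num.truncn rho^-1).+1%:R <= n%:R :> R)%R by rewrite ler_nat.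
  lra.
set x := (rho * (n%:R + 1))%R in rn.
pose k := (Num.truncn x).+1.
have k1 : (x < k%:R)%R by exact: truncnS_gt.
have k2 : (k%:R <= x + 1)%R.
  by rewrite /k -natr1 lerD2r truncn_le; lra.
pose m : R := (cb * x / 2)%R.
have m0 : (0 < m)%R by rewrite divr_gt0// mulr_gt0//; lra.
have hk : (surv k * m <= 1 / 2)%R.
  have h := surv_ub Q_dist Q_critical Q_var_pos Q_var_fin k.
  rewrite -[leRHS]mul1r in h; have k0 : (0 < k%:R + 1 :> R)%R by lra.
  have : (cb * surv k * (k%:R + 1) <= 1)%R by rewrite -ler_pdivlMr.
  have : (0 <= cb * surv k)%R by apply/ltW/mulr_gt0 => //; exact: surv_gt0.
  rewrite /m (_ : surv k * (cb * x / 2) = cb * surv k * x / 2)%R; last by ring.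
  move: (cb * surv k)%R => y y0 hy.
  have : (y * x <= y * (k%:R + 1))%R by rewrite ler_wpM2l//; lra.
  lra.
apply: (le_trans (typical_bound tt bp m0)).
apply: (le_trans (leeD (small_population B Q_dist Q_critical Q_var_pos Q_var_fin n hk)
  (lee_wpmul2l _ HM))); first by rewrite lee_fin invr_ge0 ltW.
rewrite -EFinM -EFinD lee_fin [leRHS]mulrDl.
have q0 := surv_gt0 n.
have n0 : (0 < n%:R + 1 :> R)%R by rewrite ltr_wpDl.
have hq : (cb * surv n * (n%:R + 1) <= 1)%R.
  by rewrite -ler_pdivlMr// div1r; exact: surv_ub.
have hl : (theta Q <= surv n * (n%:R + 1))%R.
  by rewrite -ler_pdivrMr//; apply: surv_lb => //; rewrite (ltW t0).
have M0 : (0 <= M)%R.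
  by rewrite -lee_fin; apply: le_trans HM; apply: integral_ge0 => w _; rewrite lee_fin.
apply: lerD.
  rewrite (_ : 2 * (k%:R * s2 * surv n ^+ 2) = 2 * (k%:R * s2 * surv n) * surv n)%R; last by ring.
  rewrite ler_wpM2r ?(ltW q0)//.
  have h1 : (k%:R <= 2 * x)%R by lra.
  have h2 : (k%:R * s2 * surv n <= 2 * x * s2 * surv n)%R.
    by rewrite ler_wpM2r ?(ltW q0)// ler_wpM2r// ltW.
  have h3 : (2 * x * s2 * surv n = e / 2 * (cb * surv n * (n%:R + 1)))%R.
    by rewrite /x /rho; field; rewrite gt_eqF.
  have h4 : (e / 2 * (cb * surv n * (n%:R + 1)) <= e / 2)%R.
    by rewrite ler_piMr// divr_ge0// ltW.
  rewrite h3 in h2; have := le_trans h2 h4.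
  by move: (k%:R * s2 * surv n)%R => u hu; lra.
have -> : (m^-1 * M = C * M * (theta Q / (n%:R + 1)))%R.
  rewrite /m /C /x; field; rewrite !gt_eqF//.
apply: ler_wpM2l; first by apply: mulr_ge0.
by rewrite ler_pdivrMr.
Qed.

(** Markov's inequality for the number of vacant sites around each particle, after exchanging the
    sums over particles and over sites. *)
Lemma expect_vacant_ball n (bs : seq site) (M t : R) : (0 < t)%R ->
  (forall x, x \in bs -> massle (killed Q (fun z => 1 - delta R x z)%R n) M) ->
  \int[P]_w (count (fun y => t < (vacant bs (pos n w) y)%:R)%R (pos n w))%:R%:E <=
    (t^-1 * ((size bs)%:R * M))%:E.
Proof.
move=> tgt0 HM.
pose c x s : R := (count (fun z : site => (z + x)%R \notin s) s)%:R.
have c0 x s : (0 <= c x s)%R by [].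
have mc x : measurable_fun setT (fun w => (c x (pos n w))%:E).
  exact: (pos_measurable_fun B n (fun s => (c x s)%:E)).
apply: (@le_trans _ _ (\int[P]_w ((t^-1)%:E * \sum_(x <- bs) (c x (pos n w))%:E))).
  apply: ge0_le_integral => //.
  - exact: (pos_measurable_fun B n (fun s => (count (fun y => t < (vacant bs s y)%:R)%R s)%:R%:E)).
  - exact: (pos_measurable_fun B n (fun s => (t^-1)%:E * \sum_(x <- bs) (c x s)%:E)).
  move=> w _; rewrite sumEFin -EFinM lee_fin /c.
  move: (pos n w) => s.
  have -> : (\sum_(x <- bs) (count (fun z : site => (z + x)%R \notin s) s)%:R =
     \sum_(z <- s) (vacant bs s z)%:R :> R)%R.
    under eq_bigr => x _ do rewrite -sum_indicator.
    rewrite exchange_big/=; apply: eq_bigr => z _.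
    by rewrite /vacant -sum_indicator.
  rewrite mulr_sumr -sum_indicator; apply: ler_sum => z _.
  case: ltP => h /=; last by rewrite mulr_ge0// invr_ge0 ltW.
  by rewrite mulrC ler_pdivlMr// mul1r ltW.
have ti : (0 <= t^-1)%R by rewrite invr_ge0 ltW.
have mS : measurable_fun setT (fun w => \sum_(x <- bs) (c x (pos n w))%:E).
  exact: (pos_measurable_fun B n (fun s => \sum_(x <- bs) (c x s)%:E)).
have S0 w : setT w -> 0 <= \sum_(x <- bs) (c x (pos n w))%:E.
  by move=> _; apply: sume_ge0 => x _; rewrite lee_fin.
rewrite ge0_integralZl//.
rewrite EFinM; apply: lee_wpmul2l; first by rewrite lee_fin.
rewrite ge0_integral_sum//; last by move=> x w _; rewrite lee_fin.
have -> : ((size bs)%:R * M)%:E = \sum_(x <- bs) M%:E.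
  rewrite sumEFin big_const_seq count_predT iter_addr_0 mulr_natl.
  by [].
rewrite big_seq [leRHS]big_seq; apply: lee_sum => x xbs.
by apply: expect_vacant => //; exact: HM.
Qed.

End typical_asymptotics.

(** * The conditional distribution as a probability measure *)

Section conditional_law.
Context d (T : measurableType d) (R : realType) (P : probability T R).
Variables (H : set T) (Y : T -> R).
Hypothesis mHY : forall A : set R, measurable A -> measurable (H `&` Y @^-1` A).
Hypothesis H0 : (0 < P H)%E.
Local Open Scope ereal_scope.

Let nu : set R -> \bar R := cond_distribution P H Y.
Let c : R := (fine (P H))^-1%R.

Let mH : measurable H.
Proof. by rewrite -[H]setIT -(preimage_setT Y); apply: mHY; exact: measurableT. Qed.

Let Hfin : P H \is a fin_num. Proof. exact: fin_num_measure. Qed.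

Let fH0 : (0 < fine (P H))%R. Proof. by apply: fine_gt0; rewrite H0 ltey_eq Hfin. Qed.

Let c_ge0 : (0 <= c)%R. Proof. by rewrite invr_ge0 ltW. Qed.

Let nu0 : nu set0 = 0.
Proof. by rewrite /nu /cond_distribution preimage_set0 setI0 measure0 mul0e. Qed.

Let nu_ge0 A : 0 <= nu A.
Proof. by rewrite /nu /cond_distribution mule_ge0// lee_fin. Qed.

(** Y is measurable only on H, so [nu] is not handled as a pushforward and countable additivity is
    checked directly. *)
Let nu_sigma : semi_sigma_additive nu.
Proof.
move=> F mF tF mUF; rewrite [X in X @ \oo --> _](_ : _ =
    (fun n => c%:E * \sum_(0 <= i < n) P (H `&` Y @^-1` F i))); last first.
  by apply/funext => k; rewrite ge0_sume_distrr//; apply: eq_bigr => i _; rewrite muleC.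
rewrite /nu /cond_distribution muleC preimage_bigcup setI_bigcupr.
apply: cvgeZl => //; apply: measure_semi_sigma_additive.
- by move=> n; apply: mHY; exact: mF.
- apply/trivIsetP => /= i j _ _ ij; rewrite setIACA -preimage_setI.
  by move/trivIsetP : tF => /(_ _ _ _ _ ij) ->//; rewrite preimage_set0 setI0.
- by rewrite -setI_bigcupr -preimage_bigcup; apply: mHY.
Qed.

HB.instance Definition _ := isMeasure.Build _ _ _ nu nu0 nu_ge0 nu_sigma.

Let nuT : nu setT = 1.
Proof.
rewrite /nu /cond_distribution preimage_setT setIT -[in X in X * _](fineK Hfin) -EFinM.
by rewrite divff// gt_eqF.
Qed.

Lemma cond_distribution_le (A : set R) (p : R) :
  P (H `&` Y @^-1` A) <= (p * fine (P H))%:E -> cond_distribution P H Y A <= p%:E.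
Proof.
move=> h; rewrite /cond_distribution.
apply: le_trans (lee_wpmul2r _ h) _; first by rewrite lee_fin.
by rewrite -EFinM lee_fin mulfK// gt_eqF.
Qed.

(** The integral is split at |x| = dl: inside, g differs from g 0 by at most e; outside, by at most
    2 M on a set of mass at most p. *)
Lemma cond_integral_close (g : R -> R) (dl e M p : R) :
  continuous g -> (forall x, `|g x| <= M)%R -> (0 <= e)%R ->
  (forall x, `|x| <= dl -> `|g x - g 0| <= e)%R ->
  P (H `&` Y @^-1` [set x | dl < `|x|]%R) <= (p * fine (P H))%:E ->
  exists2 r : R, \int[cond_distribution P H Y]_x (g x)%:E = r%:E & (`|r - g 0| <= e + 2 * M * p)%R.
Proof.
move=> cg gM e0 gd Hp.
pose h x : R := (g x - g 0)%R.
have M0 : (0 <= M)%R by apply: le_trans (gM 0%R).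
have mg : measurable_fun setT g by exact: continuous_measurable_fun.
have bd (f : R -> R) (C : R) : (forall x, `|f x| <= C)%R -> [bounded f x | x in [set: R]].
  move=> fC; exists C; split; first exact: num_real.
  by move=> x Cx y _; apply: le_trans (fC y) (ltW Cx).
have nuf : nu setT < +oo by rewrite nuT ltry.
have ig : nu.-integrable setT (EFin \o g).
  by apply: measurable_bounded_integrable => //; exact: (bd g M).
have ic : nu.-integrable setT (EFin \o (fun=> g 0%R)).
  by apply: measurable_bounded_integrable => //; exact: (bd (fun=> g 0%R) M (fun=> gM 0%R)).
have cstI (k : R) : \int[nu]_x k%:E = k%:E.
  transitivity (\int[nu]_x (cst k%:E) x); first by [].
  by rewrite integral_cst// [X in _ * X](_ : _ = 1) ?mule1//; exact: nuT.
have If : \int[nu]_x (g x)%:E \is a fin_num by exact: integrable_fin_num.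
exists (fine (\int[nu]_x (g x)%:E)); first exact: (esym (fineK If)).
rewrite -lee_fin.
have -> : (`|fine (\int[nu]_x (g x)%:E) - g 0|)%:E = `| \int[nu]_x (h x)%:E |.
  have -> : \int[nu]_x (h x)%:E = \int[nu]_x (g x)%:E - (g 0%R)%:E.
    under eq_integral do rewrite EFinB.
    rewrite integralB_EFin//; congr (_ - _); exact: cstI.
  by rewrite -[in RHS](fineK If) -EFinB.
have mh : measurable_fun setT h by apply: measurable_funB.
apply: le_trans (le_abse_integral _ _ _) _ => //; first exact/measurable_EFinP.
pose Bad := [set x : R | dl < `|x|]%R.
have mBad : measurable Bad.
  apply: open_measurable; apply: (open_comp (f := fun x : R => `|x|%R) (D := [set y | dl < y]%R)).
    by move=> x _; exact: norm_continuous.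
  exact: open_gt.
have m1 : measurable_fun setT (fun x : R => (\1_Bad x : R)%:E).
  by apply/measurable_EFinP; exact: measurable_indic.
have m2 : measurable_fun setT (fun x : R => (2 * M)%:E * (\1_Bad x : R)%:E).
  exact: measurable_funeM.
have M2 : (0 <= 2 * M)%R by rewrite mulr_ge0.
apply: (@le_trans _ _ (\int[nu]_x (e%:E + (2 * M)%:E * (\1_Bad x : R)%:E))).
  apply: ge0_le_integral => //.
  - by apply: measurableT_comp => //; exact/measurable_EFinP.
  - by apply: emeasurable_funD.
  move=> x _; rewrite /= -EFinM -EFinD lee_fin indicE /h.
  have [xB|xB] := boolP (x \in Bad).
    rewrite mulr1; have := ler_normB (g x) (g 0%R); have := gM x; have := gM 0%R; lra.
  rewrite mulr0 addr0; apply: gd; rewrite leNgt; apply/negP => h'.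
  by move/negP: xB; apply; rewrite inE.
rewrite ge0_integralD//; last by move=> x _; rewrite mule_ge0 ?lee_fin.
rewrite cstI EFinD leeD2l//.
have b0 x : setT x -> 0 <= (\1_Bad x : R)%:E by rewrite lee_fin.
rewrite ge0_integralZl//.
rewrite integral_indic// setIT (EFinM (2 * M)%R p); apply: lee_wpmul2l; first by rewrite lee_fin.
exact: cond_distribution_le.
Qed.

End conditional_law.

(** * Criteria for the two conditional asymptotic relations *)

Section criteria.
Context d (T : measurableType d) (R : realType) (P : probability T R).
Variables (H : nat -> set T) (X : nat -> T -> R) (f : nat -> R).
Hypothesis mHX : forall n (A : set R), measurable (H n `&` X n @^-1` A).
Hypothesis H0 : forall n, (0 < P (H n))%E.

Let Y n w := X n w / f n.

Let mHY n (A : set R) : measurable (H n `&` Y n @^-1` A).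
Proof. exact: (mHX n ((fun x => x / f n) @^-1` A)). Qed.

Lemma is_o_P_of_small :
  (forall e p : R, 0 < e -> 0 < p -> exists N : nat, forall n, (N <= n)%N ->
     (P (H n `&` Y n @^-1` [set x | (e < `|x|)%R]) <= (p * fine (P (H n)))%:E)%E) ->
  is_o_P P H X f.
Proof.
move=> small g cg [M0 [_ HM0]].
pose M := `|M0| + 1.
have Mpos : 0 < M by rewrite /M ltr_wpDl.
have gM x : `|g x| <= M.
  by apply: (HM0 M) => //; rewrite /M (le_lt_trans (ler_norm M0))// ltrDl.
have close n dl e p : 0 <= e -> (forall x, `|x| <= dl -> `|g x - g 0| <= e) ->
    (P (H n `&` Y n @^-1` [set x | (dl < `|x|)%R]) <= (p * fine (P (H n)))%:E)%E ->
    exists2 r : R, (\int[cond_distribution P (H n) (Y n)]_x (g x)%:E = r%:E)%E &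
      `|r - g 0| <= e + 2 * M * p.
  move=> e0 gd Hp.
  exact: (cond_integral_close (fun A _ => mHY n A) (H0 n) cg gM e0 gd Hp).
have mg : measurable_fun setT g by exact: continuous_measurable_fun.
rewrite integral_dirac//; last exact/measurable_EFinP.
rewrite diracE mem_set// mul1e.
apply: cvg_EFin.
  apply: nearW => n.
  have M20 : 0 <= 2 * M by rewrite mulr_ge0// ltW.
  have gd x : `|x| <= 0 -> `|g x - g 0| <= 2 * M.
    by move=> _; have := ler_normB (g x) (g 0); have := gM x; have := gM 0; lra.
  have mH : measurable (H n) by rewrite -[H n]setIT -(preimage_setT (X n)); exact: mHX.
  (* The choice dl = 0, e = 2 M, p = 1 is always admissible; it shows that every integral is
     finite. *)
  have tot : (P (H n `&` Y n @^-1` [set x | (0 < `|x|)%R]) <= (1 * fine (P (H n)))%:E)%E.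
    rewrite mul1r fineK ?fin_num_measure//.
    by apply: le_measure; rewrite ?inE//; exact: mHY.
  by have [r -> _] := close n _ _ _ M20 gd tot.
apply/cvgrPdist_le => e e0.
have e2 : 0 < e / 2 by rewrite divr_gt0.
have /cvgrPdist_le/(_ _ e2) : g x @[x --> (0 : R)] --> g 0 by exact: cg.
rewrite near_nbhs; move=> /nbhs_ballP[dl /= dl0 Hdl].
pose p := e / (4 * M).
have p0 : 0 < p by rewrite divr_gt0// mulr_gt0.
have dl2 : 0 < dl / 2 by rewrite divr_gt0.
have [N HN] := small _ _ dl2 p0.
exists N => // n /= Nn.
have gd x : `|x| <= dl / 2 -> `|g x - g 0| <= e / 2.
  move=> xd; rewrite distrC; apply: Hdl; rewrite /ball /= sub0r normrN.
  by apply: (le_lt_trans xd); lra.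
have [r -> hr] := close n _ _ _ (ltW e2) gd (HN n Nn).
rewrite /= distrC; apply: (le_trans hr).
have -> : 2 * M * p = e / 2 by rewrite /p; field; rewrite gt_eqF.
by lra.
Qed.

(** Tightness concerns all indices at once. For the finitely many n < N each single law has a small
    tail by continuity from above, and X >= 0 allows the compact set to be an interval [[0, L]]. *)
Lemma is_O_P_of_tail : (forall n w, 0 <= X n w) ->
  (forall p : R, 0 < p -> exists (la : R) (N : nat), forall n, (N <= n)%N ->
     (P (H n `&` Y n @^-1` [set x | (la <= x)%R]) <= (p * fine (P (H n)))%:E)%E) ->
  is_O_P P H X f.
Proof.
move=> X0 tail p p0; have [la [N HN]] := tail p p0.
have fP n : 0 < fine (P (H n)).
  apply: fine_gt0; rewrite H0/= ltey_eq fin_num_measure//.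
  by rewrite -[H n]setIT -(preimage_setT (X n)); exact: mHX.
have each n : exists b : R, (P (H n `&` Y n @^-1` [set x | (b <= x)%R]) <= (p * fine (P (H n)))%:E)%E.
  pose F (i : nat) := H n `&` Y n @^-1` [set x | i%:R <= x].
  have : P \o F @ \oo --> P (\bigcap_i F i).
    apply: nonincreasing_cvg_mu.
    - by rewrite (le_lt_trans (probability_le1 P _)) ?ltry//; exact: mHY.
    - by move=> i; exact: mHY.
    - by apply: bigcap_measurable => // i _; exact: mHY.
    - move=> i j ij; apply/subsetPset => w [Hw /= h]; split=> //=.
      by apply: le_trans h; rewrite ler_nat.
  rewrite (_ : \bigcap_i F i = set0) ?measure0; last first.
    apply/seteqP; split => // w h.
    have [_ /=] := h (Num.truncn (Y n w)).+1 I.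
    by rewrite leNgt truncnS_gt.
  move=> /fine_cvgP[Ffin /cvgrPdist_le/(_ (p * fine (P (H n))))].
  rewrite mulr_gt0// => /(_ isT) [i _ Hi].
  have [j _ Hj] := Ffin.
  exists (maxn i j)%:R.
  have := Hi (maxn i j) (leq_maxl _ _); rewrite /= sub0r normrN => h.
  rewrite -[leLHS]fineK ?lee_fin; last exact: (Hj (maxn i j) (leq_maxr _ _)).
  exact: le_trans (ler_norm _) h.
have all_b : exists b : R, forall n, (n < N)%N ->
    (P (H n `&` Y n @^-1` [set x | (b <= x)%R]) <= (p * fine (P (H n)))%:E)%E.
  elim: N {HN} => [|m [b Hb]]; first by exists 0.
  have [b' Hb'] := each m; exists (Num.max b b') => n.
  have mono (c c' : R) : c <= c' -> (P (H n `&` Y n @^-1` [set x | (c' <= x)%R]) <=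
      P (H n `&` Y n @^-1` [set x | (c <= x)%R]))%E.
    move=> cc; apply: le_measure; rewrite ?inE; [exact: mHY|exact: mHY|].
    by move=> w [Hw /= h]; split=> //=; exact: le_trans h.
  rewrite ltnS leq_eqVlt => /orP[/eqP nm|nm].
    by apply: le_trans (mono b' _ _) _; [rewrite le_max lexx orbT|rewrite nm].
  by apply: le_trans (mono b _ _) (Hb n nm); rewrite le_max lexx.
have [b Hb] := all_b.
pose L : R := Num.max 0 (Num.max la b).
exists `[0%R, L]%classic; split; first exact: segment_compact.
move=> n /= fn0; apply: (cond_distribution_le (fun A _ => mHY n A) (H0 n)).
have sub (c : R) : c <= L -> (P (H n `&` Y n @^-1` (~` `[0%R, L]%classic)) <=
    P (H n `&` Y n @^-1` [set x | (c <= x)%R]))%E.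
  move=> cL; apply: le_measure; rewrite ?inE; [exact: mHY|exact: mHY|].
  move=> w [Hw /= h]; split=> //=; rewrite leNgt; apply/negP => wc; apply: h.
  rewrite in_itv /= divr_ge0 ?X0 ?(ltW fn0)//=.
  by apply: le_trans cL; exact: ltW.
have [Nn|nN] := leqP N n.
  by apply: le_trans (HN n Nn); apply: sub; rewrite !le_max lexx orbT.
by apply: le_trans (Hb n nN); apply: sub; rewrite !le_max lexx !orbT.
Qed.

End criteria.

(** * Choice of parameters for vacant sites and for crowding *)

Section main.
Context d (T : measurableType d) (R : realType) (P : probability T R).
Context (Q : nat -> R) (B : branching_random_walk P 2 Q).
Hypotheses (Q_dist : is_distribution Q) (Q_critical : dist_mean Q = 1%E).
Hypothesis (Q_var_pos : (0 < dist_variance Q)%E).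
Hypothesis (Q_var_fin : (dist_variance Q < +oo)%E).
Variable tau : nat -> T -> label.
Hypothesis tau_typical : forall n, typical_particle B n (tau n).
Variable ell : nat -> R.
Hypothesis ell_infty : ell n @[n --> \oo] --> +oo.
Hypothesis ell_subpoly : ln (ell n) / ln n%:R @[n --> \oo] --> (0 : R).
Notation pos := (pos B).
Notation surv := (surv Q).

Let ell_large (c : R) : exists N : nat, forall n, (N <= n)%N -> c <= ell n.
Proof.
have /cvgryPge/(_ c) [N _ HN] := ell_infty.
by exists N => n Nn; exact: HN.
Qed.

Let ln_large (c : R) : exists N : nat, forall n, (N <= n)%N -> c <= ln n%:R.
Proof.
exists (Num.truncn (expR c)).+1 => n hn.
rewrite -(expRK c) ler_ln ?posrE ?expR_gt0//; last first.
  by rewrite ltr0n; apply: leq_trans hn.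
by apply: le_trans (ltW (truncnS_gt (expR c))) _; rewrite ler_nat.
Qed.

Let ell_small (e : R) : 0 < e -> exists N : nat, forall n, (N <= n)%N -> ln (ell n) <= e * ln n%:R.
Proof.
move=> e0; have /cvgr_le/(_ e e0) [N1 _ HN1] := ell_subpoly.
have [N2 HN2] := ln_large 1.
exists (maxn N1 N2) => n hn.
have h1 := HN1 n (leq_trans (leq_maxl _ _) hn).
have h2 := HN2 n (leq_trans (leq_maxr _ _) hn).
by rewrite -ler_pdivrMr//; lra.
Qed.

Lemma vacant_small (eps p : R) : 0 < eps -> 0 < p -> exists N : nat, forall n, (N <= n)%N ->
  (P (survives B n `&` [set w | (eps * ell n ^+ 2 <
     (vacant (ball0 (ell n)) (pos n w) (location B (tau n w) w))%:R)%R]) <= (p * surv n)%:E)%E.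
Proof.
move=> eps0 p0; have p2 : 0 < p / 2 by rewrite divr_gt0.
have [C C0 [N1 HC]] := typical_small B Q_dist Q_critical Q_var_pos Q_var_fin p2.
(* Chosen so that C * (9 M / eps) <= p / 2, the 9 being that of [size_ball0]. *)
pose M := Num.min 1 (p * eps / (18 * (C + 1))).
have M0 : 0 < M by rewrite lt_min ltr01/= divr_gt0 ?mulr_gt0//; lra.
have M1 : M <= 1 by rewrite ge_min lexx.
have hCM : C * (eps^-1 * (9 * M)) <= p / 2.
  have : M <= p * eps / (18 * (C + 1)) by rewrite ge_min lexx orbT.
  rewrite ler_pdivlMr; last by lra.
  have -> : C * (eps^-1 * (9 * M)) = (M * (9 * C)) / eps by ring.
  move=> h; rewrite ler_pdivrMr//.
  have : M * (9 * C) <= M * (9 * (C + 1)) by rewrite ler_wpM2l ?(ltW M0)//; lra.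
  lra.
(* Half of M pays for the mass 1 / K beyond the diffusive scale, the other half for the product of
   survival rates. *)
pose K := (Num.truncn (2 / M)).+1.
have K0 : (0 < K)%N by [].
have [g g0 [m0 Hmass]] := vacant_mass Q_dist Q_critical Q_var_pos Q_var_fin K0.
have KM : K%:R^-1 <= M / 2.
  rewrite -[M / 2]invrK lef_pV2 ?posrE ?invr_gt0 ?divr_gt0// invf_div.
  exact: ltW (truncnS_gt _).
(* As q^g = M / 2, the bound (harm a / harm n)^g is at most M / 2 once harm a <= q * harm n. *)
pose q := expR (ln (M / 2) / g).
have M2 : 0 < M / 2 by rewrite divr_gt0.
have q1 : q < 1.
  rewrite -expR0 ltr_expR ltr_pdivrMr// mul0r.
  by rewrite -ln1 ltr_ln ?posrE//; lra.
have q0 : 0 < q by exact: expR_gt0.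
have q4 : 0 < q / 4 by rewrite divr_gt0.
have [N2 HN2] := ell_large (m0%:R + 1).
have [N3 HN3] := ell_small q4.
have [N4 HN4] := ln_large (8 / q).
exists (maxn (maxn N1 N2) (maxn N3 (maxn N4 1))) => n hn.
have /andP[/andP[n1 n2] /andP[n3 /andP[n4 n5]]] :
  ((N1 <= n) && (N2 <= n) && ((N3 <= n) && ((N4 <= n) && (1 <= n))))%N.
  by rewrite -!geq_max.
have l1 := HN2 n n2; have l2 := HN3 n n3; have l3 := HN4 n n4.
have m00 : 0 <= m0%:R :> R by [].
have l0 : 1 <= ell n by lra.
(* The time from which every site of the ball is within the diffusive scale. *)
pose a := (Num.truncn (ell n ^+ 2)).+1.
have a1 : ell n ^+ 2 < a%:R by exact: truncnS_gt.
have l20 : 0 <= ell n ^+ 2 by exact: sqr_ge0.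
have a2 : a%:R <= ell n ^+ 2 + 1 by rewrite /a -natr1 lerD2r truncn_le.
have m0a : (m0 <= a)%N.
  rewrite -(ler_nat R); apply: le_trans (ltW a1); rewrite expr2; nra.
have lnn : 0 < ln n%:R :> R by apply: lt_le_trans l3; rewrite divr_gt0.
(* Subpolynomial growth of ell enters here: harm a <= 4 + 2 ln (ell n), and each of the two terms is
   at most (q / 2) ln n. *)
have ha : harm R a <= q * harm R n.
  apply: (le_trans (harm_le_ln R a)).
  have l21 : 1 <= ell n ^+ 2 by rewrite expr2; nra.
  have h1 : ln (a%:R + 1) <= ln (3 * ell n ^+ 2).
    by rewrite ler_ln ?posrE; lra.
  have h2 : ln (3 * ell n ^+ 2) = ln 3 + 2 * ln (ell n).
    rewrite lnM ?posrE//; last by lra.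
    by rewrite lnXn; [rewrite mulr_natl|lra].
  have h3 : ln 3 <= 2 :> R.
    by have := @le_ln1Dx R 2 ltac:(lra); rewrite (_ : 1 + 2 = 3)//; lra.
  have h4 : ln n%:R <= harm R n.
    have np : 0 < n%:R :> R by rewrite ltr0n.
    have np1 : 0 < n%:R + 1 :> R by lra.
    by apply: le_trans (ln_le_harm R n); rewrite ler_ln ?posrE// lerDl.
  have h5 : 8 <= q * ln n%:R by rewrite mulrC -ler_pdivrMr.
  have h6 : q * ln n%:R <= q * harm R n by rewrite ler_wpM2l// ltW.
  lra.
have hn1 := harm_ge1 R n; have ha1 := harm_ge1 R a.
have an : (a <= n)%N.
  rewrite leqNgt; apply/negP => na; have := harm_mono R (ltnW na); nra.
have hexp : expR (g * (ln (harm R a) - ln (harm R n))) <= M / 2.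
  have -> : M / 2 = expR (g * (ln (M / 2) / g)).
    by rewrite [g * _]mulrC divfK ?gt_eqF// lnK.
  rewrite ler_expR ler_wpM2l ?(ltW g0)// lerBlDr.
  have -> : ln (M / 2) / g = ln q by rewrite expRK.
  rewrite -lnM ?posrE//; last by lra.
  by rewrite ler_ln ?posrE ?mulr_gt0//; lra.
have mass x : x \in ball0 (ell n) -> massle (killed Q (fun z => 1 - delta R x z) n) M.
  move=> xb s us; apply: le_trans (Hmass n a x m0a an _ s us) _; last by lra.
  have lpos : 0 <= ell n by lra.
  have := normsq_ball0 lpos xb => /le_lt_trans/(_ a1).
  by rewrite -[a%:R]/(a%:Z%:~R) ltr_int => /ltW.
have t0 : 0 < eps * ell n ^+ 2 by rewrite mulr_gt0//; apply: exprn_gt0; lra.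
have HE := expect_vacant_ball B Q_dist Q_critical t0 mass.
have lp2 : 0 < ell n ^+ 2 by apply: exprn_gt0; lra.
have b2 : (eps * ell n ^+ 2)^-1 * ((size (ball0 (ell n)))%:R * M) <= eps^-1 * (9 * M).
  rewrite mulrC ler_pdivrMr// -mulrA.
  have -> : eps^-1 * (9 * M * (eps * ell n ^+ 2)) = 9 * ell n ^+ 2 * M.
    by field; rewrite gt_eqF.
  by rewrite ler_wpM2r ?(ltW M0)//; exact: size_ball0.
have HE' : (\int[P]_w (count (fun y => eps * ell n ^+ 2 < (vacant (ball0 (ell n)) (pos n w) y)%:R)%R
    (pos n w))%:R%:E <= (eps^-1 * (9 * M))%:E)%E.
  by apply: (le_trans HE); rewrite lee_fin.
apply: le_trans (HC n (tau n) (fun s y => eps * ell n ^+ 2 < (vacant (ball0 (ell n)) s y)%:R)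
  (eps^-1 * (9 * M)) n1 (tau_typical n) _ HE') _.
  by move=> s t y st; rewrite (vacant_perm _ _ st).
have s0 := ltW (surv_gt0 Q_dist Q_critical Q_var_pos Q_var_fin n).
by rewrite lee_fin ler_wpM2r//; lra.
Qed.

Lemma particles_small (p : R) : 0 < p -> exists la : R, 0 < la /\ exists N : nat, forall n, (N <= n)%N ->
  (P (survives B n `&` [set w | (la * (ln n%:R * ell n ^+ 2) <=
     (crowd (ball0 (ell n)) (pos n w) (location B (tau n w) w))%:R)%R]) <= (p * surv n)%:E)%E.
Proof.
move=> p0; have p2 : 0 < p / 2 by rewrite divr_gt0.
have [C C0 [N1 HC]] := typical_small B Q_dist Q_critical Q_var_pos Q_var_fin p2.
have v0 := s2_gt0 Q_var_pos Q_var_fin.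
(* 216 = 2 * 3 * 9 * 4, from p / 2, the factor 3 of [expect_crowd], the 9 of [size_ball0] and harm n
   <= 4 ln n; the summand 4 makes sg <= 1/4. *)
pose la : R := 216 * C * s2 Q / p + 4.
have hla0 : 0 <= 216 * C * s2 Q / p.
  by apply: divr_ge0 (ltW p0); apply: mulr_ge0 (ltW v0); apply: mulr_ge0.
have la4 : 4 <= la by rewrite /la; lra.
have la0 : 0 < la by lra.
exists la; split=> //.
have [N2 HN2] := ell_large 1; have [N3 HN3] := ln_large 1.
exists (maxn N1 (maxn N2 (maxn N3 1))) => n hn.
have /and4P[n1 n2 n3 n4] : [&& (N1 <= n), (N2 <= n), (N3 <= n) & (1 <= n)]%N.
  by rewrite -!geq_max.
have l1 := HN2 n n2; have l2 := HN3 n n3.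
have lp2 : 1 <= ell n ^+ 2 by rewrite expr2; nra.
set b := ln n%:R * ell n ^+ 2.
have b1 : 1 <= b by rewrite /b; nra.
have lb : 4 <= la * b by nra.
have lb0 : 0 < la * b by lra.
pose sg := (la * b)^-1.
have sg0 : 0 <= sg by rewrite invr_ge0 ltW.
have sg4 : sg <= 1 / 4 by rewrite div1r lef_pV2 ?posrE.
have sg01 : 0 <= sg <= 1 by rewrite sg0/=; lra.
have sg04 : 0 <= sg <= 1 / 4 by rewrite sg0/=; lra.
have l0 : 0 <= ell n by lra.
have HE := expect_crowd B Q_dist Q_critical sg04 (ball0_0 l0)
  (crowd_mass Q_dist Q_critical Q_var_pos Q_var_fin n (uniq_ball0 (ell n)) sg01).
set M := s2 Q * _ in HE.
have np : 1 <= n%:R :> R by rewrite ler1n.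
have hh : harm R n <= 4 * ln n%:R.
  apply: (le_trans (harm_le_ln R n)).
  have : ln (n%:R + 1) <= ln (2 * n%:R) :> R by rewrite ler_ln ?posrE; lra.
  rewrite lnM ?posrE//; last by lra.
  have := @le_ln1Dx R 1 ltac:(lra); rewrite (_ : 1 + 1 = 2)//.
  lra.
have hM : C * (3 * M) <= p / 2.
  have h1 : (size (ball0 (ell n)))%:R * harm R n <= 36 * b.
    have := ler_pM (ler0n _ _) (le_trans ler01 (harm_ge1 R n)) (size_ball0 l1) hh.
    by rewrite /b; lra.
  have h2 : C * (3 * M) <= C * s2 Q * 108 / la.
    have -> : C * (3 * M) = 3 * C * s2 Q * sg * ((size (ball0 (ell n)))%:R * harm R n).
      by rewrite /M; ring.
    have -> : C * s2 Q * 108 / la = 3 * C * s2 Q * sg * (36 * b).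
      by rewrite /sg; field; rewrite !gt_eqF//; lra.
    by apply: ler_wpM2l => //; apply: mulr_ge0 sg0; apply: mulr_ge0 (ltW v0); apply: mulr_ge0.
  apply: (le_trans h2); rewrite ler_pdivrMr//.
  have -> : p / 2 * la = C * s2 Q * 108 + p * 2 by rewrite /la; field; rewrite gt_eqF.
  lra.
pose bad s y := 1 <= sg * (crowd (ball0 (ell n)) s y)%:R.
have badE s y : (la * b <= (crowd (ball0 (ell n)) s y)%:R) = bad s y.
  by rewrite /bad /sg ler_pdivlMl// mulr1.
under eq_set do rewrite badE.
have s0 := ltW (surv_gt0 Q_dist Q_critical Q_var_pos Q_var_fin n).
apply: le_trans (HC n (tau n) bad (3 * M) n1 (tau_typical n) _ HE) _.
  by move=> s t y st; rewrite /bad (crowd_perm _ _ st).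
by rewrite lee_fin ler_wpM2r//; lra.
Qed.

End main.

Theorem theorem8 (R : realType) (d : measure_display) (T : measurableType d)
    (P : probability T R) (Q : nat -> R)
    (Q_dist : is_distribution Q)
    (Q_critical : dist_mean Q = 1%E)
    (Q_var_pos : (0 < dist_variance Q)%E)
    (Q_var_fin : (dist_variance Q < +oo)%E)
    (B : branching_random_walk P 2 Q)
    (tau : nat -> T -> label)
    (tau_typical : forall n, typical_particle B n (tau n))
    (ell : nat -> R)
    (ell_infty : ell n @[n --> \oo] --> +oo)
    (ell_subpoly : ln (ell n) / ln n%:R @[n --> \oo] --> (0 : R)) :
  let S := fun n w => location B (tau n w) w in
  is_o_P P (survives B)
    (fun n w => (num_unoccupied B n (site_ball (S n w) (ell n)) w)%:R)
    (fun n => ell n ^+ 2)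
  /\
  is_O_P P (survives B)
    (fun n w => (num_particles B n (site_ball (S n w) (ell n)) w)%:R)
    (fun n => ln n%:R * ell n ^+ 2).
Proof.
move=> S.
have PS n : P (survives B n) = (surv Q n)%:E by exact: prob_survives.
have PS0 n : (0 < P (survives B n))%E by rewrite PS lte_fin surv_gt0.
have ell_pos : exists N : nat, forall n, (N <= n)%N -> 0 < ell n.
  have /cvgryPgt/(_ 0) [N _ HN] := ell_infty.
  by exists N => n Nn; exact: HN.
have ln_pos n : (2 <= n)%N -> 0 < ln n%:R :> R by move=> n2; rewrite ln_gt0// ltr1n.
split.
  apply: is_o_P_of_small => //.
    move=> n A.
    (* [measurable_bad_event] works with boolean predicates, so membership in A is reflected
       classically. *)
    pose bad s y := `[< A (vacant (ball0 (ell n)) s y)%:R >].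
    have := measurable_bad_event (tau_typical n) bad.
    congr measurable; congr (_ `&` _); apply/seteqP; split => w /=;
      by rewrite num_unoccupiedE => /asboolP.
  move=> e p e0 p0.
  have [N1 HN1] := vacant_small Q_dist Q_critical Q_var_pos Q_var_fin tau_typical ell_infty ell_subpoly e0 p0.
  have [N2 HN2] := ell_pos.
  exists (maxn N1 N2) => n; rewrite geq_max => /andP[n1 n2].
  rewrite PS /=; have := HN1 n n1; congr (P (_ `&` _) <= _)%E.
  have l2 : 0 < ell n ^+ 2 by apply: exprn_gt0; exact: HN2.
  apply/funext => w /=; rewrite num_unoccupiedE ger0_norm ?ltr_pdivlMr//.
  by rewrite divr_ge0// ltW.
apply: is_O_P_of_tail => //.
  move=> n A.
  pose bad s y := `[< A (crowd (ball0 (ell n)) s y)%:R >].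
  have := measurable_bad_event (tau_typical n) bad.
  congr measurable; congr (_ `&` _); apply/seteqP; split => w /=;
    by rewrite num_particlesE => /asboolP.
move=> p p0.
have [la [la0 [N1 HN1]]] := particles_small Q_dist Q_critical Q_var_pos Q_var_fin tau_typical ell_infty p0.
have [N2 HN2] := ell_pos.
(* From n = 2 on ln n is positive, so the normalisation can be multiplied out. *)
exists la, (maxn N1 (maxn N2 2)) => n; rewrite !geq_max => /and3P[n1 n2 n3].
rewrite PS /=; have := HN1 n n1; congr (P (_ `&` _) <= _)%E.
have l2 : 0 < ln n%:R * ell n ^+ 2 by rewrite mulr_gt0 ?ln_pos//; apply: exprn_gt0; exact: HN2.
by apply/funext => w /=; rewrite num_particlesE ler_pdivlMr.
Qed.
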